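(* Let $R$ be an associative unital ring. The following conditions on $R$ are equivalent. (i) $R$ is left perfect. (ii) Every semi-flat $R$-complex is semi-projective. (iii) Every $R$-complex has a pure-minimal semi-projective resolution.
   Context: $R$-modules are left modules; right $R$-modules are modules over the opposite ring $R^\circ$. $R$ is left perfect if and only if every flat (left) $R$-module is projective. An $R$-complex is a (possibly unbounded) chain complex $M$ of $R$-modules, indexed homologically; $Z_i(M)=\operatorname{Ker}(\partial_i^M)$; $\mathcal{C}(R)$ is the category of $R$-complexes and chain maps, with hom-sets $\operatorname{hom}_{\mathcal{C}(R)}(L,M)$. An $R$-complex $F$ is semi-flat if every $F_i$ is flat and the total tensor product functor $-\otimes_R F$ preserves acyclicity of $R^\circ$-complexes. An $R$-complex $P$ is semi-projective if every $P_i$ is projective and the total Hom functor $\operatorname{Hom}_R(P,-)$ preserves acyclicity of $R$-complexes. A semi-projective resolution of $M$ is a quasi-isomorphism $P\to M$ with $P$ semi-projective; it is called pure-minimal if $P$ is pure-minimal. An exact sequence of $R$-modules is pure if $\operatorname{Hom}_R(A,-)$ leaves it exact for every finitely presented $R$-module $A$. A subcomplex $L\subseteq M$ is pure if $0\to\operatorname{hom}_{\mathcal{C}(R)}(A,L)\to\operatorname{hom}_{\mathcal{C}(R)}(A,M)\to\operatorname{hom}_{\mathcal{C}(R)}(A,M/L)\to 0$ is exact for every bounded complex $A$ of finitely presented $R$-modules. An $R$-complex $M$ is pure-acyclic if it is acyclic and $0\to Z_i(M)\to M_i\to Z_{i-1}(M)\to 0$ is a pure exact sequence of $R$-modules for every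 $i\in\mathbb{Z}$. An $R$-complex is pure-minimal if the zero complex is its only pure-acyclic pure subcomplex. *)

(* Defs.v *)
From HB Require Import structures.
From mathcomp Require Import all_boot all_order all_algebra.
From mathcomp Require Import ring_quotient.
From mathcomp Require Import mathcomp_extra boolp classical_sets functions.
From mathcomp Require Import cardinality fsbigop.
From mathcomp Require Import freeg.
From mathcomp Require Import zify.

Set Implicit Arguments.
Unset Strict Implicit.
Unset Printing Implicit Defensive.

Import GRing.Theory.
Local Open Scope ring_scope.
Local Open Scope quotient_scope.
Local Open Scope classical_set_scope.

(** * Exactness *)

Definition surjective (T U : Type) (f : T -> U) := forall y, exists x, f x = y.

Definition exact_at (U V W : zmodType) (f : U -> V) (g : V -> W) :=
  forall y, g y = 0 <-> exists x, f x = y.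

Definition short_exact (U V W : zmodType) (f : U -> V) (g : V -> W) :=
  [/\ injective f, exact_at f g & surjective g].

(** * Products and direct sums of families of abelian groups *)

Section DProd.
Variables (I : Type) (V : I -> zmodType).

(* A named product, so that it can carry the pointwise group structure. *)
Definition dprod := forall i, V i.

HB.instance Definition _ := gen_eqMixin dprod.
HB.instance Definition _ := gen_choiceMixin dprod.

Lemma dprodP (f g : dprod) : (forall i, f i = g i) -> f = g.
Proof. exact: functional_extensionality_dep. Qed.

Definition dprod_zero : dprod := fun i => 0.
Definition dprod_opp (f : dprod) : dprod := fun i => - f i.
Definition dprod_add (f g : dprod) : dprod := fun i => f i + g i.

Fact dprod_addA : associative dprod_add.
Proof. by move=> f g h; apply: dprodP => i; exact: addrA. Qed.
Fact dprod_addC : commutative dprod_add.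
Proof. by move=> f g; apply: dprodP => i; exact: addrC. Qed.
Fact dprod_add0 : left_id dprod_zero dprod_add.
Proof. by move=> f; apply: dprodP => i; exact: add0r. Qed.
Fact dprod_addN : left_inverse dprod_zero dprod_opp dprod_add.
Proof. by move=> f; apply: dprodP => i; exact: addNr. Qed.

HB.instance Definition _ := GRing.isZmodule.Build dprod
  dprod_addA dprod_addC dprod_add0 dprod_addN.

End DProd.

Section DirSum.
Variables (I : choiceType) (V : I -> zmodType).

Definition finsupp : {pred dprod V} :=
  fun f => `[< finite_set [set i | f i != 0] >].

Fact finsupp_closed : zmod_closed finsupp.
Proof.
split.
  by apply/asboolP/(sub_finite_set _ (finite_set0 I)) => i /=; rewrite eqxx.
move=> f g /asboolP ff /asboolP fg; apply/asboolP.
have /sub_finite_set: [set i | (f - g) i != 0] `<=`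
    ([set i | f i != 0] `|` [set i | g i != 0]).
  move=> i /=; case: (eqVneq (f i) 0) => [f0|]; last by left.
  case: (eqVneq (g i) 0) => [g0|]; last by right.
  by rewrite /GRing.add/= /GRing.opp/= /dprod_add /dprod_opp f0 g0 subr0 eqxx.
by apply; rewrite finite_setU.
Qed.
HB.instance Definition _ :=
  GRing.isZmodClosed.Build (dprod V) finsupp finsupp_closed.

Record dirsum := DirSum { dirsum_val : dprod V; _ : dirsum_val \in finsupp }.
HB.instance Definition _ := [isSub for dirsum_val].
HB.instance Definition _ := [Choice of dirsum by <:].
HB.instance Definition _ := [SubChoice_isSubZmodule of dirsum by <:].

Definition dirsum_proj (f : dirsum) : forall i, V i := dirsum_val f.
Coercion dirsum_proj : dirsum >-> Funclass.

Lemma dirsumP (f g : dirsum) : (forall i, f i = g i) -> f = g.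
Proof. by move=> h; apply/val_inj/dprodP. Qed.

Definition dirsum_inj_fun i (x : V i) : dprod V :=
  fun j => if i =P j is ReflectT e then ecast k (V k) e x else 0.

Fact dirsum_inj_fun_finsupp i x : @dirsum_inj_fun i x \in finsupp.
Proof.
apply/asboolP/(sub_finite_set _ (finite_set1 i)) => j /=.
by rewrite /dirsum_inj_fun; case: eqP => // _; rewrite eqxx.
Qed.

Definition dirsum_inj i (x : V i) : dirsum := DirSum (dirsum_inj_fun_finsupp x).

Lemma dirsum_injE i (x : V i) : dirsum_inj x i = x.
Proof.
by rewrite /= /dirsum_inj_fun; case: eqP => // e; rewrite (eq_irrelevance e erefl).
Qed.

Lemma dirsum_inj_out i j (x : V i) : i != j -> dirsum_inj x j = 0.
Proof. by rewrite /= /dirsum_inj_fun; case: eqP. Qed.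

Fact dirsum_inj_is_zmod_morphism i : zmod_morphism (@dirsum_inj i).
Proof.
move=> x y; apply: dirsumP => j; rewrite /= /dirsum_inj_fun /=.
rewrite /GRing.opp/= /GRing.add/= /dprod_add /dprod_opp /=.
by case: eqP => [e|_]; [case: _ / e | rewrite oppr0 addr0].
Qed.
HB.instance Definition _ i :=
  GRing.isZmodMorphism.Build (V i) dirsum (@dirsum_inj i)
    (@dirsum_inj_is_zmod_morphism i).

Section Lift.
Variables (W : zmodType) (F : forall i, {additive V i -> W}).

Definition dirsum_lift (f : dirsum) : W := \sum_(i \in [set: I]) F i (f i).

Lemma dirsum_liftE (A : set I) (f : dirsum) : finite_set A ->
    (forall i, ~ A i -> f i = 0) -> dirsum_lift f = \sum_(i \in A) F i (f i).
Proof.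
move=> fA f0; apply/esym/fsbig_widen => // i [_ /= /f0 ->]; exact: raddf0.
Qed.

Lemma dirsum_supp (f : dirsum) :
  finite_set [set i | f i != 0] /\ (forall i, ~ [set i | f i != 0] i -> f i = 0).
Proof.
split; first by case: f => f /= /asboolP.
by move=> i /= /negP; rewrite negbK => /eqP.
Qed.

Fact dirsum_lift_is_zmod_morphism : zmod_morphism dirsum_lift.
Proof.
move=> f g; have [fS f0] := dirsum_supp f; have [gS g0] := dirsum_supp g.
set A := [set i | f i != 0] `|` [set i | g i != 0].
have fA : finite_set A by rewrite finite_setU.
have f0' i : ~ A i -> f i = 0 by move=> Ai; apply: f0 => fi; apply: Ai; left.
have g0' i : ~ A i -> g i = 0 by move=> Ai; apply: g0 => gi; apply: Ai; right.
rewrite !(@dirsum_liftE A) //; last first.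
  by move=> i Ai; rewrite -[LHS]/(f i - g i) f0' // g0' // subr0.
rewrite !fsbig_finite //= -sumrB; apply: eq_bigr => i _.
by rewrite -raddfB.
Qed.
HB.instance Definition _ :=
  GRing.isZmodMorphism.Build dirsum W dirsum_lift dirsum_lift_is_zmod_morphism.

Lemma dirsum_lift_inj i (x : V i) : dirsum_lift (dirsum_inj x) = F i x.
Proof.
rewrite (@dirsum_liftE [set i]) ?fsbig_set1 ?dirsum_injE //.
by move=> j /eqP ji; rewrite dirsum_inj_out // eq_sym.
Qed.

End Lift.

Lemma dirsum_ext (W : zmodType) (a b : {additive dirsum -> W}) :
  (forall i (x : V i), a (dirsum_inj x) = b (dirsum_inj x)) -> a =1 b.
Proof.
move=> ab f; have [fS f0] := dirsum_supp f.
suff -> : f = \sum_(i <- finmap.enum_fset (fset_set [set i | f i != 0])) dirsum_inj (f i).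
  by rewrite !raddf_sum; apply: eq_bigr => i _; exact: ab.
apply: dirsumP => j.
pose p (h : dirsum) : V j := h j.
have pD : zmod_morphism p by [].
pose pA : {additive dirsum -> V j} := HB.pack p (GRing.isZmodMorphism.Build _ _ p pD).
rewrite -[RHS]/(pA _) raddf_sum.
rewrite [RHS](eq_bigr (fun i => dirsum_inj (f i) j)) //.
have [fj0|fjN0] := eqVneq (f j) 0.
  rewrite big1_seq // => i _.
  have [->|ij] := eqVneq i j; last by rewrite dirsum_inj_out.
  by rewrite fj0 dirsum_injE.
rewrite (bigD1_seq j) ?finmap.fset_uniq //; last by rewrite in_fset_set // inE.
rewrite dirsum_injE big1 => [|i ij]; first exact/esym/addr0.
exact: dirsum_inj_out.
Qed.

End DirSum.


(** * Submodules, quotient modules, and groups of linear maps *)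

Record submodule (R : pzRingType) (M : lmodType R) := Submodule {
  submodule_mem :> {pred M};
  submodule_closed : submod_closed submodule_mem }.
HB.instance Definition _ (R : pzRingType) (M : lmodType R) (S : submodule M) :=
  GRing.isSubmodClosed.Build R M (submodule_mem S)
    (GRing.submod_closed_semi (submodule_closed S)).

Section Submodule.
Variables (R : pzRingType) (M : lmodType R) (S : submodule M).

Record submod := Submod { submod_val : M; _ : submod_val \in submodule_mem S }.
HB.instance Definition _ := [isSub for submod_val].
HB.instance Definition _ := [Choice of submod by <:].
HB.instance Definition _ := [SubChoice_isSubZmodule of submod by <:].
HB.instance Definition _ := [SubZmodule_isSubLmodule of submod by <:].

Definition submod_incl (x : submod) : M := val x.
Fact submod_incl_is_linear : linear submod_incl.
Proof. by move=> a x y; rewrite /submod_incl linearP. Qed.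
HB.instance Definition _ :=
  GRing.isLinear.Build R submod M *:%R submod_incl submod_incl_is_linear.

End Submodule.

Section QuotientModule.
Variables (R : pzRingType) (M : lmodType R) (S : submodule M).

Definition quotmod := (Quotient.quot (submodule_mem S)).
HB.instance Definition _ := GRing.Zmodule.on quotmod.

Definition quotmod_pi (x : M) : quotmod := \pi_(Quotient.quot (submodule_mem S)) x.

Lemma quotmod_eq x y : (quotmod_pi x == quotmod_pi y) = (x - y \in S).
Proof. by rewrite -Quotient.idealrBE. Qed.

Lemma quotmod_piP (q : quotmod) : exists x, quotmod_pi x = q.
Proof. by exists (repr q); exact: reprK. Qed.

Fact quotmod_pi_is_zmod_morphism : zmod_morphism quotmod_pi.
Proof. by move=> x y; rewrite /quotmod_pi raddfB. Qed.

Definition quotmod_scale (a : R) (q : quotmod) : quotmod :=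
  quotmod_pi (a *: repr q).

Lemma quotmod_scaleE a x : quotmod_scale a (quotmod_pi x) = quotmod_pi (a *: x).
Proof.
apply/eqP; rewrite quotmod_eq -scalerBr rpredZ // -quotmod_eq.
by apply/eqP; exact: reprK.
Qed.

Fact quotmod_scaleA a b q :
  quotmod_scale a (quotmod_scale b q) = quotmod_scale (a * b) q.
Proof. by have [x <-] := quotmod_piP q; rewrite !quotmod_scaleE scalerA. Qed.
Fact quotmod_scale1 : left_id 1 quotmod_scale.
Proof. by move=> q; have [x <-] := quotmod_piP q; rewrite quotmod_scaleE scale1r. Qed.
Fact quotmod_piD x y : quotmod_pi (x + y) = quotmod_pi x + quotmod_pi y.
Proof. exact: raddfD. Qed.
Fact quotmod_scaleDr : right_distributive quotmod_scale +%R.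
Proof.
move=> a p q; have [x <-] := quotmod_piP p; have [y <-] := quotmod_piP q.
by rewrite -quotmod_piD !quotmod_scaleE -quotmod_piD scalerDr.
Qed.
Fact quotmod_scaleDl q : {morph quotmod_scale^~ q : a b / a + b}.
Proof.
move=> a b; have [x <-] := quotmod_piP q.
by rewrite !quotmod_scaleE -quotmod_piD scalerDl.
Qed.
HB.instance Definition _ := GRing.Zmodule_isLmodule.Build R quotmod
  quotmod_scaleA quotmod_scale1 quotmod_scaleDr quotmod_scaleDl.

Fact quotmod_pi_is_linear : linear quotmod_pi.
Proof. by move=> a x y; rewrite quotmod_piD -quotmod_scaleE. Qed.
HB.instance Definition _ :=
  GRing.isLinear.Build R M quotmod *:%R quotmod_pi quotmod_pi_is_linear.

End QuotientModule.

Section Hom.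
Variables (R : pzRingType) (U V : lmodType R).

Definition lhom := {linear U -> V}.

Lemma lhomP (f g : lhom) : f =1 g -> f = g.
Proof.
case: f g => f [[fm] [fz]] [g [[gm] [gz]]] /= fg.
have {fg} fg : f = g by exact/funext.
by case: _ / fg gm gz => gm gz; congr GRing.Linear.Pack;
  congr GRing.Linear.Class; congr (_ _); exact: Prop_irrelevance.
Qed.

HB.instance Definition _ := gen_eqMixin lhom.
HB.instance Definition _ := gen_choiceMixin lhom.

Definition lhom_zero : lhom := \0.
Definition lhom_opp (f : lhom) : lhom := \- f.
Definition lhom_add (f g : lhom) : lhom := f \+ g.

Fact lhom_addA : associative lhom_add.
Proof. by move=> f g h; apply: lhomP => x; exact: addrA. Qed.
Fact lhom_addC : commutative lhom_add.
Proof. by move=> f g; apply: lhomP => x; exact: addrC. Qed.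
Fact lhom_add0 : left_id lhom_zero lhom_add.
Proof. by move=> f; apply: lhomP => x; exact: add0r. Qed.
Fact lhom_addN : left_inverse lhom_zero lhom_opp lhom_add.
Proof. by move=> f; apply: lhomP => x; exact: addNr. Qed.
HB.instance Definition _ := GRing.isZmodule.Build lhom
  lhom_addA lhom_addC lhom_add0 lhom_addN.

End Hom.

(** * Tensor products *)

Section Tensor.
Variables (R : pzRingType) (X : lmodType R^c) (F : lmodType R).

(* Right R-modules are left modules over the converse ring R^c, so that
   (r : R^c) *: x is the right multiple x r. The tensor product is the free
   abelian group on X * F modulo the subgroup generated by the biadditivity and
   balancing relations. *)
Definition tensor_rel : {pred {freeg (X * F)%type}} := fun t =>
  `[< forall S : {pred {freeg (X * F)%type}}, zmod_closed S ->
      (forall x x' y, << (x + x', y) >> - << (x, y) >> - << (x', y) >> \in S) ->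
      (forall x y y', << (x, y + y') >> - << (x, y) >> - << (x, y') >> \in S) ->
      (forall (r : R) x y,
         << ((r : R^c) *: x, y) >> - << (x, r *: y) >> \in S) ->
      t \in S >].

Fact tensor_rel_closed : zmod_closed tensor_rel.
Proof.
split; first by apply/asboolP => S [].
move=> t u /asboolP tS /asboolP uS; apply/asboolP => S Sz Sl Sr Sb.
by case: (Sz) => _; apply; [exact: tS | exact: uS].
Qed.
HB.instance Definition _ :=
  GRing.isZmodClosed.Build {freeg (X * F)%type} tensor_rel tensor_rel_closed.

Definition tensor := Quotient.quot tensor_rel.
HB.instance Definition _ := GRing.Zmodule.on tensor.

Definition tensor_pi (t : {freeg (X * F)%type}) : tensor :=
  \pi_(Quotient.quot tensor_rel) t.
Fact tensor_pi_is_zmod_morphism : zmod_morphism tensor_pi.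
Proof. by move=> t u; rewrite /tensor_pi raddfB. Qed.
HB.instance Definition _ := GRing.isZmodMorphism.Build
  {freeg (X * F)%type} tensor tensor_pi tensor_pi_is_zmod_morphism.

Definition tens (x : X) (y : F) : tensor := tensor_pi << (x, y) >>.

Lemma tensor_pi_eq t u : (tensor_pi t == tensor_pi u) = (t - u \in tensor_rel).
Proof. by rewrite -Quotient.idealrBE. Qed.

Lemma tensDl x x' y : tens (x + x') y = tens x y + tens x' y.
Proof.
apply/eqP; rewrite /tens -raddfD /= tensor_pi_eq opprD addrA.
by apply/asboolP => S _ + _ _; exact.
Qed.

Lemma tensDr x y y' : tens x (y + y') = tens x y + tens x y'.
Proof.
apply/eqP; rewrite /tens -raddfD /= tensor_pi_eq opprD addrA.
by apply/asboolP => S _ _ + _; exact.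
Qed.

Lemma tens_scale (r : R) x y : tens ((r : R^c) *: x) y = tens x (r *: y).
Proof.
by apply/eqP; rewrite /tens tensor_pi_eq; apply/asboolP => S _ _ _; exact.
Qed.

Lemma tensor_ext (W : zmodType) (a b : {additive tensor -> W}) :
  (forall x y, a (tens x y) = b (tens x y)) -> a =1 b.
Proof.
move=> ab t; rewrite -[t]reprK -/(tensor_pi _) -[repr t]freeg_sumE.
rewrite 3!raddf_sum; apply: eq_bigr => -[x y] _ /=.
by rewrite -[coeff _ _]intz -freegU_mulz !raddfMz; congr (_ *~ _); exact: ab.
Qed.

Section TensorLift.
Variables (W : zmodType) (b : X -> F -> W).
Hypotheses (bDl : forall x x' y, b (x + x') y = b x y + b x' y)
  (bDr : forall x y y', b x (y + y') = b x y + b x y')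
  (b_scale : forall (r : R) x y, b ((r : R^c) *: x) y = b x (r *: y)).

Let bf (t : {freeg (X * F)%type}) : W :=
  fglift (fun z => b z.1 z.2 : zmodule W) t.

Let bfB : zmod_morphism bf.
Proof. exact: (@lift_is_additive int (X * F)%type (zmodule W)). Qed.

Let bfU x y : bf << (x, y) >> = b x y.
Proof. by rewrite /bf liftU scale1r. Qed.

Let bf_rel t : t \in tensor_rel -> bf t = 0.
Proof.
move/asboolP/(_ (fun t => `[< bf t = 0 >])) => h; apply/asboolP; apply: h.
- split; first by apply/asboolP; have := bfB 0 0; rewrite !subrr.
  by move=> u v /asboolP u0 /asboolP v0; apply/asboolP; rewrite bfB u0 v0 subrr.
- by move=> x x' y; apply/asboolP; rewrite !bfB !bfU bDl addrAC addrK subrr.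
- by move=> x y y'; apply/asboolP; rewrite !bfB !bfU bDr addrAC addrK subrr.
- by move=> r x y; apply/asboolP; rewrite !bfB !bfU b_scale subrr.
Qed.

Definition tensor_lift (t : tensor) : W :=
  fglift (fun z => b z.1 z.2 : zmodule W) (repr t).

Let tensor_lift_pi t : tensor_lift (tensor_pi t) = bf t.
Proof.
apply/eqP; rewrite -subr_eq0 -/(bf _) -bfB; apply/eqP/bf_rel.
by rewrite -tensor_pi_eq; apply/eqP; exact: reprK.
Qed.

Lemma tensor_lift_tens x y : tensor_lift (tens x y) = b x y.
Proof. by rewrite tensor_lift_pi bfU. Qed.

Lemma tensor_lift_is_zmod_morphism : zmod_morphism tensor_lift.
Proof.
move=> t u; rewrite -[t]reprK -[u]reprK -!/(tensor_pi _) -raddfB.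
by rewrite !tensor_lift_pi bfB.
Qed.

End TensorLift.

End Tensor.

Section TensorMap.
Variables (R : pzRingType) (X X' : lmodType R^c) (F F' : lmodType R).
Variables (f : {linear X -> X'}) (g : {linear F -> F'}).

Definition tensor_map : tensor X F -> tensor X' F' :=
  tensor_lift (fun x y => tens (f x) (g y)).

Let fgDl x x' y : tens (f (x + x')) (g y) = tens (f x) (g y) + tens (f x') (g y).
Proof. by rewrite raddfD tensDl. Qed.
Let fgDr x y y' : tens (f x) (g (y + y')) = tens (f x) (g y) + tens (f x) (g y').
Proof. by rewrite raddfD tensDr. Qed.
Let fg_scale (r : R) x y :
  tens (f ((r : R^c) *: x)) (g y) = tens (f x) (g (r *: y)).
Proof. by rewrite !linearZ tens_scale. Qed.

Lemma tensor_mapE x y : tensor_map (tens x y) = tens (f x) (g y).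
Proof. exact: tensor_lift_tens. Qed.

Fact tensor_map_is_zmod_morphism : zmod_morphism tensor_map.
Proof. exact: tensor_lift_is_zmod_morphism. Qed.
HB.instance Definition _ := GRing.isZmodMorphism.Build
  (tensor X F) (tensor X' F') tensor_map tensor_map_is_zmod_morphism.

End TensorMap.

(** * Classes of modules and rings *)

Definition flat (R : pzRingType) (F : lmodType R) :=
  forall (X Y Z : lmodType R^c) (f : {linear X -> Y}) (g : {linear Y -> Z}),
    exact_at f g ->
    exact_at (tensor_map f (idfun : {linear F -> F}))
             (tensor_map g (idfun : {linear F -> F})).

Definition projective (R : pzRingType) (P : lmodType R) :=
  forall (M N : lmodType R) (g : {linear M -> N}) (f : {linear P -> N}),
    surjective g -> exists h : {linear P -> M}, forall x, g (h x) = f x.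

(* Bass' characterization, taken as the definition: flat implies projective. *)
Definition left_perfect (R : pzRingType) :=
  forall F : lmodType R, flat F -> projective F.

Definition finitely_presented (R : pzRingType) (A : lmodType R) :=
  exists (m n : nat) (f : {linear 'rV[R]_m -> 'rV[R]_n})
    (g : {linear 'rV[R]_n -> A}), exact_at f g /\ surjective g.

Section HomEval.
Variables (R : pzRingType) (U V : lmodType R).

Definition lhom_eval (x : U) (f : lhom U V) : V := f x.
Fact lhom_eval_is_zmod_morphism x : zmod_morphism (lhom_eval x).
Proof. by []. Qed.
HB.instance Definition _ x := GRing.isZmodMorphism.Build _ _
  (lhom_eval x) (lhom_eval_is_zmod_morphism x).
End HomEval.

Section HomFunctor.
Variables (R : pzRingType) (A B M N : lmodType R).

Definition lhom_post (f : {linear M -> N}) (h : lhom A M) : lhom A N := f \o h.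
Definition lhom_pre (f : {linear A -> B}) (h : lhom B M) : lhom A M := h \o f.

Fact lhom_post_is_zmod_morphism f : zmod_morphism (lhom_post f).
Proof. by move=> g h; apply: lhomP => x; exact: raddfB. Qed.
Fact lhom_pre_is_zmod_morphism f : zmod_morphism (lhom_pre f).
Proof. by move=> g h; apply: lhomP. Qed.
HB.instance Definition _ f := GRing.isZmodMorphism.Build _ _
  (lhom_post f) (lhom_post_is_zmod_morphism f).
HB.instance Definition _ f := GRing.isZmodMorphism.Build _ _
  (lhom_pre f) (lhom_pre_is_zmod_morphism f).
End HomFunctor.

Definition pure_exact (R : pzRingType) (L M N : lmodType R)
    (f : {linear L -> M}) (g : {linear M -> N}) :=
  short_exact f g /\
  forall A : lmodType R, finitely_presented A ->
    short_exact (lhom_post (A := A) f) (lhom_post (A := A) g).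

(** * Chain complexes *)

(* The differential from degree i to degree j takes a proof of i = j + 1 (proof
   irrelevant, as int has decidable equality) rather than having target M_(i-1),
   so that no transport between provably equal degrees is ever needed. *)
Record zcomplex := ZComplex {
  zobj :> int -> zmodType;
  zdiff : forall i j : int, i = j + 1 -> {additive zobj i -> zobj j};
  zdiffK : forall (i j k : int) (e : i = j + 1) (e' : j = k + 1) x,
    zdiff e' (zdiff e x) = 0 }.
Arguments zdiff C {i j} e : rename.

Record complex (R : pzRingType) := Complex {
  cobj :> int -> lmodType R;
  cdiff : forall i j : int, i = j + 1 -> {linear cobj i -> cobj j};
  cdiffK : forall (i j k : int) (e : i = j + 1) (e' : j = k + 1) x,
    cdiff e' (cdiff e x) = 0 }.
Arguments cdiff {R} C {i j} e : rename.

Definition zcomplex_of (R : pzRingType) (M : complex R) : zcomplex :=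
  
  @ZComplex (fun i => cobj M i) (fun i j e => cdiff M e) (@cdiffK R M).
Coercion zcomplex_of : complex >-> zcomplex.

Definition acyclic (C : zcomplex) :=
  forall (i j k : int) (e : i = j + 1) (e' : j = k + 1),
    exact_at (zdiff C e) (zdiff C e').

Lemma pred_succ (i : int) : i = i - 1 + 1.
Proof. by rewrite subrK. Qed.

(** ** Chain maps *)

Section ChainMap.
Variables (R : pzRingType) (L M : complex R).

Definition chain_map_pred : {pred dprod (fun i : int => lhom (L i) (M i))} :=
  fun f => `[< forall (i j : int) (e : i = j + 1) x,
                 f j (cdiff L e x) = cdiff M e (f i x) >].

Fact chain_map_closed : zmod_closed chain_map_pred.
Proof.
split; first by apply/asboolP => i j e x; rewrite /= raddf0.
move=> f g /asboolP fP /asboolP gP; apply/asboolP => i j e x.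
rewrite -[LHS]/(f j (cdiff L e x) - g j (cdiff L e x)) fP gP -raddfB.
by [].
Qed.
HB.instance Definition _ :=
  GRing.isZmodClosed.Build _ chain_map_pred chain_map_closed.

Record chain_map := ChainMap {
  chain_map_val : dprod (fun i : int => lhom (L i) (M i));
  _ : chain_map_val \in chain_map_pred }.
HB.instance Definition _ := [isSub for chain_map_val].
HB.instance Definition _ := [Choice of chain_map by <:].
HB.instance Definition _ := [SubChoice_isSubZmodule of chain_map by <:].

Definition chain_map_at (f : chain_map) : forall i : int, {linear L i -> M i} :=
  chain_map_val f.
Coercion chain_map_at : chain_map >-> Funclass.

Lemma chain_mapP (f : chain_map) (i j : int) (e : i = j + 1) x :
  f j (cdiff L e x) = cdiff M e (f i x).
Proof. by have /asboolP := valP f; apply. Qed.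

Lemma mk_chain_map_subproof (f : forall i : int, {linear L i -> M i}) :
  (forall (i j : int) (e : i = j + 1) x, f j (cdiff L e x) = cdiff M e (f i x)) ->
  (f : dprod (fun i : int => lhom (L i) (M i))) \in chain_map_pred.
Proof. by move=> fP; apply/asboolP. Qed.

Definition mk_chain_map f fP : chain_map :=
  ChainMap (@mk_chain_map_subproof f fP).

End ChainMap.

Section ChainMapComp.
Variables (R : pzRingType) (A M N : complex R) (f : chain_map M N).

Fact chain_map_post_subproof (h : chain_map A M) (i j : int) (e : i = j + 1) x :
  (f j \o h j) (cdiff A e x) = cdiff N e ((f i \o h i) x).
Proof. by rewrite /= !chain_mapP. Qed.

Definition chain_map_post (h : chain_map A M) : chain_map A N :=
  mk_chain_map (f := fun i => f i \o h i) (chain_map_post_subproof h).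

End ChainMapComp.

(** ** Cycles, homology, quasi-isomorphisms *)

Section Kernel.
Variables (R : pzRingType) (M N : lmodType R) (f : {linear M -> N}).

Fact kermod_closed : submod_closed [pred x | f x == 0].
Proof.
split; first by rewrite inE raddf0.
by move=> a x y; rewrite !inE linearP => /eqP-> /eqP->; rewrite scaler0 addr0.
Qed.
Definition kermod : submodule M := Submodule kermod_closed.

Fact immod_closed : submod_closed (fun y => `[< exists x, f x = y >]).
Proof.
split; first by apply/asboolP; exists 0; rewrite raddf0.
move=> a _ _ /asboolP[x <-] /asboolP[y <-]; apply/asboolP.
by exists (a *: x + y); rewrite linearP.
Qed.
Definition immod : submodule N := Submodule immod_closed.
End Kernel.

Section Cycles.
Variables (R : pzRingType) (M : complex R).

Definition cycles (i : int) : lmodType R :=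
  submod (kermod (cdiff M (pred_succ i))).

Definition cycles_incl (i : int) : {linear cycles i -> M i} :=
  @submod_incl _ _ (kermod (cdiff M (pred_succ i))).

Fact to_cycles_subproof (i j : int) (e : i = j + 1) (x : M i) :
  cdiff M e x \in kermod (cdiff M (pred_succ j)).
Proof. by rewrite inE cdiffK. Qed.

Definition to_cycles_fun (i j : int) (e : i = j + 1) (x : M i) : cycles j :=
  Submod (to_cycles_subproof e x).
Fact to_cycles_is_linear i j (e : i = j + 1) : linear (to_cycles_fun e).
Proof. by move=> a x y; apply: val_inj; rewrite /= linearP. Qed.
HB.instance Definition _ i j (e : i = j + 1) :=
  GRing.isLinear.Build R (M i) (cycles j) *:%R (to_cycles_fun e)
    (to_cycles_is_linear e).

(* The corestriction M_i -> Z_j(M) of the differential, for i = j + 1. *)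
Definition to_cycles (i j : int) (e : i = j + 1) : {linear M i -> cycles j} :=
  to_cycles_fun e.

(* B_i(M) is the image of M_(i+1) in Z_i(M). *)
Definition homology (i : int) : lmodType R :=
  quotmod (immod (to_cycles (erefl (i + 1)))).

End Cycles.

Section HomologyMap.
Variables (R : pzRingType) (L M : complex R) (f : chain_map L M).

Fact cycles_map_subproof i (z : cycles L i) :
  f i (val z) \in kermod (cdiff M (pred_succ i)).
Proof.
case: z => z /=; rewrite !inE => /eqP z0.
by rewrite -chain_mapP z0 raddf0.
Qed.
Definition cycles_map i (z : cycles L i) : cycles M i :=
  Submod (cycles_map_subproof z).

(* Computed on a representative cycle; see [homology_mapE]. *)
Definition homology_map i (h : homology L i) : homology M i :=
  quotmod_pi _ (cycles_map (repr h)).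

Lemma homology_mapE i (z : cycles L i) :
  homology_map (quotmod_pi _ z) = quotmod_pi _ (cycles_map z).
Proof.
apply/eqP; rewrite quotmod_eq.
have : repr (quotmod_pi (immod (to_cycles L (erefl (i + 1)))) z) - z
         \in immod (to_cycles L (erefl (i + 1))).
  by rewrite -quotmod_eq; apply/eqP; exact: reprK.
move/asboolP => [x ex]; apply/asboolP; exists (f (i + 1) x).
apply: val_inj; rewrite /= -chain_mapP -raddfB.
by have /(congr1 val) /= -> := ex.
Qed.

End HomologyMap.

Definition quasi_iso (R : pzRingType) (L M : complex R) (f : chain_map L M) :=
  forall i, bijective (homology_map f (i := i)).

(** ** The total tensor product *)

Section TotalTensor.
Variables (R : pzRingType) (X : complex R^c) (F : complex R).

Definition tdeg (n : int) := {pq : int * int | pq.1 + pq.2 == n}.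

Definition total_tensor_summand (n : int) (pq : tdeg n) : zmodType :=
  tensor (X (val pq).1) (F (val pq).2).

Definition total_tensor_obj (n : int) : zmodType :=
  dirsum (@total_tensor_summand n).

Section Diff.
Variables (n m : int) (e : n = m + 1).

Fact tdeg_predl_subproof (pq : tdeg n) : ((val pq).1 - 1) + (val pq).2 == m.
Proof. by rewrite addrAC (eqP (valP pq)) e addrK. Qed.
Fact tdeg_predr_subproof (pq : tdeg n) : (val pq).1 + ((val pq).2 - 1) == m.
Proof. by rewrite addrA (eqP (valP pq)) e addrK. Qed.

Definition tdeg_predl (pq : tdeg n) : tdeg m :=
  exist _ ((val pq).1 - 1, (val pq).2) (tdeg_predl_subproof pq).
Definition tdeg_predr (pq : tdeg n) : tdeg m :=
  exist _ ((val pq).1, (val pq).2 - 1) (tdeg_predr_subproof pq).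

(* d (x (x) y) = dx (x) y + (-1)^p x (x) dy  for x in X_p, y in F_q *)
Definition total_tensor_diff_at (pq : tdeg n)
    (t : total_tensor_summand pq) : total_tensor_obj m :=
  dirsum_inj (i := tdeg_predl pq) (tensor_map (cdiff X (pred_succ _)) idfun t) +
  dirsum_inj (i := tdeg_predr pq) (tensor_map idfun (cdiff F (pred_succ _)) t)
    *~ (-1) ^+ `|(val pq).1|%N.

Fact total_tensor_diff_at_is_zmod_morphism pq :
  zmod_morphism (@total_tensor_diff_at pq).
Proof.
by move=> t u; rewrite /total_tensor_diff_at !raddfB /= mulrzBl opprD addrACA.
Qed.
HB.instance Definition _ pq := GRing.isZmodMorphism.Build _ _
  (@total_tensor_diff_at pq) (@total_tensor_diff_at_is_zmod_morphism pq).

Definition total_tensor_diff :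
    {additive total_tensor_obj n -> total_tensor_obj m} :=
  dirsum_lift (fun pq => @total_tensor_diff_at pq).

Lemma total_tensor_diffE (pq : tdeg n) x y :
  total_tensor_diff (dirsum_inj (tens x y : total_tensor_summand pq)) =
  dirsum_inj (tens (cdiff X (pred_succ _) x) y :
    total_tensor_summand (tdeg_predl pq)) +
  dirsum_inj (tens x (cdiff F (pred_succ _) y) :
    total_tensor_summand (tdeg_predr pq))
    *~ (-1) ^+ `|(val pq).1|%N.
Proof.
rewrite /total_tensor_diff /= dirsum_lift_inj /= /total_tensor_diff_at.
by rewrite !tensor_mapE.
Qed.

End Diff.

Fact tens0l (U : lmodType R^c) (V : lmodType R) (y : V) : tens (0 : U) y = 0.
Proof. by apply: (addIr (tens 0 y)); rewrite -tensDl !add0r. Qed.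
Fact tens0r (U : lmodType R^c) (V : lmodType R) (x : U) : tens x (0 : V) = 0.
Proof. by apply: (addIr (tens x 0)); rewrite -tensDr !add0r. Qed.

Fact sign_pred (p : int) : (-1) ^+ `|p - 1|%N = - (-1) ^+ `|p|%N :> int.
Proof.
rewrite -signr_odd -[in RHS]signr_odd.
have -> : odd `|p - 1| = ~~ odd `|p| by lia.
by case: odd.
Qed.

Fact total_tensor_inj_irr n (v : int * int) (h h' : v.1 + v.2 == n) x :
  @dirsum_inj _ (@total_tensor_summand n) (exist _ v h) x =
  @dirsum_inj _ (@total_tensor_summand n) (exist _ v h') x.
Proof. by rewrite (bool_irrelevance h h'). Qed.

Fact total_tensor_diffK (i j k : int) (e : i = j + 1) (e' : j = k + 1) t :
  total_tensor_diff e' (total_tensor_diff e t) = 0.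
Proof.
pose z : {additive total_tensor_obj i -> total_tensor_obj k} := \0.
rewrite -[RHS]/(z t) -[LHS]/((total_tensor_diff e' \o total_tensor_diff e) t).
apply: dirsum_ext => pq {}t.
pose inj : {additive total_tensor_summand pq -> total_tensor_obj i} :=
  @dirsum_inj _ (@total_tensor_summand i) pq.
rewrite -[LHS]/((total_tensor_diff e' \o total_tensor_diff e \o inj) t).
rewrite -[RHS]/((z \o inj) t).
apply: tensor_ext => x y /=.
rewrite total_tensor_diffE raddfD raddfMz /= !total_tensor_diffE /=.
rewrite !cdiffK tens0l tens0r !raddf0 add0r mul0rz addr0 sign_pred.
rewrite mulrNz; apply/eqP; rewrite addrC subr_eq0; apply/eqP.
by congr (_ *~ _); exact: total_tensor_inj_irr.
Qed.

Definition total_tensor : zcomplex := ZComplex total_tensor_diffK.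

End TotalTensor.

(** ** The total Hom complex *)

Section TotalHom.
Variables (R : pzRingType) (M N : complex R).

Definition hdeg (n : int) := {pq : int * int | pq.2 - pq.1 == n}.

Definition total_hom_obj (n : int) : zmodType :=
  dprod (fun pq : hdeg n => lhom (M (val pq).1) (N (val pq).2)).

Section Diff.
Variables (n m : int) (e : n = m + 1).

Fact hdeg_predl_subproof (pq : hdeg m) : (val pq).2 - ((val pq).1 - 1) == n.
Proof. by rewrite opprB addrCA addrC (eqP (valP pq)) e. Qed.
Fact hdeg_succr_subproof (pq : hdeg m) : ((val pq).2 + 1) - (val pq).1 == n.
Proof. by rewrite addrAC (eqP (valP pq)) e. Qed.

Definition hdeg_predl (pq : hdeg m) : hdeg n :=
  exist _ ((val pq).1 - 1, (val pq).2) (hdeg_predl_subproof pq).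
Definition hdeg_succr (pq : hdeg m) : hdeg n :=
  exist _ ((val pq).1, (val pq).2 + 1) (hdeg_succr_subproof pq).

(* df = d o f - (-1)^n f o d  for f of degree n *)
Definition total_hom_diff_fun (f : total_hom_obj n) : total_hom_obj m :=
  fun pq =>
    lhom_post (cdiff N (erefl ((val pq).2 + 1))) (f (hdeg_succr pq)) -
    lhom_pre (cdiff M (pred_succ (val pq).1)) (f (hdeg_predl pq))
      *~ (-1) ^+ `|n|%N.

Fact total_hom_diff_is_zmod_morphism : zmod_morphism total_hom_diff_fun.
Proof.
move=> f g; apply: dprodP => pq.
rewrite -[RHS]/(total_hom_diff_fun f pq - total_hom_diff_fun g pq).
rewrite /total_hom_diff_fun -[(f - g) _]/(f _ - g _) -[(f - g) _]/(f _ - g _).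
by rewrite !raddfB mulrzBl !opprD !opprK addrACA.
Qed.
HB.instance Definition _ := GRing.isZmodMorphism.Build _ _
  total_hom_diff_fun total_hom_diff_is_zmod_morphism.

Definition total_hom_diff : {additive total_hom_obj n -> total_hom_obj m} :=
  total_hom_diff_fun.

End Diff.

Fact total_hom_irr n (f : total_hom_obj n) (v : int * int)
  (h h' : v.2 - v.1 == n) x :
  f (exist _ v h) x = f (exist _ v h') x.
Proof. by rewrite (bool_irrelevance h h'). Qed.

Fact total_hom_diffK (i j k : int) (e : i = j + 1) (e' : j = k + 1) f :
  total_hom_diff e' (total_hom_diff e f) = 0.
Proof.
apply: dprodP => pq; apply: lhomP => x.
have evM (U V : lmodType R) (g : lhom U V) (s : int) y : (g *~ s) y = g y *~ s.
  exact: (raddfMz (lhom_eval y)).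
pose pq1 := hdeg_predl e (hdeg_succr e' pq).
pose pq2 := hdeg_succr e (hdeg_predl e' pq).
pose pq3 := hdeg_predl e (hdeg_predl e' pq).
rewrite -[LHS]/(cdiff N erefl
    (cdiff N erefl (f (hdeg_succr e (hdeg_succr e' pq)) x) -
     (lhom_pre (cdiff M (pred_succ (val pq).1)) (f pq1) *~ (-1) ^+ `|i|%N) x) -
  (lhom_pre (cdiff M (pred_succ (val pq).1))
     (lhom_post (cdiff N erefl) (f pq2) -
      lhom_pre (cdiff M (pred_succ ((val pq).1 - 1)))
        (f pq3) *~ (-1) ^+ `|i|%N) *~ (-1) ^+ `|j|%N) x).
rewrite !evM -[lhom_pre _ (_ - _) x]/(cdiff N erefl (f pq2 (cdiff M _ x)) -
  (lhom_pre (cdiff M (pred_succ ((val pq).1 - 1))) (f pq3) *~ (-1) ^+ `|i|%N)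
     (cdiff M _ x)).
rewrite evM /lhom_pre /= raddfB raddfMz.
have E : cdiff N (erefl ((val pq).2 + 1)) (cdiff N (erefl ((val pq).2 + 1 + 1))
  (f (hdeg_succr e (hdeg_succr e' pq)) x)) = 0 by exact: cdiffK.
rewrite [X in X - _ - _ = _]E cdiffK !raddf0 mul0rz subr0 sub0r.
rewrite (_ : (-1) ^+ `|j| = - (-1) ^+ `|i|); last first.
  by rewrite -sign_pred e addrK.
rewrite mulrNz opprK addrC; apply/eqP; rewrite subr_eq0; apply/eqP.
congr (_ *~ _); congr (cdiff _ _ _).
exact: (@total_hom_irr i f ((val pq).1 - 1, (val pq).2 + 1)).
Qed.

Definition total_hom : zcomplex := ZComplex total_hom_diffK.

End TotalHom.

Definition semi_flat (R : pzRingType) (F : complex R) :=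
  (forall i, flat (F i)) /\
  (forall X : complex R^c, acyclic X -> acyclic (total_tensor X F)).

Definition semi_projective (R : pzRingType) (P : complex R) :=
  (forall i, projective (P i)) /\
  (forall M : complex R, acyclic M -> acyclic (total_hom P M)).

(** * Purity *)

Section Subcomplex.
Variables (R : pzRingType) (M : complex R).

Record subcomplex := Subcomplex {
  subcomplex_at :> forall i : int, submodule (M i);
  subcomplex_diff : forall (i j : int) (e : i = j + 1) x,
    x \in subcomplex_at i -> cdiff M e x \in subcomplex_at j }.

Variable L : subcomplex.

Section Diff.
Variables (i j : int) (e : i = j + 1).

Definition sub_diff_fun (x : submod (L i)) : submod (L j) :=
  Submod (subcomplex_diff e (valP x)).
Fact sub_diff_is_linear : linear sub_diff_fun.
Proof. by move=> a x y; apply: val_inj; rewrite /= !linearP. Qed.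
HB.instance Definition _ := GRing.isLinear.Build R (submod (L i)) (submod (L j))
  *:%R sub_diff_fun sub_diff_is_linear.
Definition sub_diff : {linear submod (L i) -> submod (L j)} := sub_diff_fun.

Definition quot_diff_fun (q : quotmod (L i)) : quotmod (L j) :=
  quotmod_pi (L j) (cdiff M e (repr q)).
Fact quot_diffE x :
  quot_diff_fun (quotmod_pi (L i) x) = quotmod_pi (L j) (cdiff M e x).
Proof.
apply/eqP; rewrite quotmod_eq -raddfB; apply: subcomplex_diff.
by rewrite -quotmod_eq; apply/eqP; exact: reprK.
Qed.
Fact quot_diff_is_linear : linear quot_diff_fun.
Proof.
move=> a p q; have [x <-] := quotmod_piP p; have [y <-] := quotmod_piP q.
by rewrite -linearP !quot_diffE !linearP.
Qed.
HB.instance Definition _ := GRing.isLinear.Build R (quotmod (L i)) (quotmod (L j))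
  *:%R quot_diff_fun quot_diff_is_linear.
Definition quot_diff : {linear quotmod (L i) -> quotmod (L j)} := quot_diff_fun.
End Diff.

Fact sub_diffK (i j k : int) (e : i = j + 1) (e' : j = k + 1) x :
  sub_diff e' (sub_diff e x) = 0.
Proof. by apply: val_inj; rewrite /= cdiffK. Qed.

Fact quot_diffK (i j k : int) (e : i = j + 1) (e' : j = k + 1) q :
  quot_diff e' (quot_diff e q) = 0.
Proof.
by have [x <-] := quotmod_piP q; rewrite /= !quot_diffE cdiffK raddf0.
Qed.

Definition complex_of_sub : complex R := Complex sub_diffK.
Definition quotient_complex : complex R := Complex quot_diffK.

Definition sub_incl : chain_map complex_of_sub M :=
  @mk_chain_map R complex_of_sub M (fun i => @submod_incl R (M i) (L i))
    (fun _ _ _ _ => erefl).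

Definition quot_proj : chain_map M quotient_complex :=
  @mk_chain_map R M quotient_complex (fun i => @quotmod_pi R (M i) (L i))
    (fun _ _ e x => esym (quot_diffE e x)).

End Subcomplex.

Definition bounded (R : pzRingType) (A : complex R) :=
  exists a b : int, forall i : int, i < a \/ b < i -> forall x : A i, x = 0.

Definition pure_subcomplex (R : pzRingType) (M : complex R) (L : subcomplex M) :=
  forall A : complex R, bounded A -> (forall i, finitely_presented (A i)) ->
    short_exact (chain_map_post (A := A) (sub_incl L))
                (chain_map_post (A := A) (quot_proj L)).

Definition pure_acyclic (R : pzRingType) (M : complex R) :=
  acyclic M /\
  forall (i j : int) (e : i = j + 1),
    pure_exact (cycles_incl M i) (to_cycles M e).

Definition pure_minimal (R : pzRingType) (M : complex R) :=
  forall L : subcomplex M, pure_subcomplex L -> pure_acyclic (complex_of_sub L) ->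
    forall i x, x \in L i -> x = 0.

Definition has_pure_minimal_semi_projective_resolution
    (R : pzRingType) (M : complex R) :=
  exists (P : complex R) (f : chain_map P M),
    [/\ quasi_iso f, semi_projective P & pure_minimal P].

(* Main.v *)
Require Import Defs.
From HB Require Import structures.
From mathcomp Require Import all_boot all_order all_algebra.
From mathcomp Require Import boolp classical_sets cardinality fsbigop.
From mathcomp Require Import freeg zify.

(** Why the equivalences hold.

    Semi-free resolutions. Every complex M receives a surjective quasi-isomorphism
    from a complex of free modules whose generators are well-founded trees: each
    generator kills a given cycle of generators below it ([tree_quasi_iso]).
    Recursion on the trees bounds any cycle of Hom(P, N) for acyclic N
    ([tree_semi_projective]), and the height of the trees filters tensor products
    with P, which stay exact ([semifree_right_acyclic], [semifree_left_acyclic]).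

    Perfect rings: semi-flat is semi-projective. For semi-flat F, let K be the kernel
    of a semi-free resolution of F. It is acyclic and semi-flat, so W (x) K is acyclic
    for every right module W, as one sees by resolving W; hence the cycles of K are
    flat ([semi_flat_acyclic_cycles]). Over a left perfect ring they are projective,
    so K is contractible, and Hom(F, N) inherits acyclicity from the resolution
    ([perfect_semi_flat_semi_projective]). Conversely a flat module is a semi-flat
    complex concentrated in degree 0.

    Perfect rings: pure-minimal resolutions. A subcomplex L of M is pure and
    pure-acyclic exactly when it is acyclic and each Z_j(L) is pure in M_j in the
    sense of linear systems ([pure_cycles]). Zorn's lemma gives a maximal such L in a
    semi-free resolution P, and P / L is pure-minimal since the condition passes to
    extensions ([preim_pure_cycles]). Pure submodules of flat modules and the
    quotients by them are flat ([eqpure_flat]); so over a perfect ring L is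
    contractible and P / L is projective in each degree, hence semi-projective, and
    the resolution deforms to one that kills L ([quotient_resolution]).

    Back to perfect rings. Let F be flat and P -> F a pure-minimal semi-projective
    resolution of the complex F in degree 0. Semi-projectivity splits Z_0 off P_0
    ([cycles0_summand]), so Z_0 is projective. As F = Z_0 / B_0 is flat, the acyclic
    subcomplex ... -> P_2 -> P_1 -> B_0 -> 0 has pure cycles
    ([trunc_pure_cycles]), hence is pure-acyclic and pure, hence zero. Therefore
    F = Z_0 is projective ([flat_projective_of_resolution]). *)

Set Implicit Arguments.
Unset Strict Implicit.
Unset Printing Implicit Defensive.

Import Order.TTheory GRing.Theory.
Local Open Scope ring_scope.
Local Open Scope quotient_scope.
Local Open Scope classical_set_scope.

(** * Linear maps and projective modules *)

Section LinearMaps.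
Variable R : pzRingType.
Implicit Types U V A F M N P : lmodType R.

Definition mklin U V (f : U -> V) (fL : linear f) : {linear U -> V} :=
  HB.pack f (GRing.isLinear.Build R U V *:%R f fL).

Lemma linear_factor U A V (g : {linear U -> A}) (u : {linear U -> V}) :
  surjective g -> (forall x, g x = 0 -> u x = 0) ->
  exists h : {linear A -> V}, forall x, h (g x) = u x.
Proof.
move=> gS gu; pose s a := sval (cid (gS a)).
have sK a : g (s a) = a by rewrite /s; case: cid.
have uE x : u (s (g x)) = u x.
  apply/eqP; rewrite -subr_eq0 -raddfB; apply/eqP/gu.
  by rewrite linearB sK subrr.
have hL : linear (u \o s).
  move=> a x y; have -> : a *: x + y = g (a *: s x + s y) by rewrite linearP !sK.
  by rewrite /= uE linearP.
by exists (mklin hL) => x; exact: uE.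
Qed.

Lemma additive_inj (U V : zmodType) (f : {additive U -> V}) :
  (forall x, f x = 0 -> x = 0) -> injective f.
Proof.
move=> f0 x y fxy; apply/eqP; rewrite -subr_eq0; apply/eqP/f0.
by rewrite raddfB fxy subrr.
Qed.

Lemma surj_section P M (p : {linear M -> P}) : surjective p -> projective P ->
  exists s : {linear P -> M}, cancel s p.
Proof. by move=> pS /(_ _ _ p idfun pS). Qed.

Lemma projective_retract F P (i : {linear F -> P}) (r : {linear P -> F}) :
  cancel i r -> projective P -> projective F.
Proof.
move=> irK Pp M N g f gS; have [h hE] := Pp M N g (f \o r) gS.
by exists (h \o i) => x; rewrite hE /= irK.
Qed.

Lemma quotmod_pi_eq0 M (S : submodule M) x : quotmod_pi S x = 0 <-> x \in S.
Proof.
rewrite -{1}(linear0 (quotmod_pi S)).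
by split=> [/eqP|xL]; [|apply/eqP]; rewrite quotmod_eq subr0.
Qed.

Lemma quotmod_piB M (S : submodule M) x y :
  quotmod_pi S (x - y) = quotmod_pi S x - quotmod_pi S y.
Proof. exact: linearB. Qed.

End LinearMaps.

Arguments mklin : simpl never.

(** * Direct sums and free modules *)

Section DirSumExpand.
Variables (I : choiceType) (V : I -> zmodType).

Definition dirsum_at i (f : dirsum V) : V i := f i.
Fact dirsum_at_is_zmod_morphism i : zmod_morphism (dirsum_at i).
Proof. by []. Qed.
HB.instance Definition _ i := GRing.isZmodMorphism.Build (dirsum V) (V i)
  (dirsum_at i) (dirsum_at_is_zmod_morphism i).
Arguments dirsum_at : simpl never.

Lemma dirsum_expand (f : dirsum V) : exists s : seq I, [/\ uniq s,
  forall i, i \notin s -> f i = 0 & f = \sum_(i <- s) dirsum_inj (f i)].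
Proof.
have [fS f0] := dirsum_supp f.
pose s : seq I := finmap.enum_fset (fset_set [set i | f i != 0]).
have us : uniq s by exact: finmap.fset_uniq.
have s0 i : i \notin s -> f i = 0.
  by case: (eqVneq (f i) 0) => // fi /negP[]; rewrite in_fset_set // inE.
exists s; split => //; apply: dirsumP => h.
rewrite -[RHS]/(dirsum_at h _) raddf_sum /=.
have [hs|hs] := boolP (h \in s); last first.
  rewrite s0 // big1_seq // => g /andP[_ gs].
  by rewrite /dirsum_at dirsum_inj_out //; apply: contraNneq hs => <-.
rewrite (bigD1_seq h) //= {1}/dirsum_at dirsum_injE big1 ?addr0 // => g gh.
by rewrite /dirsum_at dirsum_inj_out.
Qed.

Lemma dirsum_ind (P : dirsum V -> Prop) :
  P 0 -> (forall f g, P f -> P g -> P (f + g)) ->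
  (forall i x, P (@dirsum_inj _ V i x)) -> forall f, P f.
Proof.
move=> P0 PD Pi f; have [s [_ _ ->]] := dirsum_expand f.
by elim/big_ind: _.
Qed.

End DirSumExpand.
Arguments dirsum_at : simpl never.

Section Spanned.
Variables (G : eqType) (T : zmodType) (V : G -> zmodType).
Variables (inj : forall g, {additive V g -> T}) (co : forall g, {additive T -> V g}).
Hypothesis co_inj : forall g v, co g (inj g v) = v.
Hypothesis co_inj_out : forall g g' v, g != g' -> co g (inj g' v) = 0.

(** Membership in the direct sum of the [V g]. It is preserved by sums, so that
    checking it on generators of T decomposes all of T. *)
Definition spanned (t : T) := exists r : seq G, [/\ uniq r,
  forall g, g \notin r -> co g t = 0 & t = \sum_(g <- r) inj g (co g t)].

Lemma spanned_widen t r r' : uniq r -> uniq r' -> {subset r <= r'} ->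
  (forall g, g \notin r -> co g t = 0) -> t = \sum_(g <- r) inj g (co g t) ->
  t = \sum_(g <- r') inj g (co g t).
Proof.
move=> ur ur' rr' t0 tE; rewrite {1}tE [RHS](bigID (mem r)) /=.
rewrite [X in _ = _ + X]big1 => [|g /t0 ->]; last exact: raddf0.
rewrite addr0 -[RHS]big_filter; apply: perm_big; apply: uniq_perm => //.
  exact: filter_uniq.
by move=> g; rewrite mem_filter; case: (boolP (g \in r)) => // /rr' ->.
Qed.

Lemma spanned0 : spanned 0.
Proof. by exists [::]; split=> // [g _|]; rewrite ?raddf0 ?big_nil. Qed.

Lemma spannedD t u : spanned t -> spanned u -> spanned (t + u).
Proof.
move=> [r [ur r0 rE]] [s [us s0 sE]].
have uu : uniq (undup (r ++ s)) := undup_uniq _.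
exists (undup (r ++ s)); split=> // [g|].
  rewrite mem_undup mem_cat negb_or => /andP[gr gs].
  by rewrite raddfD /= r0 // s0 // addr0.
rewrite {1}(spanned_widen ur uu _ r0 rE); last first.
  by move=> g; rewrite mem_undup mem_cat => ->.
rewrite {1}(spanned_widen us uu _ s0 sE); last first.
  by move=> g; rewrite mem_undup mem_cat orbC => ->.
by rewrite -big_split; apply: eq_bigr => g _; rewrite !raddfD.
Qed.

Lemma spanned_inj g v : spanned (inj g v).
Proof.
exists [:: g]; split=> // [h|]; last by rewrite big_seq1 co_inj.
by rewrite inE => hg; exact: co_inj_out.
Qed.

Lemma spanned_sum I (s : seq I) (F : I -> T) :
  (forall i, spanned (F i)) -> spanned (\sum_(i <- s) F i).
Proof.
move=> sF; elim/big_ind: _ => //; first exact: spanned0.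
exact: spannedD.
Qed.

End Spanned.

Section Free.
Variables (R : pzRingType) (G : choiceType).

Definition free := dirsum (fun _ : G => R : zmodType).
HB.instance Definition _ := GRing.Zmodule.on free.

Fact free_scale_supp (a : R) (f : free) :
  ((fun g => a * f g) : dprod (fun _ : G => R : zmodType)) \in @finsupp _ _.
Proof.
have [fS f0] := dirsum_supp f.
apply/asboolP; apply: sub_finite_set fS => g /=.
by apply: contraNN => /eqP ->; rewrite mulr0.
Qed.
Definition free_scale (a : R) (f : free) : free := DirSum (free_scale_supp a f).

Fact free_scaleA a b f : free_scale a (free_scale b f) = free_scale (a * b) f.
Proof. by apply: dirsumP => g; rewrite /= mulrA. Qed.
Fact free_scale1 : left_id 1 free_scale.
Proof. by move=> f; apply: dirsumP => g; rewrite /= mul1r. Qed.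
Fact free_scaleDr : right_distributive free_scale +%R.
Proof. by move=> a f h; apply: dirsumP => g; exact: mulrDr. Qed.
Fact free_scaleDl f : {morph free_scale^~ f : a b / a + b}.
Proof. by move=> a b; apply: dirsumP => g; exact: mulrDl. Qed.
HB.instance Definition _ := GRing.Zmodule_isLmodule.Build R free
  free_scaleA free_scale1 free_scaleDr free_scaleDl.

Definition basis (g : G) : free := @dirsum_inj G (fun _ : G => R : zmodType) g 1.

Definition coord (g : G) (f : free) : R := f g.
Fact coord_is_zmod_morphism g : zmod_morphism (coord g).
Proof. by []. Qed.
HB.instance Definition _ g := GRing.isZmodMorphism.Build free R (coord g)
  (coord_is_zmod_morphism g).
Arguments coord : simpl never.
Arguments basis : simpl never.

Lemma coordZ (a : R) (f : free) g : coord g (a *: f) = a * f g.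
Proof. by []. Qed.

Lemma coord_basis g h : (basis g : free) h = (g == h)%:R.
Proof.
have [<-|gh] := eqVneq g h; first exact: dirsum_injE.
exact: dirsum_inj_out.
Qed.

Lemma free_injE g (a : R) :
  @dirsum_inj G (fun _ : G => R : zmodType) g a = a *: basis g.
Proof.
apply: dirsumP => h; rewrite -[RHS]/(a * basis g h) coord_basis.
have [<-|gh] := eqVneq g h; first by rewrite dirsum_injE mulr1.
by rewrite dirsum_inj_out // mulr0.
Qed.

Lemma free_support (f : free) : exists s : seq G, uniq s /\
  (forall g, g \notin s -> f g = 0) /\ f = \sum_(g <- s) f g *: basis g.
Proof.
have [s [us s0 fE]] := dirsum_expand (f : dirsum _).
exists s; split => //; split => //; rewrite {1}fE.
by apply: eq_bigr => g _; exact: free_injE.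
Qed.

Lemma free_ext (M : lmodType R) (u v : {linear free -> M}) :
  (forall g, u (basis g) = v (basis g)) -> u =1 v.
Proof.
move=> uv f; have [s [_ [_ ->]]] := free_support f.
by rewrite !linear_sum; apply: eq_bigr => g _; rewrite !linearZ uv.
Qed.

Section Lift.
Variables (M : lmodType R) (phi : G -> M).

Fact scale_phi_is_additive g : zmod_morphism (fun a : R => a *: phi g).
Proof. by move=> a b; exact: scalerBl. Qed.
Let scale_phi g : {additive (R : zmodType) -> M} :=
  HB.pack (fun a : R => a *: phi g)
    (GRing.isZmodMorphism.Build _ _ _ (scale_phi_is_additive g)).

Definition free_lift (f : free) : M := dirsum_lift scale_phi f.

Fact free_lift_is_linear : linear free_lift.
Proof.
move=> a f h.
have -> : free_lift (a *: f + h) = free_lift (a *: f) + free_lift h.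
  exact: (raddfD (dirsum_lift scale_phi : {additive _ -> _})).
congr (_ + _).
have [fS f0] := dirsum_supp f.
rewrite /free_lift (dirsum_liftE _ fS f0).
have f0' g : ~ [set g | f g != 0] g -> (a *: f) g = 0.
  by move=> /f0 fg; rewrite -[LHS]/(a * f g) fg mulr0.
rewrite (dirsum_liftE _ fS f0') !fsbig_finite // scaler_sumr.
by apply: eq_bigr => g _; rewrite scalerA.
Qed.
HB.instance Definition _ := GRing.isLinear.Build R free M *:%R free_lift
  free_lift_is_linear.

Lemma free_lift_basis g : free_lift (basis g) = phi g.
Proof. by rewrite /free_lift dirsum_lift_inj /= scale1r. Qed.

End Lift.

Lemma free_projective : projective free.
Proof.
move=> M N g f gS.
exists (free_lift (fun x => sval (cid (gS (f (basis x)))))).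
apply: (@free_ext _ (g \o free_lift _) f) => y.
by rewrite /= free_lift_basis; case: cid.
Qed.

End Free.
Arguments coord : simpl never.
Arguments basis : simpl never.

(** * Tensor products *)

Section Cokernel.
Variables (A B : zmodType) (f : {additive A -> B}).

Definition im_pred : {pred B} := fun y => `[< exists x, f x = y >].
Fact im_pred_closed : zmod_closed im_pred.
Proof.
split; first by apply/asboolP; exists 0; rewrite raddf0.
move=> _ _ /asboolP[x <-] /asboolP[y <-]; apply/asboolP.
by exists (x - y); rewrite raddfB.
Qed.
HB.instance Definition _ := GRing.isZmodClosed.Build B im_pred im_pred_closed.

Definition coker := Quotient.quot im_pred.
HB.instance Definition _ := GRing.Zmodule.on coker.
Definition coker_pi (y : B) : coker := \pi_(Quotient.quot im_pred) y.
Fact coker_pi_is_zmod_morphism : zmod_morphism coker_pi.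
Proof. by move=> t u; rewrite /coker_pi raddfB. Qed.
HB.instance Definition _ :=
  GRing.isZmodMorphism.Build B coker coker_pi coker_pi_is_zmod_morphism.

Lemma coker_pi_eq x y : coker_pi x = coker_pi y <-> exists z, f z = x - y.
Proof.
split=> [/eqP|[z fz]]; first by rewrite /coker_pi -Quotient.idealrBE => /asboolP.
by apply/eqP; rewrite /coker_pi -Quotient.idealrBE; apply/asboolP; exists z.
Qed.
End Cokernel.

Definition mkadd (U V : zmodType) (f : U -> V) (fB : zmod_morphism f) :
    {additive U -> V} := HB.pack f (GRing.isZmodMorphism.Build U V f fB).
Arguments mkadd : simpl never.

Section TensorBasics.
Variable R : pzRingType.
Implicit Types (X Y W : lmodType R^c) (A B F Q : lmodType R).

Lemma tensNl X F (x : X) (y : F) : tens (- x) y = - tens x y.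
Proof.
by apply/eqP; rewrite -subr_eq0 opprK -tensDl addNr; apply/eqP; exact: tens0l.
Qed.

Lemma tensNr X F (x : X) (y : F) : tens x (- y) = - tens x y.
Proof.
by apply/eqP; rewrite -subr_eq0 opprK -tensDr addNr; apply/eqP; exact: tens0r.
Qed.

Lemma tensBl X F (x x' : X) (y : F) : tens (x - x') y = tens x y - tens x' y.
Proof. by rewrite tensDl tensNl. Qed.

Lemma tensBr X F (x : X) (y y' : F) : tens x (y - y') = tens x y - tens x y'.
Proof. by rewrite tensDr tensNr. Qed.

Lemma tens_suml X F I (s : seq I) (P : pred I) (x : I -> X) (y : F) :
  tens (\sum_(i <- s | P i) x i) y = \sum_(i <- s | P i) tens (x i) y.
Proof. exact: (raddf_sum (mkadd (fun a b => tensBl a b y))). Qed.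

Lemma tens_sumr X F I (s : seq I) (P : pred I) (x : X) (y : I -> F) :
  tens x (\sum_(i <- s | P i) y i) = \sum_(i <- s | P i) tens x (y i).
Proof. exact: (raddf_sum (mkadd (tensBr x))). Qed.

Lemma tensor_ind X F (P : tensor X F -> Prop) :
  P 0 -> (forall t u, P t -> P u -> P (t + u)) -> (forall x y, P (tens x y)) ->
  forall t, P t.
Proof.
move=> P0 PD Pt t.
rewrite -[t]reprK -/(tensor_pi _) -[repr t]freeg_sumE raddf_sum.
elim/big_ind: _ => // -[x y] _.
rewrite -[coeff _ _]intz -freegU_mulz raddfMz.
set c := coeff _ _; rewrite -[X in X *~ _]/(tens x y).
have Pn n z : P (tens z y *~ Posz n).
  elim: n => [|n IH] //; rewrite -addn1 PoszD mulrzDr mulr1z.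
  by apply: PD; [exact: IH | exact: Pt].
case: c => n; first exact: Pn.
by rewrite NegzE mulrNz -mulNrz -tensNl; exact: Pn.
Qed.

Lemma tensor_sum X F (t : tensor X F) :
  exists s : seq (X * F), t = \sum_(z <- s) tens z.1 z.2.
Proof.
elim/tensor_ind: t => [|t u [s ->] [s' ->]|x y].
- by exists [::]; rewrite big_nil.
- by exists (s ++ s'); rewrite big_cat.
by exists [:: (x, y)]; rewrite big_seq1.
Qed.

Lemma tensor_map_comp X1 X2 X3 F1 F2 F3 (f : {linear X1 -> X2})
    (f' : {linear X2 -> X3}) (g : {linear F1 -> F2}) (g' : {linear F2 -> F3})
    (f2 : {linear X1 -> X3}) (g2 : {linear F1 -> F3}) :
  (forall x, f' (f x) = f2 x) -> (forall x, g' (g x) = g2 x) ->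
  forall t, tensor_map f' g' (tensor_map f g t) = tensor_map f2 g2 t.
Proof.
move=> ff gg; apply: (@tensor_ext _ _ _ _ (tensor_map f' g' \o tensor_map f g)).
by move=> x y; rewrite /= !tensor_mapE ff gg.
Qed.

Lemma tensor_map_id X F (f : {linear X -> X}) (g : {linear F -> F}) :
  f =1 id -> g =1 id -> forall t, tensor_map f g t = t.
Proof.
move=> f1 g1; apply: (@tensor_ext _ _ _ _ (tensor_map f g) idfun).
by move=> x y /=; rewrite tensor_mapE f1 g1.
Qed.

Lemma tensor_map0l X1 X2 F1 F2 (f : {linear X1 -> X2}) (g : {linear F1 -> F2}) :
  (forall x, f x = 0) -> forall t, tensor_map f g t = 0.
Proof.
move=> f0; apply: (@tensor_ext _ _ _ _ (tensor_map f g) \0).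
by move=> x y /=; rewrite tensor_mapE f0; exact: tens0l.
Qed.

Lemma tensor_map0r X1 X2 F1 F2 (f : {linear X1 -> X2}) (g : {linear F1 -> F2}) :
  (forall x, g x = 0) -> forall t, tensor_map f g t = 0.
Proof.
move=> g0; apply: (@tensor_ext _ _ _ _ (tensor_map f g) \0).
by move=> x y /=; rewrite tensor_mapE g0; exact: tens0r.
Qed.

Lemma tensor_map_surj X1 X2 F1 F2 (f : {linear X1 -> X2})
    (g : {linear F1 -> F2}) :
  surjective f -> surjective g -> surjective (tensor_map f g).
Proof.
move=> fS gS; elim/tensor_ind => [|t u [t' <-] [u' <-]|x y].
- by exists 0; rewrite raddf0.
- by exists (t' + u'); rewrite raddfD.
have [x' <-] := fS x; have [y' <-] := gS y.
by exists (tens x' y'); rewrite tensor_mapE.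
Qed.

Lemma linear_exact_section (U V W : zmodType) (f : U -> V) (g : {additive V -> W})
    (s : W -> V) : exact_at f g -> cancel s g ->
  forall x y, g x = y -> exists z, f z = s y - x.
Proof. by move=> fg sK x y gx; apply/fg; rewrite raddfB sK gx subrr. Qed.

(** The map W (x) Q -> coker (f (x) Q) that sends w (x) q to the class of
    y (x) q, for any y over w, is well defined and bilinear; composed with
    g (x) Q it is the projection, so ker (g (x) Q) lies in im (f (x) Q). *)
Lemma tensor_right_exactl X Y W Q (f : {linear X -> Y}) (g : {linear Y -> W}) :
  exact_at f g -> surjective g ->
  exact_at (tensor_map f (idfun : {linear Q -> Q}))
           (tensor_map g (idfun : {linear Q -> Q})).
Proof.
move=> fg gS t; split; last first.
  move=> [u <-]; rewrite (@tensor_map_comp _ _ _ _ _ _ _ _ _ _ (g \o f) idfun) //.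
  by apply: tensor_map0l => x /=; apply/fg; exists x.
pose s w := sval (cid (gS w)).
have sK w : g (s w) = w by rewrite /s; case: cid.
set fQ := tensor_map f _.
have key x y q : g x = y -> coker_pi fQ (tens (s y) q) = coker_pi fQ (tens x q).
  move=> /(linear_exact_section fg sK)[z fz]; apply/coker_pi_eq.
  by exists (tens z q); rewrite /fQ /= tensor_mapE fz tensBl.
pose b w q := coker_pi fQ (tens (s w) q).
have bDl w w' q : b (w + w') q = b w q + b w' q.
  by rewrite /b -raddfD -tensDl; apply: key; rewrite raddfD /= !sK.
have bDr w q q' : b w (q + q') = b w q + b w q'.
  by rewrite /b tensDr raddfD.
have bZ (r : R) w q : b ((r : R^c) *: w) q = b w (r *: q).
  by rewrite /b -tens_scale; apply: key; rewrite linearZ /= sK.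
pose L := mkadd (tensor_lift_is_zmod_morphism bDl bDr bZ).
have LE u : L (tensor_map g idfun u) = coker_pi fQ u.
  move: u; apply: (@tensor_ext _ _ _ _ (L \o tensor_map g idfun)) => x q.
  rewrite /= tensor_mapE -[LHS]/(tensor_lift b (tens (g x) q)) tensor_lift_tens //.
  exact: key.
move=> t0; have := LE t; rewrite t0 raddf0 => /esym; rewrite -[in RHS](raddf0 (coker_pi fQ)).
by move=> /coker_pi_eq[z]; rewrite subr0 => fz; exists z.
Qed.

Lemma tensor_right_exactr X A B Q (f : {linear A -> B}) (g : {linear B -> Q}) :
  exact_at f g -> surjective g ->
  exact_at (tensor_map (idfun : {linear X -> X}) f)
           (tensor_map (idfun : {linear X -> X}) g).
Proof.
move=> fg gS t; split; last first.
  move=> [u <-]; rewrite (@tensor_map_comp _ _ _ _ _ _ _ _ _ _ idfun (g \o f)) //.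
  by apply: tensor_map0r => x /=; apply/fg; exists x.
pose s w := sval (cid (gS w)).
have sK w : g (s w) = w by rewrite /s; case: cid.
set fQ := tensor_map _ f.
have key q x y : g x = y -> coker_pi fQ (tens q (s y)) = coker_pi fQ (tens q x).
  move=> /(linear_exact_section fg sK)[z fz]; apply/coker_pi_eq.
  by exists (tens q z); rewrite /fQ /= tensor_mapE fz tensBr.
pose b q w := coker_pi fQ (tens q (s w)).
have bDl q q' w : b (q + q') w = b q w + b q' w.
  by rewrite /b tensDl raddfD.
have bDr q w w' : b q (w + w') = b q w + b q w'.
  by rewrite /b -raddfD -tensDr; apply: key; rewrite raddfD /= !sK.
have bZ (r : R) q w : b ((r : R^c) *: q) w = b q (r *: w).
  by rewrite /b tens_scale; apply/esym/key; rewrite linearZ /= sK.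
pose L := mkadd (tensor_lift_is_zmod_morphism bDl bDr bZ).
have LE u : L (tensor_map idfun g u) = coker_pi fQ u.
  move: u; apply: (@tensor_ext _ _ _ _ (L \o tensor_map idfun g)) => q x.
  rewrite /= tensor_mapE -[LHS]/(tensor_lift b (tens q (g x))) tensor_lift_tens //.
  exact: key.
move=> t0; have := LE t; rewrite t0 raddf0 => /esym; rewrite -[in RHS](raddf0 (coker_pi fQ)).
by move=> /coker_pi_eq[z]; rewrite subr0 => fz; exists z.
Qed.

End TensorBasics.

(** * Flat modules *)

Section Flat.
Variable R : pzRingType.
Implicit Types (X Y W : lmodType R^c) (A B F M N P Q S : lmodType R).

Lemma flat_inj Q X Y (f : {linear X -> Y}) : flat Q ->
  (forall x, f x = 0 -> x = 0) ->
  forall t, tensor_map f (idfun : {linear Q -> Q}) t = 0 -> t = 0.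
Proof.
move=> Qf f0 t ft; have e : exact_at (\0 : {linear X -> X}) f.
  move=> y; split=> [/f0 ->|[x <-]]; first by exists 0.
  by rewrite raddf0.
have [x <-] := (Qf _ _ _ _ _ e t).1 ft.
exact: tensor_map0l.
Qed.

(** Injections suffice: any exact X -> Y -> Z factors through the image of Y,
    onto which tensoring is right exact. *)
Lemma flat_of_inj Q :
  (forall X Y (f : {linear X -> Y}), (forall x, f x = 0 -> x = 0) ->
     forall t, tensor_map f (idfun : {linear Q -> Q}) t = 0 -> t = 0) ->
  flat Q.
Proof.
move=> Qi X Y Z f g fg.
have gI x : g x \in immod g by apply/asboolP; exists x.
have gL : linear (fun x => Submod (gI x)).
  by move=> a x y; apply: val_inj; rewrite /= linearP.
pose g0 := mklin gL; pose i : {linear submod (immod g) -> Z} := @submod_incl _ _ (immod g).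
have g0E x : i (g0 x) = g x by [].
have i0 z : i z = 0 -> z = 0 by move=> iz; apply: val_inj.
have fg0 : exact_at f g0.
  move=> y; split=> [/(congr1 i)|[x <-]]; first by rewrite g0E raddf0 => /fg.
  by apply: i0; rewrite g0E; apply/fg; exists x.
have g0S : surjective g0.
  move=> [z zI]; have /asboolP[x gx] := zI.
  by exists x; apply: val_inj; exact: gx.
move=> t; split=> [gt|[u <-]].
  apply: (tensor_right_exactl (Q := Q) fg0 g0S t).1; apply: (Qi _ _ i i0).
  by rewrite (@tensor_map_comp _ _ _ _ _ _ _ _ _ _ _ g idfun).
rewrite (@tensor_map_comp _ _ _ _ _ _ _ _ _ _ _ (g \o f) idfun) //.
by apply: tensor_map0l => x /=; apply/fg; exists x.
Qed.

Section FreeCoordinates.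
Variables (G : choiceType) (g : G).

Section Right.
Variable X : lmodType R^c.
Let b (x : X) (p : free R G) : X := (p g : R^c) *: x.
Let bDl x x' y : b (x + x') y = b x y + b x' y.
Proof. exact: scalerDr. Qed.
Let bDr x y y' : b x (y + y') = b x y + b x y'.
Proof. by rewrite -scalerDl. Qed.
Let bZ (r : R) x y : b ((r : R^c) *: x) y = b x (r *: y).
Proof. by rewrite /b scalerA. Qed.
Definition tcoordr (t : tensor X (free R G)) : X := tensor_lift b t.
HB.instance Definition _ := GRing.isZmodMorphism.Build (tensor X (free R G)) X
  tcoordr (tensor_lift_is_zmod_morphism bDl bDr bZ).
Lemma tcoordrE x p : tcoordr (tens x p) = (p g : R^c) *: x.
Proof. exact: tensor_lift_tens. Qed.
End Right.

Section Left.
Variable K : lmodType R.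
Let b (p : free R^c G) (y : K) : K := (p g : R) *: y.
Let bDl x x' y : b (x + x') y = b x y + b x' y.
Proof. by rewrite -scalerDl. Qed.
Let bDr x y y' : b x (y + y') = b x y + b x y'.
Proof. exact: scalerDr. Qed.
Let bZ (r : R) x y : b ((r : R^c) *: x) y = b x (r *: y).
Proof. by rewrite /b scalerA. Qed.
Definition tcoordl (t : tensor (free R^c G) K) : K := tensor_lift b t.
HB.instance Definition _ := GRing.isZmodMorphism.Build (tensor (free R^c G) K) K
  tcoordl (tensor_lift_is_zmod_morphism bDl bDr bZ).
Lemma tcoordlE p y : tcoordl (tens p y) = (p g : R) *: y.
Proof. exact: tensor_lift_tens. Qed.
End Left.
End FreeCoordinates.

Section FreeExpansion.
Variables (G : choiceType).

Lemma tcoordr_basis (g : G) X (x : X) (g' : G) :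
  tcoordr g (tens x (basis R g')) = if g' == g then x else 0.
Proof.
rewrite tcoordrE coord_basis; case: eqP => _; last exact: scale0r.
exact: scale1r.
Qed.

Lemma tcoordl_basis (g : G) (K : lmodType R) (y : K) (g' : G) :
  tcoordl g (tens (basis R^c g') y) = if g' == g then y else 0.
Proof.
rewrite tcoordlE coord_basis; case: eqP => _; last exact: scale0r.
exact: scale1r.
Qed.

Lemma tensor_free_expand X (t : tensor X (free R G)) :
  exists r : seq G, [/\ uniq r, forall g, g \notin r -> tcoordr g t = 0 &
    t = \sum_(g <- r) tens (tcoordr g t) (basis R g)].
Proof.
pose inj (g : G) := mkadd (fun a b : X => tensBl a b (basis R g)).
have co_inj g v : tcoordr g (inj g v) = v by rewrite tcoordr_basis eqxx.
have co_out g g' v : g != g' -> tcoordr g (inj g' v) = 0.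
  by rewrite eq_sym tcoordr_basis => /negbTE ->.
elim/tensor_ind: t => [||x p].
- exact: (spanned0 inj (fun g => @tcoordr G g X)).
- exact: (spannedD (inj := inj) (co := fun g => @tcoordr G g X)).
have [s [_ [_ ->]]] := free_support p; rewrite tens_sumr.
apply: (spanned_sum (inj := inj) (co := fun g => @tcoordr G g X)) => g.
by rewrite -tens_scale; exact: (spanned_inj co_inj co_out).
Qed.

(** Coordinates identify X (x) R^(G) with X^(G), naturally in X. *)
Lemma free_flat : flat (free R G).
Proof.
apply: flat_of_inj => X Y f f0 t ft.
have [r [_ _ ->]] := tensor_free_expand t.
rewrite big1 // => g _.
suff -> : tcoordr g t = 0 by exact: tens0l.
apply: f0; transitivity (tcoordr g (tensor_map f idfun t)); last first.
  by rewrite ft raddf0.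
move: (t); apply: (@tensor_ext _ _ _ _ (f \o @tcoordr G g X)
  (@tcoordr G g Y \o tensor_map f idfun)) => x p.
by rewrite /= tensor_mapE !tcoordrE linearZ.
Qed.

End FreeExpansion.

Lemma flat_retract F P (i : {linear F -> P}) (r : {linear P -> F}) :
  cancel i r -> flat P -> flat F.
Proof.
move=> irK Pf; apply: flat_of_inj => X Y f f0 t ft.
rewrite -[t](tensor_map_id (f := idfun) (g := idfun)) //.
rewrite -(@tensor_map_comp _ _ _ _ _ _ _ idfun idfun i r) //.
rewrite (flat_inj Pf f0 (t := tensor_map idfun i t)) ?raddf0 //.
rewrite (@tensor_map_comp _ _ _ _ _ _ _ _ _ _ _ f i) //.
rewrite -(@tensor_map_comp _ _ _ _ _ _ _ f idfun idfun i) //.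
by rewrite ft raddf0.
Qed.

Lemma free_cover M : surjective (free_lift (R := R) (id : M -> M)).
Proof. by move=> x; exists (basis R x); rewrite free_lift_basis. Qed.

Lemma projective_flat P : projective P -> flat P.
Proof.
move=> Pp; have [s sK] := surj_section (p := free_lift id) (@free_cover P) Pp.
by apply: (flat_retract sK); exact: free_flat.
Qed.

(** Flatness of S is read off inside M. For Q = M / S and X inside Y, an element
    of X (x) Q that dies in Y (x) Q lifts to X (x) M, where its image in Y (x) M
    comes from some s in Y (x) S; as s dies in (Y / X) (x) M it dies in
    (Y / X) (x) S, so it comes from X (x) S. *)
Lemma pure_flat S M Q (i : {linear S -> M}) (p : {linear M -> Q}) :
  (forall X t, tensor_map (idfun : {linear X -> X}) i t = 0 -> t = 0) ->
  exact_at i p -> surjective p -> flat M -> flat S /\ flat Q.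
Proof.
move=> iP ip pS Mf.
have sq X Y A B (f : {linear X -> Y}) (g : {linear A -> B}) t :
    tensor_map f idfun (tensor_map idfun g t) =
    tensor_map idfun g (tensor_map f idfun t).
  rewrite (@tensor_map_comp _ _ _ _ _ _ _ _ _ _ _ f g) //.
  by rewrite (@tensor_map_comp _ _ _ _ _ _ _ _ _ _ _ f g).
split.
  apply: flat_of_inj => X Y f f0 t ft; apply/iP/(flat_inj Mf f0).
  by rewrite sq ft raddf0.
apply: flat_of_inj => X Y f f0 t ft.
have [t' tE] := tensor_map_surj (f := idfun : {linear X -> X}) (fun x => ex_intro _ x erefl) pS t.
have [|s sE] := (tensor_right_exactr (X := Y) ip pS (tensor_map f idfun t')).1.
  by rewrite -sq tE.
pose c : {linear Y -> quotmod (immod f)} := @quotmod_pi _ _ (immod f).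
have fc : exact_at f c.
  by move=> y; split=> [/quotmod_pi_eq0/asboolP|[x <-]] //;
     apply/quotmod_pi_eq0/asboolP; exists x.
have [|u uE] := (tensor_right_exactl (Q := S) fc (@quotmod_piP _ _ _) s).1.
  apply: iP; rewrite -sq sE (@tensor_map_comp _ _ _ _ _ _ _ _ _ _ _ (c \o f) idfun) //.
  by apply: tensor_map0l => x /=; apply/fc; exists x.
rewrite -tE; apply/(tensor_right_exactr (X := X) ip pS); exists u.
apply/eqP; rewrite -subr_eq0; apply/eqP/(flat_inj Mf f0).
by rewrite raddfB /= sq uE sE subrr.
Qed.

End Flat.

(** * Pure submodules by systems of linear equations *)

Definition mxact (R : pzRingType) (M : lmodType R) m n (a : 'M[R]_(m, n))
  (x : 'I_n -> M) (k : 'I_m) : M := \sum_l a k l *: x l.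

(** Purity in terms of solving finite linear systems. It is equivalent to lifting
    maps out of finitely presented modules along M -> M / S, but it involves only
    finitely many elements of S, hence is stable under unions of chains. *)
Definition eqpure (R : pzRingType) (M : lmodType R) (S : submodule M) :=
  forall m n (a : 'M[R]_(m, n)) (x : 'I_n -> M),
    (forall k, mxact a x k \in S) ->
    exists2 y : 'I_n -> M, forall l, y l \in S &
      forall k, mxact a y k = mxact a x k.

Lemma free_ordE (R : pzRingType) n (f : free R 'I_n) : f = \sum_l f l *: basis R l.
Proof.
have [s [us [s0 fE]]] := free_support f.
rewrite {1}fE big_uniq // big_mkcond; apply: eq_bigr => l _.
by case: ifPn => // /s0 ->; rewrite scale0r.
Qed.

Lemma free_ord_coord (R : pzRingType) n (c : 'I_n -> R) l :
  (\sum_k c k *: basis R k) l = c l.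
Proof.
rewrite -[LHS]/(coord l _) raddf_sum /= (bigD1 l) //= big1 => [|k /negbTE kl].
  by rewrite addr0 coordZ coord_basis eqxx mulr1.
by rewrite coordZ coord_basis kl mulr0.
Qed.

Section MxAct.
Variable R : pzRingType.
Implicit Types (M N : lmodType R).

Lemma mxactB M m n (a : 'M[R]_(m, n)) (x y : 'I_n -> M) k :
  mxact a (fun l => x l - y l) k = mxact a x k - mxact a y k.
Proof. by rewrite /mxact -sumrB; apply: eq_bigr => l _; rewrite scalerBr. Qed.

Lemma mxactD M m n (a : 'M[R]_(m, n)) (x y : 'I_n -> M) k :
  mxact a (fun l => x l + y l) k = mxact a x k + mxact a y k.
Proof. by rewrite /mxact -big_split; apply: eq_bigr => l _; rewrite scalerDr. Qed.

Lemma mxact_linear M N (f : {linear M -> N}) m n (a : 'M[R]_(m, n)) x k :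
  f (mxact a x k) = mxact a (f \o x) k.
Proof. by rewrite linear_sum; apply: eq_bigr => l _; rewrite linearZ. Qed.

Lemma eq_mxact M m n (a : 'M[R]_(m, n)) (x y : 'I_n -> M) k :
  x =1 y -> mxact a x k = mxact a y k.
Proof. by move=> xy; apply: eq_bigr => l _; rewrite xy. Qed.

Lemma mxact_sub M (S : submodule M) m n (a : 'M[R]_(m, n)) (x : 'I_n -> M) k :
  (forall l, x l \in S) -> mxact a x k \in S.
Proof. by move=> xS; apply: rpred_sum => l _; apply: rpredZ. Qed.

Lemma mxact_mul M m n p (a : 'M[R]_(m, n)) (b : 'M[R]_(n, p)) (w : 'I_p -> M) k :
  (forall k j, \sum_l a k l * b l j = 0) -> mxact a (mxact b w) k = 0.
Proof.
move=> ab; rewrite /mxact; under eq_bigr => l _ do rewrite scaler_sumr.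
rewrite exchange_big big1 // => j _.
by under eq_bigr => l _ do rewrite scalerA; rewrite -scaler_suml ab scale0r.
Qed.

(** For R^n -> X with e_l |-> x_l, the element sum_l e_l (x) q_l of R^n (x) Q dies
    in X (x) Q, so by flatness it comes from ker (x) Q; the columns of b are the
    elements of the kernel that occur. *)
Lemma flat_vanish (X : lmodType R^c) (Q : lmodType R) n (x : 'I_n -> X)
    (q : 'I_n -> Q) : flat Q -> \sum_l tens (x l) (q l) = 0 ->
  exists p (b : 'M[R]_(n, p)) (w : 'I_p -> Q),
    (forall l, q l = mxact b w l) /\
    forall j, \sum_l (b l j : R^c) *: x l = 0.
Proof.
move=> Qf xq0; pose f : {linear free R^c 'I_n -> X} := free_lift x.
pose i : {linear submod (kermod f) -> free R^c 'I_n} := @submod_incl _ _ (kermod f).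
have fi : exact_at i f.
  move=> y; split=> [fy|[[z zf] <-]]; last exact/eqP.
  by have yf : y \in kermod f by [apply/eqP]; exists (Submod yf).
have [|u uE] := (Qf _ _ _ _ _ fi (\sum_l tens (basis R^c l) (q l))).1.
  rewrite raddf_sum -[RHS]xq0; apply: eq_bigr => l _ /=.
  by rewrite tensor_mapE /= free_lift_basis.
have [s us] := tensor_sum u.
exists (size s), (\matrix_(l, j) ((val (tnth (in_tuple s) j).1 : free R^c 'I_n) l : R)).
exists (fun j => (tnth (in_tuple s) j).2); split=> [l|j].
  have <- : tcoordl l (\sum_l tens (basis R^c l) (q l)) = q l.
    rewrite raddf_sum /= (bigD1 l) //= tcoordl_basis eqxx.
    by rewrite big1 ?addr0 // => h /negbTE hl; rewrite tcoordl_basis hl.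
  rewrite -uE us raddf_sum /= raddf_sum /= big_tnth.
  by apply: eq_bigr => j _; rewrite tensor_mapE tcoordlE mxE.
under eq_bigr => l _ do rewrite mxE.
case: (tnth _ _) => -[z zf] y; have /eqP := zf.
rewrite {1}(free_ordE z) linear_sum /= => fz; rewrite -[RHS]fz.
by apply: eq_bigr => l _; rewrite linearZ /= free_lift_basis.
Qed.

(** The case of [flat_vanish] in which x_l is the l-th column of a. *)
Lemma flat_equation (F : lmodType R) m n (a : 'M[R]_(m, n)) (q : 'I_n -> F) :
  flat F -> (forall k, mxact a q k = 0) ->
  exists p (b : 'M[R]_(n, p)) (w : 'I_p -> F),
    (forall l, q l = mxact b w l) /\ forall k j, \sum_l a k l * b l j = 0.
Proof.
move=> Ff aq.
pose x l : free R^c 'I_m := \sum_k (a k l : R^c) *: basis R^c k.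
have xE l k : x l k = a k l := free_ord_coord _ _.
have [|p [b [w [qE bx]]]] := @flat_vanish _ _ _ x q Ff.
  rewrite /x; under eq_bigr => l _ do rewrite tens_suml.
  rewrite exchange_big big1 // => k _.
  under eq_bigr => l _ do rewrite tens_scale.
  by rewrite -tens_sumr -[X in tens _ X]/(mxact a q k) aq; exact: tens0r.
exists p, b, w; split=> // k j; have /(congr1 (coord k)) := bx j.
rewrite raddf_sum /= => bxk; rewrite -[RHS]bxk; apply: eq_bigr => l _.
by rewrite coordZ xE.
Qed.

(** If sum_l x_l (x) s_l vanishes over M, then s = b w with w in M and x b = 0.
    By purity w may be taken in S, and then the sum vanishes over S. *)
Lemma eqpure_tensor_inj (M : lmodType R) (S : submodule M) :
  flat M -> eqpure S -> forall (X : lmodType R^c) t,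
  tensor_map (idfun : {linear X -> X}) (@submod_incl _ _ S) t = 0 -> t = 0.
Proof.
move=> Mf Sp X t; have [s ->] := tensor_sum t; rewrite raddf_sum /= big_tnth => t0.
pose x l := (tnth (in_tuple s) l).1; pose q l := (tnth (in_tuple s) l).2.
have [|p [b [w [qE bx]]]] := @flat_vanish _ _ _ x (fun l => val (q l)) Mf.
  by rewrite -[RHS]t0; apply: eq_bigr => l _; rewrite tensor_mapE.
have [|y yS yE] := Sp _ _ b w; first by move=> k; rewrite -qE; exact: valP.
pose y' j := Submod (yS j).
have qE' l : q l = mxact b y' l.
  apply: val_inj; rewrite /= qE -yE -[RHS]/(submod_incl _) mxact_linear.
  exact: eq_mxact.
rewrite big_tnth (eq_bigr (fun l => \sum_j tens ((b l j : R^c) *: x l) (y' j))).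
  by rewrite exchange_big big1 // => j _; rewrite -tens_suml bx; exact: tens0l.
move=> l _; rewrite -/(q l) -/(x l) qE' tens_sumr.
by apply: eq_bigr => j _; rewrite tens_scale.
Qed.

Lemma quot_exact (M : lmodType R) (S : submodule M) :
  exact_at (@submod_incl _ _ S) (@quotmod_pi _ _ S).
Proof.
move=> x; split=> [/quotmod_pi_eq0 xS|[y <-]]; first by exists (Submod xS).
by apply/quotmod_pi_eq0; exact: valP.
Qed.

Lemma eqpure_flat (M : lmodType R) (S : submodule M) :
  flat M -> eqpure S -> flat (submod S) /\ flat (quotmod S).
Proof.
move=> Mf Sp; apply: (pure_flat (i := @submod_incl _ _ S) (p := @quotmod_pi _ _ S)).
- exact: eqpure_tensor_inj.
- exact: quot_exact.
- exact: quotmod_piP.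
- exact: Mf.
Qed.

End MxAct.

(** * Purity and lifting from finitely presented modules *)

Section RowVectors.
Variables (R : pzRingType) (M : lmodType R) (n : nat).

Section RowLift.
Variable x : 'I_n -> M.
Definition row_lift (v : 'rV[R]_n) : M := \sum_l v 0 l *: x l.
Fact row_lift_is_linear : linear row_lift.
Proof.
move=> a u v; rewrite /row_lift scaler_sumr -big_split; apply: eq_bigr => l _.
by rewrite !mxE scalerDl scalerA.
Qed.
HB.instance Definition _ := GRing.isLinear.Build R 'rV[R]_n M *:%R row_lift
  row_lift_is_linear.

Lemma row_lift_delta l : row_lift (delta_mx 0 l) = x l.
Proof.
rewrite /row_lift (bigD1 l) //= mxE !eqxx scale1r big1 ?addr0 // => k /negbTE kl.
by rewrite mxE kl andbF scale0r.
Qed.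
End RowLift.

Lemma row_linearE (u : {linear 'rV[R]_n -> M}) v :
  u v = row_lift (fun l => u (delta_mx 0 l)) v.
Proof.
rewrite {1}[v]row_sum_delta linear_sum; apply: eq_bigr => l _.
by rewrite linearZ.
Qed.

Lemma row_linear_ext (u v : {linear 'rV[R]_n -> M}) :
  (forall l, u (delta_mx 0 l) = v (delta_mx 0 l)) -> u =1 v.
Proof.
move=> uv w; rewrite (row_linearE u) (row_linearE v).
by apply: eq_bigr => l _; rewrite uv.
Qed.
End RowVectors.

Section Lifting.
Variable R : pzRingType.
Implicit Types (A U V M N : lmodType R).

Lemma linear_corestrict U V A (f : {linear U -> V}) (h : {linear A -> V}) :
  injective f -> (forall x, exists y, f y = h x) ->
  exists k : {linear A -> U}, forall x, f (k x) = h x.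
Proof.
move=> fI fh; pose k x := sval (cid (fh x)).
have kE x : f (k x) = h x by rewrite /k; case: cid.
have kL : linear k by move=> a x y; apply: fI; rewrite linearP !kE linearP.
by exists (mklin kL) => x; exact: kE.
Qed.

(** The images in N of the generators of A lift to some x in M, and the relations
    a of A send x into S. A solution y in S of a y = a x corrects the lift. *)
Lemma eqpure_lift M N (p : {linear M -> N}) (S : submodule M) A :
  surjective p -> (forall x, p x = 0 <-> x \in S) -> eqpure S ->
  finitely_presented A -> forall phi : {linear A -> N},
  exists h : {linear A -> M}, forall x, p (h x) = phi x.
Proof.
move=> pS pk Sp [m [n [f [g [fg gS]]]]] phi.
pose a := \matrix_(k < m, l < n) f (delta_mx 0 k) 0 l.
have aE (Q : lmodType R) (x : 'I_n -> Q) k :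
    mxact a x k = row_lift x (f (delta_mx 0 k)).
  by apply: eq_bigr => l _; rewrite mxE.
pose x l := sval (cid (pS (phi (g (delta_mx 0 l))))).
have xE l : p (x l) = phi (g (delta_mx 0 l)) by rewrite /x; case: cid.
have fg0 v : g (f v) = 0 by apply/fg; exists v.
have [|y yS yE] := Sp _ _ a x.
  move=> k; apply/pk; rewrite mxact_linear (eq_mxact _ _ xE) aE.
  by rewrite -(row_linearE (phi \o g)) /= fg0 raddf0.
pose u : {linear 'rV[R]_n -> M} := row_lift (fun l => x l - y l).
have uf v : u (f v) = 0.
  rewrite -[LHS]/((u \o f) v) -[RHS]/((\0 : {linear 'rV[R]_m -> M}) v).
  move: v; apply: row_linear_ext => k.
  by rewrite /= -aE mxactB yE subrr.
have [|h hE] := linear_factor (u := u) gS.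
  by move=> v /fg[w <-].
exists h => z; have [v <-] := gS z; rewrite hE -[LHS]/((p \o u) v) -[RHS]/((phi \o g) v).
move: v; apply: row_linear_ext => l /=.
rewrite row_lift_delta raddfB /= xE.
by have /pk -> := yS l; rewrite subr0.
Qed.

(** A system a x = 0 modulo S is a map from coker a, and a lift of that map
    solves the system exactly. *)
Lemma eqpure_of_lift M N (p : {linear M -> N}) (S : submodule M) :
  (forall x, p x = 0 <-> x \in S) ->
  (forall A, finitely_presented A -> forall phi : {linear A -> N},
    exists h : {linear A -> M}, forall x, p (h x) = phi x) -> eqpure S.
Proof.
move=> pk pl m n a x axS.
pose f : {linear 'rV[R]_m -> 'rV[R]_n} := row_lift (fun k => \row_l a k l).
pose g : {linear 'rV[R]_n -> quotmod (immod f)} := @quotmod_pi _ _ (immod f).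
have fg : exact_at f g.
  by move=> y; split=> [/quotmod_pi_eq0/asboolP|[z <-]] //;
     apply/quotmod_pi_eq0/asboolP; exists z.
have gS : surjective g := @quotmod_piP _ _ _.
have fx (Q : lmodType R) (z : 'I_n -> Q) k :
    row_lift z (f (delta_mx 0 k)) = mxact a z k.
  by rewrite /f /= row_lift_delta; apply: eq_bigr => l _; rewrite mxE.
pose u : {linear 'rV[R]_n -> N} := p \o row_lift x.
have [|phi phiE] := linear_factor (u := u) gS.
  move=> v /fg[w <-].
  rewrite -[LHS]/((u \o f) w) -[RHS]/((\0 : {linear 'rV[R]_m -> N}) w).
  move: w; apply: row_linear_ext => k.
  by rewrite /= fx; apply/pk.
have [|h hE] := pl (quotmod (immod f)) _ phi.
  by exists m, n, f, g.
exists (fun l => x l - h (g (delta_mx 0 l))) => [l|k].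
  by apply/pk; rewrite raddfB /= hE phiE /u /= row_lift_delta subrr.
rewrite mxactB -[X in _ - X]fx -(row_linearE (h \o g)) /=.
by have -> : g (f (delta_mx 0 k)) = 0; [apply/fg; exists (delta_mx 0 k) | rewrite raddf0 subr0].
Qed.

Lemma pure_exact_eqpure A M N (i : {linear A -> M}) (p : {linear M -> N})
    (S : submodule M) :
  (forall x, p x = 0 <-> x \in S) -> pure_exact i p -> eqpure S.
Proof.
move=> pk [_ ip]; apply: (eqpure_of_lift pk) => B Bfp phi.
by have [_ _ /(_ phi)[h hE]] := ip B Bfp; exists h => x; rewrite -hE.
Qed.

Lemma eqpure_pure_exact A M N (i : {linear A -> M}) (p : {linear M -> N})
    (S : submodule M) :
  (forall x, p x = 0 <-> x \in S) -> short_exact i p -> eqpure S -> pure_exact i p.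
Proof.
move=> pk ip Sp; split=> // B Bfp; have [iI ipe pS] := ip; split.
- move=> h h' /(congr1 (fun f : lhom _ _ => f : _ -> _)) hh.
  by apply: lhomP => x; apply: iI; exact: (congr1 (fun f => f x) hh).
- move=> h; split=> [h0|[k <-]].
    have [|k kE] := linear_corestrict (h := h) iI.
      by move=> x; apply/ipe; exact: (congr1 (fun f : lhom _ _ => f x) h0).
    by exists k; apply: lhomP.
  by apply: lhomP => x; apply/ipe; exists (k x).
- move=> phi; have [h hE] := eqpure_lift pS pk Sp Bfp phi.
  by exists h; apply: lhomP.
Qed.

Lemma eqpure_trans M (S : submodule M) (T : submodule (submod S)) (T' : submodule M) :
  (forall x : submod S, x \in T <-> val x \in T') ->
  (forall x, x \in T' -> x \in S) ->
  eqpure T -> eqpure S -> eqpure T'.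
Proof.
move=> TT TS Tp Sp m n a x axT.
have [|y yS yE] := Sp _ _ a x; first by move=> k; exact/TS.
pose y' l := Submod (yS l).
have y'E k : val (mxact a y' k) = mxact a x k.
  rewrite -yE -[LHS]/(submod_incl _) mxact_linear.
  exact: eq_mxact.
have [|z zT zE] := Tp _ _ a y'; first by move=> k; apply/TT; rewrite y'E.
exists (fun l => val (z l)) => [l|k]; first exact/TT.
rewrite -y'E -zE -[RHS]/(submod_incl _) mxact_linear.
exact: eq_mxact.
Qed.

End Lifting.

(** * Complexes: exactness, quasi-isomorphisms, contractions *)

(** Statements about the differential out of degree i need only be checked for
    the target i - 1, where the index equation is canonical. *)
Lemma deg_ind (i : int) (Q : forall j, i = j + 1 -> Prop) :
  Q (i - 1) (pred_succ i) -> forall j e, Q j e.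
Proof.
move=> Q0 j e; have ij : i - 1 = j by rewrite e addrK.
by case: j / ij e => e; rewrite (eq_irrelevance e (pred_succ i)).
Qed.

Section ShortExactComplexes.
Variables (A B C : zcomplex).
Variables (u : forall n, {additive A n -> B n}) (v : forall n, {additive B n -> C n}).
Hypothesis uD : forall i j (e : i = j + 1) x, u j (zdiff A e x) = zdiff B e (u i x).
Hypothesis vD : forall i j (e : i = j + 1) x, v j (zdiff B e x) = zdiff C e (v i x).
Hypothesis uv : forall n, short_exact (u n) (v n).

Let uI n x : u n x = 0 -> x = 0.
Proof. by have [uI _ _] := uv n => ux; apply: uI; rewrite ux raddf0. Qed.
Let uvE n y : v n y = 0 <-> exists x, u n x = y.
Proof. by have [_ + _] := uv n; apply. Qed.
Let vu n x : v n (u n x) = 0.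
Proof. by apply/uvE; exists x. Qed.
Let vS n y : exists x, v n x = y.
Proof. by have [_ _] := uv n; apply. Qed.

Lemma ses_acyclicl : acyclic B -> acyclic C -> acyclic A.
Proof.
move=> Ba Ca i j k e e' a; split=> [da|[x <-]]; last exact: zdiffK.
have [|b bE] := (Ba i j k e e' (u j a)).1; first by rewrite -uD da raddf0.
have [|c cE] := (Ca (i + 1) i j erefl e (v i b)).1; first by rewrite -vD bE vu.
have [b' b'E] := vS c.
have [|a' a'E] := (uvE (b - zdiff B erefl b')).1.
  by rewrite raddfB /= vD b'E cE subrr.
exists a'; apply/eqP; rewrite -subr_eq0; apply/eqP/uI.
by rewrite raddfB /= uD a'E raddfB /= zdiffK subr0 bE subrr.
Qed.

Lemma ses_acyclicr : acyclic A -> acyclic B -> acyclic C.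
Proof.
move=> Aa Ba i j k e e' c; split=> [dc|[x <-]]; last exact: zdiffK.
have [b bE] := vS c.
have [|a aE] := (uvE (zdiff B e' b)).1; first by rewrite vD bE.
have [|a' a'E] := (Aa j k (k - 1) e' (pred_succ k) a).1.
  by apply: uI; rewrite uD aE zdiffK.
have [|x xE] := (Ba i j k e e' (b - u j a')).1.
  by rewrite raddfB /= -uD a'E aE subrr.
by exists (v i x); rewrite -vD xE raddfB /= vu subr0.
Qed.

End ShortExactComplexes.

Section QuasiIso.
Variables (R : pzRingType) (L M : complex R) (f : chain_map L M).

(** Surjectivity and injectivity in homology, in terms of cycles. *)
Definition homology_onto := forall i j k (e : i = j + 1) (e' : j = k + 1) (m : M j),
  cdiff M e' m = 0 -> exists (y : L j) (x : M i),
    cdiff L e' y = 0 /\ f j y = m + cdiff M e x.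
Definition homology_into := forall i j k (e : i = j + 1) (e' : j = k + 1)
  (y : L j) (x : M i), cdiff L e' y = 0 -> f j y = cdiff M e x ->
  exists w : L i, y = cdiff L e w.

Lemma bijective_inj_surj (T U : Type) (g : T -> U) :
  injective g -> surjective g -> bijective g.
Proof.
move=> gI gS; pose h y := sval (cid (gS y)).
have hK : cancel h g by move=> y; rewrite /h; case: cid.
by exists h => // x; apply: gI; rewrite hK.
Qed.

Lemma homology_piE (N : complex R) i (z z' : cycles N i) :
  quotmod_pi (immod (to_cycles N (erefl (i + 1)))) z = quotmod_pi _ z' <->
  exists x : N (i + 1), cdiff N erefl x = val z - val z'.
Proof.
split=> [/eqP|[x xE]].
  by rewrite quotmod_eq => /asboolP[x /(congr1 val) xE]; exists x.
by apply/eqP; rewrite quotmod_eq; apply/asboolP; exists x; exact: val_inj.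
Qed.

Lemma quasi_isoP : quasi_iso f <-> homology_onto /\ homology_into.
Proof.
split=> [fq|[fo fi] i].
  split=> i j + e; subst i.
    apply: deg_ind => m dm.
    have [g _ gK] := fq j.
    have mZ : m \in kermod (cdiff M (pred_succ j)) by apply/eqP.
    have [[y yZ] yE] := quotmod_piP (g (quotmod_pi _ (Submod mZ : cycles M j))).
    have := gK (quotmod_pi _ (Submod mZ : cycles M j)).
    rewrite -yE homology_mapE => /homology_piE[x /= xE].
    exists y, x; split; first exact/eqP.
    by rewrite xE addrC subrK.
  apply: deg_ind => y x dy fyx.
  have yZ : y \in kermod (cdiff L (pred_succ j)) by apply/eqP.
  have [g gK _] := fq j.
  have /(can_inj gK)/homology_piE[w wE] : homology_map f (quotmod_pi _ (Submod yZ : cycles L j)) =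
      homology_map f (quotmod_pi _ (0 : cycles L j)).
    rewrite !homology_mapE; apply/homology_piE; exists x.
    by rewrite /= raddf0 subr0.
  by exists w; rewrite wE [RHS]subr0.
apply: bijective_inj_surj => [h h'|h].
  have [y <-] := quotmod_piP h; have [y' <-] := quotmod_piP h'.
  rewrite !homology_mapE => /homology_piE[x /= xE].
  have [||w wE] := fi _ _ _ erefl (pred_succ i) (val y - val y') x.
  - rewrite linearB; have /eqP -> := valP y; have /eqP -> := valP y'.
    by rewrite subrr.
  - by rewrite linearB.
  by apply/homology_piE; exists w.
have [[m mZ] <-] := quotmod_piP h.
have [|y [x [dy fy]]] := fo _ _ _ erefl (pred_succ i) m; first exact/eqP.
have yZ : y \in kermod (cdiff L (pred_succ i)) by apply/eqP.
exists (quotmod_pi _ (Submod yZ : cycles L i)); rewrite homology_mapE.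
by apply/homology_piE; exists x; rewrite /= fy [X in X - _]addrC addrK.
Qed.

End QuasiIso.

Section Contraction.
Variables (R : pzRingType) (K : complex R).

Definition contraction (h : forall i j : int, j = i + 1 -> {linear K i -> K j}) :=
  forall i j k (e : j = i + 1) (e' : i = k + 1) x,
    cdiff K e (h i j e x) + h k i e' (cdiff K e' x) = x.

(** A section s of K_j -> Z_i gives the projection x - s dx onto cycles, and s
    applied to that projection is a contraction. *)
Lemma acyclic_projective_contraction : acyclic K ->
  (forall i, projective (cycles K i)) -> exists h, contraction h.
Proof.
move=> Ka Kp.
have to_cyclesS i j (e : j = i + 1) : surjective (to_cycles K e).
  move=> [z zZ]; have /eqP dz := zZ.
  have [x xE] := (Ka _ _ _ e (pred_succ i) z).1 dz.
  by exists x; apply: val_inj.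
pose s i j e := sval (cid (surj_section (@to_cyclesS i j e) (Kp i))).
have sK i j e z : cdiff K e (s i j e z) = val z.
  rewrite /s; case: cid => /= t tK; exact: (congr1 val (tK z)).
pose r i (x : K i) := x - s _ _ (pred_succ i) (to_cycles K (pred_succ i) x).
have rZ i (x : K i) : r i x \in kermod (cdiff K (pred_succ i)).
  by apply/eqP; rewrite raddfB /= sK subrr.
have rL i : linear (fun x : K i => Submod (rZ i x) : cycles K i).
  move=> a x y; apply: val_inj; rewrite -[LHS]/(r i _) -[RHS]/(a *: r i x + r i y).
  have rE z : r i z = (idfun \- (s _ _ (pred_succ i) \o to_cycles K (pred_succ i))) z.
    by [].
  by rewrite !rE linearP.
pose h i j (e : j = i + 1) : {linear K i -> K j} := s i j e \o mklin (rL i).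
exists h => i j + e; apply: deg_ind => x.
have -> : h (i - 1) i (pred_succ i) (cdiff K (pred_succ i) x) =
    s _ _ (pred_succ i) (to_cycles K (pred_succ i) x).
  congr (s _ _ _ _); apply: val_inj; rewrite /= /r.
  have -> : to_cycles K (pred_succ (i - 1)) (cdiff K (pred_succ i) x) = 0.
    by apply: val_inj; rewrite /= cdiffK.
  by rewrite linear0 subr0.
by rewrite /h /= sK /= /r subrK.
Qed.

End Contraction.

(** * The total Hom complex *)

Section HomComplex.
Variables (R : pzRingType) (M N : complex R).

Lemma lhom_mulz (U V : lmodType R) (g : lhom U V) (s : int) y : (g *~ s) y = g y *~ s.
Proof. exact: (raddfMz (lhom_eval y)). Qed.

(** The neighbouring degrees are arbitrary, so that no transport along
    p = p - 1 + 1 is needed when differentials are iterated. *)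
Lemma total_hom_diffE n m (e : n = m + 1) (f : total_hom_obj M N n) p q p' q'
    (ep : p = p' + 1) (eq : q' = q + 1) h h1 h2 x :
  total_hom_diff M N e f (exist _ (p, q) h) x =
  cdiff N eq (f (exist _ (p, q') h1) x) -
  f (exist _ (p', q) h2) (cdiff M ep x) *~ (-1) ^+ `|n|%N.
Proof.
move: p' ep h2; apply: deg_ind => h2; subst q'.
rewrite -[LHS]/(cdiff N erefl (f (hdeg_succr e (exist _ (p, q) h)) x) -
  (lhom_pre (cdiff M (pred_succ p)) (f (hdeg_predl e (exist _ (p, q) h)))
      *~ (-1) ^+ `|n|%N) x).
rewrite lhom_mulz; congr (cdiff _ _ _ - _ *~ _).
  exact: (@total_hom_irr _ M N n f (p, q + 1)).
exact: (@total_hom_irr _ M N n f (p - 1, q)).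
Qed.

Lemma total_hom_cycleE n m (e : n = m + 1) (f : total_hom_obj M N n) p q p' q'
    (ep : p = p' + 1) (eq : q' = q + 1) h1 h2 x :
  total_hom_diff M N e f = 0 ->
  cdiff N eq (f (exist _ (p, q') h1) x) =
  f (exist _ (p', q) h2) (cdiff M ep x) *~ (-1) ^+ `|n|%N.
Proof.
have h : q - p == m.
  have /= /eqP h2' := h2; apply/eqP.
  by rewrite ep opprD addrA h2' e addrK.
move=> /(congr1 (fun g : total_hom_obj M N m => g (exist _ (p, q) h) x)).
by rewrite (@total_hom_diffE _ _ e f _ _ _ _ ep eq h h1 h2) => /eqP; rewrite subr_eq0 => /eqP.
Qed.

Definition hom_family n (F : forall p q : int, q - p == n -> {linear M p -> N q}) :
    total_hom_obj M N n :=
  fun pq => let: exist v h := pq in F v.1 v.2 h.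

Lemma total_hom_eqP n (f g : total_hom_obj M N n) :
  (forall p q h x, f (exist _ (p, q) h) x = g (exist _ (p, q) h) x) -> f = g.
Proof. by move=> fg; apply: dprodP => -[[p q] h]; apply: lhomP => x. Qed.

Lemma total_hom_acyclic_of :
  (forall n m (e : n = m + 1) (f : total_hom_obj M N m),
    (forall k (e' : m = k + 1), total_hom_diff M N e' f = 0) ->
    exists g, total_hom_diff M N e g = f) -> acyclic (total_hom M N).
Proof.
move=> H n m k e e' f; split=> [df|[g <-]]; last exact: total_hom_diffK.
apply: H => k' e''; have kk : k' = k by apply: (addIr 1); rewrite -e' -e''.
by subst k'; rewrite (eq_irrelevance e'' e').
Qed.

End HomComplex.

Lemma sign_succ (n m : int) : n = m + 1 -> (-1) ^+ `|n|%N = - (-1) ^+ `|m|%N :> int.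
Proof. by move=> ->; rewrite -[in RHS](addrK 1 m) sign_pred opprK. Qed.

Lemma sign_sq (n : int) : (-1) ^+ `|n|%N * (-1) ^+ `|n|%N = 1 :> int.
Proof. by rewrite -expr2 sqrr_sign. Qed.

Section Contractible.
Variables (R : pzRingType) (K N : complex R).

(** Up to sign, a cycle f is the boundary of f h. *)
Lemma contraction_hom_acyclic h : contraction (K := K) h -> acyclic (total_hom K N).
Proof.
move=> hK; apply: total_hom_acyclic_of => n m e f df0.
have hd p q : q - p == n -> q - (p + 1) == m.
  by move=> /eqP pq; rewrite opprD addrA pq e addrK.
pose F p q (h' : q - p == n) : {linear K p -> N q} :=
  ((f (exist _ (p + 1, q) (hd p q h')) \o h p (p + 1) erefl : lhom _ _)
     *~ (-1) ^+ `|m|%N : lhom _ _).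
have FE p q p' (ep : p' = p + 1) h' h'' x :
    F p q h' x = f (exist _ (p', q) h'') (h p p' ep x) *~ (-1) ^+ `|m|%N.
  subst p'; rewrite /F lhom_mulz /=; congr (_ *~ _).
  exact: (@total_hom_irr _ K N m f (p + 1, q)).
exists (hom_family F); apply: total_hom_eqP => p q h0 x.
have h1 : (q + 1) - p == n by rewrite addrAC (eqP h0) e.
have h2 : q - (p - 1) == n by rewrite opprB addrCA addrC (eqP h0) e.
have h3 : (q + 1) - (p + 1) == m by rewrite opprD addrACA subrr addr0.
rewrite (@total_hom_diffE _ _ _ n m e _ p q _ _ (pred_succ p) erefl h0 h1 h2) /=.
rewrite (FE _ _ _ erefl _ h3) (FE _ _ _ (pred_succ p) _ h0).
rewrite raddfMz /= (@total_hom_cycleE _ _ _ _ _ (pred_succ m) f _ _ _ _ erefl erefl h3 h0) //.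
rewrite (sign_succ e) mulrNz opprK -!mulrzA sign_sq.
by rewrite !mulr1z -linearD hK.
Qed.

End Contractible.

Lemma split_retraction (R : pzRingType) (K P F : lmodType R) (i : {linear K -> P})
    (p : {linear P -> F}) : short_exact i p -> projective F ->
  exists r : {linear P -> K}, cancel i r.
Proof.
move=> [iI ip pS] Fp; have [s sK] := surj_section pS Fp.
have [|r rE] := linear_corestrict (h := idfun \- (s \o p)) iI.
  by move=> x; apply/ip; rewrite /= linearB sK subrr.
exists r => y; apply: iI; rewrite rE /=.
have -> : p (i y) = 0 by apply/ip; exists y.
by rewrite linear0 subr0.
Qed.

Section HomShortExact.
Variables (R : pzRingType) (N : complex R).

Section Precomposition.
Variables (L M : complex R) (g : chain_map L M) (n : int).
Definition total_hom_pre (f : total_hom_obj M N n) : total_hom_obj L N n :=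
  fun pq => lhom_pre (g (val pq).1) (f pq).
Fact total_hom_pre_is_zmod_morphism : zmod_morphism total_hom_pre.
Proof. by move=> f f'; apply: dprodP => pq; exact: raddfB. Qed.
HB.instance Definition _ := GRing.isZmodMorphism.Build _ _ total_hom_pre
  total_hom_pre_is_zmod_morphism.
End Precomposition.

Lemma total_hom_preD (L M : complex R) (g : chain_map L M) n m (e : n = m + 1) f :
  total_hom_pre g (total_hom_diff M N e f) = total_hom_diff L N e (total_hom_pre g f).
Proof.
apply: total_hom_eqP => p q h x.
have h1 : (q + 1) - p == n by rewrite addrAC (eqP h) e.
have h2 : q - (p - 1) == n by rewrite opprB addrCA addrC (eqP h) e.
rewrite (@total_hom_diffE _ _ _ n m e _ p q _ _ (pred_succ p) erefl h h1 h2) /=.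
rewrite -[LHS]/(total_hom_diff M N e f (exist _ (p, q) h) (g p x)).
rewrite (@total_hom_diffE _ _ _ n m e _ p q _ _ (pred_succ p) erefl h h1 h2).
by rewrite -chain_mapP.
Qed.

Variables (K P F : complex R) (i : chain_map K P) (p : chain_map P F).
Hypothesis ip : forall n, short_exact (i n) (p n).
Hypothesis Fp : forall n, projective (F n).

(** As F is degreewise projective, the sequence splits in each degree and stays
    exact under Hom(-, N). *)
Lemma hom_ses_acyclic : acyclic (total_hom P N) -> acyclic (total_hom K N) ->
  acyclic (total_hom F N).
Proof.
apply: (@ses_acyclicl (total_hom F N) (total_hom P N) (total_hom K N)
  (fun n => total_hom_pre p (n := n)) (fun n => total_hom_pre i (n := n))).
- by move=> n m e f; exact: total_hom_preD.
- by move=> n m e f; exact: total_hom_preD.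
move=> n; split.
- apply: additive_inj => f f0; apply: total_hom_eqP => a b h x.
  have [_ _ pS] := ip a; have [y <-] := pS x.
  exact: (congr1 (fun g : total_hom_obj _ _ _ => g (exist _ (a, b) h) y) f0).
- move=> g; split=> [g0|[f <-]]; last first.
    apply: total_hom_eqP => a b h x; rewrite -[LHS]/(f (exist _ (a, b) h) (p a (i a x))).
    have [_ ipe _] := ip a; have -> : p a (i a x) = 0 by apply/ipe; exists x.
    by rewrite linear0.
  have H (ab : hdeg n) : exists f : {linear F (val ab).1 -> N (val ab).2},
      forall x, f (p _ x) = g ab x.
    have [_ ipe pS] := ip (val ab).1.
    apply: linear_factor => // x /ipe[y <-].
    exact: (congr1 (fun g : total_hom_obj _ _ _ => g ab y) g0).
  exists (fun ab => sval (cid (H ab))); apply: dprodP => ab; apply: lhomP => x.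
  by rewrite -[LHS]/(sval (cid (H ab)) (p _ x)); case: cid.
- move=> k.
  have H (ab : hdeg n) := split_retraction (ip (val ab).1) (@Fp (val ab).1).
  exists (fun ab => k ab \o sval (cid (H ab)) : lhom _ _); apply: dprodP => ab; apply: lhomP => x.
  rewrite -[LHS]/(k ab (sval (cid (H ab)) (i _ x))); case: cid => /= r rK.
  by rewrite rK.
Qed.

End HomShortExact.

Section NullHomotopy.
Variables (R : pzRingType) (P N : complex R) (f : chain_map P N).

(** A chain map is a 0-cycle of the total Hom complex, and a chain bounding it is
    a homotopy. *)
Lemma null_homotopy : acyclic (total_hom P N) ->
  exists s : forall i j, j = i + 1 -> {linear P i -> N j},
  forall i j k (e : j = i + 1) (e' : i = k + 1) x,
    f i x = cdiff N e (s i j e x) + s k i e' (cdiff P e' x).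
Proof.
move=> Ha.
have h0 (p q : int) : q - p == 0 -> p = q by rewrite subr_eq0 => /eqP.
pose F p q (h : q - p == 0) : {linear P p -> N q} :=
  ecast r {linear P p -> N r} (h0 p q h) (f p).
have FE p (h : p - p == 0) x : F p p h x = f p x.
  by rewrite /F (eq_irrelevance (h0 p p h) erefl).
have [|g gE] := (Ha 1 0 (0 - 1) (esym (add0r 1)) (pred_succ 0) (hom_family F)).1.
  apply: total_hom_eqP => p q h x.
  have epq : p = q + 1.
    by apply/eqP; rewrite eq_sym -subr_eq0 addrAC (eqP h) subrK.
  have hp : p - p == 0 by rewrite subrr.
  have hq : q - q == 0 by rewrite subrr.
  rewrite -[LHS]/(total_hom_diff P N _ _ _ _).
  rewrite (@total_hom_diffE _ _ _ _ _ _ _ p q q p epq epq h hp hq) /=.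
  by rewrite !FE chain_mapP mulr1z subrr.
have h1 (i j : int) : j = i + 1 -> j - i == 1 by move=> ->; rewrite addrAC subrr add0r.
exists (fun i j e => g (exist _ (i, j) (h1 i j e))) => i j k e e' x.
have hi : i - i == 0 by rewrite subrr.
have := congr1 (fun g : total_hom_obj _ _ _ => g (exist _ (i, i) hi) x) gE.
rewrite [RHS]FE => <-.
rewrite -[LHS]/(total_hom_diff P N (esym (add0r 1)) g (exist _ (i, i) hi) x).
rewrite (@total_hom_diffE _ _ _ _ _ _ _ i i k j e' e hi (h1 i j e) (h1 k i e')).
by rewrite expr1 mulrNz mulr1z opprK.
Qed.
End NullHomotopy.

(** * Total tensor products with semi-free complexes *)

Section Filtration.
Variables (T : zcomplex) (G : eqType) (ht : G -> nat) (Y : G -> int -> zmodType).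
Variable dY : forall g i j, i = j + 1 -> Y g i -> Y g j.
Variables (inj : forall g n, {additive Y g n -> T n})
  (co : forall g n, {additive T n -> Y g n}).
Hypothesis co_inj : forall g n v, co g n (inj g n v) = v.
Hypothesis co_inj_out : forall g g' n v, g != g' -> co g n (inj g' n v) = 0.
Hypothesis span : forall n t, spanned (fun g => inj g n) (fun g => co g n) t.
Hypothesis dY_exact : forall g i j k (e : i = j + 1) (e' : j = k + 1) (y : Y g j),
  dY e' y = 0 -> exists x : Y g i, dY e x = y.
Hypothesis co_d : forall g i j (e : i = j + 1) y,
  co g j (zdiff T e (inj g i y)) = dY e y.
Hypothesis co_d_out : forall g g' i j (e : i = j + 1) y, g != g' ->
  (ht g' <= ht g)%N -> co g j (zdiff T e (inj g' i y)) = 0.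

(** T is the direct sum of the exact complexes Y g, up to terms of the
    differential that strictly lower the height. A cycle with no coordinates of
    height above N has cycles as its coordinates of height N; subtracting the
    boundary of chains that bound those lowers the height. *)
Lemma filtered_acyclic : acyclic T.
Proof.
move=> i j k e e' t; split=> [dt|[x <-]]; last exact: zdiffK.
have [N tN] : exists N, forall g, (N <= ht g)%N -> co g j t = 0.
  have [r [_ r0 _]] := span t; exists (\max_(g <- r) ht g).+1 => g gN.
  apply: r0; apply/negP => gr.
  by move: gN; rewrite ltnNge (leq_bigmax_seq (P := predT)).
elim: N => [|N IH] in t dt tN *.
  exists 0; rewrite raddf0; have [r [_ _ ->]] := span t.
  by rewrite big1 // => g _; rewrite tN // raddf0.
have [r [ur r0 tE]] := span t.
have dco g : ht g = N -> dY e' (co g j t) = 0.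
  move=> hg; rewrite -(co_d e').
  have [gr|/r0 ->] := boolP (g \in r); last by rewrite !raddf0.
  transitivity (co g k (zdiff T e' t)); last by rewrite dt raddf0.
  rewrite [in RHS]tE !raddf_sum /= (bigD1_seq g) //= big1 ?addr0 // => g' gg'.
  have [hg'|hg'] := leqP (ht g') (ht g); first by rewrite co_d_out // eq_sym.
  by rewrite tN ?raddf0 // -hg.
pose y g : Y g i := if pselect (ht g = N) is left hg
  then sval (cid (dY_exact e (dco g hg))) else 0.
have yE g : ht g = N -> dY e (y g) = co g j t.
  by rewrite /y; case: pselect => // hg _; case: cid.
have y0 g : ht g != N -> y g = 0 by rewrite /y; case: pselect => // hg /eqP.
pose u := \sum_(g <- r) inj g i (y g).
have [||x xE] := IH (t - zdiff T e u).
- by rewrite raddfB /= zdiffK dt subrr.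
- move=> g gN; rewrite raddfB /=.
  have -> : co g j (zdiff T e u) = \sum_(g' <- r) co g j (zdiff T e (inj g' i (y g'))).
    by rewrite !raddf_sum.
  have out g' : g' != g -> co g j (zdiff T e (inj g' i (y g'))) = 0.
    move=> gg'; have [hg'|hg'] := eqVneq (ht g') N; last by rewrite y0 // !raddf0.
    by rewrite co_d_out // ?hg' // eq_sym.
  have [gr|gr] := boolP (g \in r); last first.
    rewrite r0 // big1_seq ?subrr // => g' /andP[_ gr'].
    by apply: out; apply: contraNneq gr => <-.
  rewrite (bigD1_seq g) //= big1 // addr0 co_d.
  have [hg|hg] := eqVneq (ht g) N; first by rewrite yE // subrr.
  rewrite -(co_d e) y0 // !raddf0 addr0 tN // ltn_neqAle gN andbT.
  by rewrite eq_sym.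
by exists (x + u); rewrite raddfD /= xE subrK.
Qed.

End Filtration.

Section TotalSummand.
Variables (R : pzRingType) (X : complex R^c) (F : complex R).

Section At.
Variables (p q n : int) (h : p + q == n).
Definition tinj (t : tensor (X p) (F q)) : total_tensor X F n :=
  @dirsum_inj _ (@total_tensor_summand R X F n) (exist _ (p, q) h) t.
Definition tproj (t : total_tensor X F n) : tensor (X p) (F q) :=
  dirsum_at (exist _ (p, q) h : tdeg n) t.
Fact tinj_is_zmod_morphism : zmod_morphism tinj.
Proof. by move=> t u; rewrite /tinj raddfB. Qed.
Fact tproj_is_zmod_morphism : zmod_morphism tproj.
Proof. by move=> t u; rewrite /tproj raddfB. Qed.
HB.instance Definition _ := GRing.isZmodMorphism.Build (tensor (X p) (F q))
  (total_tensor X F n) tinj tinj_is_zmod_morphism.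
HB.instance Definition _ := GRing.isZmodMorphism.Build (total_tensor X F n)
  (tensor (X p) (F q)) tproj tproj_is_zmod_morphism.
End At.

Lemma tinjK p q n (h h' : p + q == n) t : tproj h (tinj h' t) = t.
Proof. by rewrite (bool_irrelevance h h'); exact: dirsum_injE. Qed.

Lemma tproj_outl p q p' q' n (h : p + q == n) (h' : p' + q' == n) t :
  p' != p -> tproj h (tinj h' t) = 0.
Proof.
move=> pp; apply: dirsum_inj_out; apply: contraNneq pp => /(congr1 val)[-> _].
exact: eqxx.
Qed.

Lemma tproj_outr p q p' q' n (h : p + q == n) (h' : p' + q' == n) t :
  q' != q -> tproj h (tinj h' t) = 0.
Proof.
move=> pp; apply: dirsum_inj_out; apply: contraNneq pp => /(congr1 val)[_ ->].
exact: eqxx.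
Qed.

Lemma total_tensor_ind n (P : total_tensor X F n -> Prop) :
  P 0 -> (forall t u, P t -> P u -> P (t + u)) ->
  (forall p q (h : p + q == n) x y, P (tinj h (tens x y))) -> forall t, P t.
Proof.
move=> P0 PD Pi; elim/dirsum_ind => // -[[p q] h] t.
rewrite -[dirsum_inj t]/(@tinj p q n h t); elim/tensor_ind: t => [|t u Pt Pu|x y].
- by rewrite raddf0.
- by rewrite raddfD; exact: PD.
exact: Pi.
Qed.

Lemma total_tensor_ext n (W : zmodType) (a b : {additive total_tensor X F n -> W}) :
  (forall p q (h : p + q == n) x y, a (tinj h (tens x y)) = b (tinj h (tens x y))) ->
  a =1 b.
Proof.
move=> ab; elim/total_tensor_ind => [|t u at_ au|//]; first by rewrite !raddf0.
by rewrite !raddfD at_ au.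
Qed.

Lemma zdiff_tinj n m (e : n = m + 1) p q p' q' (ep : p = p' + 1) (eq : q = q' + 1)
    (h : p + q == n) (h1 : p' + q == m) (h2 : p + q' == m) x y :
  zdiff (total_tensor X F) e (tinj h (tens x y)) =
  tinj h1 (tens (cdiff X ep x) y) +
  tinj h2 (tens x (cdiff F eq y)) *~ (-1) ^+ `|p|%N.
Proof.
move: p' ep h1; apply: deg_ind => h1; move: q' eq h2; apply: deg_ind => h2.
rewrite -[LHS]/(total_tensor_diff X F e (dirsum_inj _)).
rewrite (@total_tensor_diffE _ X F n m e (exist _ (p, q) h)).
congr (_ + _ *~ _).
  exact: (@total_tensor_inj_irr _ X F m (p - 1, q)).
exact: (@total_tensor_inj_irr _ X F m (p, q - 1)).
Qed.

End TotalSummand.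

Section SemiFree.
Variables (R : pzRingType) (G : int -> choiceType).
Variable d : forall i j : int, i = j + 1 -> {linear free R (G i) -> free R (G j)}.
Hypothesis dK : forall i j k (e : i = j + 1) (e' : j = k + 1) x, d e' (d e x) = 0.

Definition free_complex : complex R := @Complex R (fun i => free R (G i)) d dK.

Definition height_lowering (ht : forall i, G i -> nat) :=
  forall i j (e : i = j + 1) (a : G i) (b : G j),
    (ht i a <= ht j b)%N -> d e (basis R a) b = 0.

End SemiFree.

Section SemiFreeRight.
Variables (R : pzRingType) (G : int -> choiceType).
Variable d : forall i j : int, i = j + 1 -> {linear free R (G i) -> free R (G j)}.
Hypothesis dK : forall i j k (e : i = j + 1) (e' : j = k + 1) x, d e' (d e x) = 0.
Variable ht : forall i, G i -> nat.
Hypothesis d_ht : height_lowering d ht.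
Variable X : complex R^c.
Hypothesis Xa : acyclic X.

Let P := free_complex dK.
Let gen := {i : int & G i}.
Let degP (n i : int) : n - i + i == n.
Proof. by rewrite subrK. Qed.
Let degB (n m i : int) : n = m + 1 -> n - i = m - i + 1.
Proof. by move=> ->; rewrite addrAC. Qed.
Let injf (g : gen) n (y : X (n - tag g)) : total_tensor X P n :=
  @tinj _ X P _ _ _ (degP n (tag g)) (tens y (basis R (tagged g))).
Let injB g n : zmod_morphism (@injf g n).
Proof. by move=> y y'; rewrite /injf tensBl raddfB. Qed.
Let inj g n : {additive X (n - tag g) -> total_tensor X P n} := mkadd (@injB g n).
Let cof (g : gen) n (t : total_tensor X P n) : X (n - tag g) :=
  tcoordr (tagged g) (tproj (degP n (tag g)) t).
Let coB g n : zmod_morphism (@cof g n).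
Proof. by move=> t u; rewrite /cof !raddfB. Qed.
Let co g n : {additive total_tensor X P n -> X (n - tag g)} := mkadd (@coB g n).

Let co_out (g : gen) n p q (h : p + q == n) x (b : P q) :
  q != tag g -> co g n (tinj h (tens x b)) = 0.
Proof.
by move=> qg; rewrite -[LHS]/(cof _ _) /cof tproj_outr // raddf0.
Qed.

Let co_in n i (a : G i) (h : n - i + i == n) x (b : P i) :
  co (Tagged (fun i => G i) a) n (tinj h (tens x b)) = (b a : R^c) *: x.
Proof. by rewrite -[LHS]/(cof _ _) /cof tinjK tcoordrE. Qed.

Let co_in0 n p i (a : G i) (h : p + i == n) x (b : P i) :
  b a = 0 -> co (Tagged (fun i => G i) a) n (tinj h (tens x b)) = 0.
Proof.
move=> b0; have ep : p = n - i by rewrite -(eqP h) addrK.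
by subst p; rewrite co_in b0; exact: scale0r.
Qed.

(** As a graded group X (x) P is the sum of the shifts of X by the degrees of the
    generators of P, and the part of the differential that comes from P lowers
    the height. *)
Lemma semifree_right_acyclic : acyclic (total_tensor X P).
Proof.
have co_inj g n v : co g n (inj g n v) = v.
  case: g v => i a v.
  by rewrite [LHS]co_in coord_basis eqxx; exact: scale1r.
have co_inj_out g g' n v : g != g' -> co g n (inj g' n v) = 0.
  case: g g' v => i a [i' a'] v; have [ii|ii] := eqVneq i' i; last first.
    by move=> _; exact: co_out.
  subst i' => aa; rewrite [LHS]co_in coord_basis.
  case: eqP => [/= aa'|_]; last exact: scale0r.
  by rewrite aa' eqxx in aa.
apply: (@filtered_acyclic _ _ (fun g : gen => ht (tagged g)) _
  (fun g i j (e : i = j + 1) => cdiff X (degB (tag g) e)) inj co) => //.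
- move=> n; elim/total_tensor_ind => [||p q h x b].
  + exact: spanned0.
  + exact: spannedD.
  have [s [_ [_ ->]]] := free_support b.
  rewrite tens_sumr raddf_sum; apply: spanned_sum => a.
  have ep : p = n - q by rewrite -(eqP h) addrK.
  subst p; rewrite -tens_scale (bool_irrelevance h (degP n q)).
  exact: (@spanned_inj _ _ _ (fun g => inj g n) (fun g => co g n)
    (fun g => co_inj g n) (fun g g' => co_inj_out g g' n)
    (Tagged (fun i => G i) a) ((b a : R^c) *: x)).
- by move=> g i j k e e' y /(Xa (degB (tag g) e)).
- move=> [i a] n m e y.
  have h2 : n - i + (i - 1) == m by rewrite addrA subrK e addrK.
  rewrite [X in co _ _ X](@zdiff_tinj _ X P _ _ e _ _ _ _ (degB i e) (pred_succ i)
    _ (degP m i) h2).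
  rewrite raddfD raddfMz [X in _ + X *~ _ = _]co_out; last first.
    by rewrite /= -subr_eq0 addrAC subrr add0r.
  by rewrite mul0rz addr0 co_in coord_basis eqxx; exact: scale1r.
move=> [i a] [i' a'] n m e y aa hh.
have h2 : n - i' + (i' - 1) == m by rewrite addrA subrK e addrK.
rewrite [X in co _ _ X](@zdiff_tinj _ X P _ _ e _ _ _ _ (degB i' e) (pred_succ i')
    _ (degP m i') h2).
rewrite raddfD raddfMz.
rewrite [X in X + _ = _](co_inj_out _ (Tagged (fun i => G i) a')) // add0r.
have [ii|ii] := eqVneq (i' - 1) i; last by rewrite co_out // mul0rz.
subst i; rewrite co_in0 ?mul0rz //; exact: d_ht.
Qed.
End SemiFreeRight.

Section SemiFreeLeft.
Variables (R : pzRingType) (G : int -> choiceType).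
Variable d : forall i j : int, i = j + 1 -> {linear free R^c (G i) -> free R^c (G j)}.
Hypothesis dK : forall i j k (e : i = j + 1) (e' : j = k + 1) x, d e' (d e x) = 0.
Variable ht : forall i, G i -> nat.
Hypothesis d_ht : height_lowering d ht.
Variable K : complex R.
Hypothesis Ka : acyclic K.

Let P := free_complex dK.
Let gen := {i : int & G i}.
Let degP (n i : int) : i + (n - i) == n.
Proof. by rewrite addrC subrK. Qed.
Let degB (n m i : int) : n = m + 1 -> n - i = m - i + 1.
Proof. by move=> ->; rewrite addrAC. Qed.
Let injf (g : gen) n (y : K (n - tag g)) : total_tensor P K n :=
  @tinj _ P K _ _ _ (degP n (tag g)) (tens (basis R^c (tagged g)) y).
Let injB g n : zmod_morphism (@injf g n).
Proof. by move=> y y'; rewrite /injf tensBr raddfB. Qed.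
Let inj g n : {additive K (n - tag g) -> total_tensor P K n} := mkadd (@injB g n).
Let cof (g : gen) n (t : total_tensor P K n) : K (n - tag g) :=
  tcoordl (tagged g) (tproj (degP n (tag g)) t).
Let coB g n : zmod_morphism (@cof g n).
Proof. by move=> t u; rewrite /cof !raddfB. Qed.
Let co g n : {additive total_tensor P K n -> K (n - tag g)} := mkadd (@coB g n).

Let co_out (g : gen) n p q (h : p + q == n) (b : P p) x :
  p != tag g -> co g n (tinj h (tens b x)) = 0.
Proof.
by move=> qg; rewrite -[LHS]/(cof _ _) /cof tproj_outl // raddf0.
Qed.

Let co_in n i (a : G i) (h : i + (n - i) == n) (b : P i) x :
  co (Tagged (fun i => G i) a) n (tinj h (tens b x)) = (b a : R) *: x.
Proof. by rewrite -[LHS]/(cof _ _) /cof tinjK tcoordlE. Qed.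

Let co_in0 n p i (a : G i) (h : i + p == n) (b : P i) x :
  b a = 0 -> co (Tagged (fun i => G i) a) n (tinj h (tens b x)) = 0.
Proof.
move=> b0; have ep : p = n - i by rewrite -(eqP h) addrAC subrr add0r.
by subst p; rewrite co_in b0; exact: scale0r.
Qed.

(** Here the copy of K at a generator of degree i carries the differential of K
    times (-1)^i. *)
Lemma semifree_left_acyclic : acyclic (total_tensor P K).
Proof.
have co_inj g n v : co g n (inj g n v) = v.
  case: g v => i a v.
  by rewrite [LHS]co_in coord_basis eqxx; exact: scale1r.
have co_inj_out g g' n v : g != g' -> co g n (inj g' n v) = 0.
  case: g g' v => i a [i' a'] v; have [ii|ii] := eqVneq i' i; last first.
    by move=> _; exact: co_out.
  subst i' => aa; rewrite [LHS]co_in coord_basis.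
  case: eqP => [/= aa'|_]; last exact: scale0r.
  by rewrite aa' eqxx in aa.
apply: (@filtered_acyclic _ _ (fun g : gen => ht (tagged g)) _
  (fun g i j (e : i = j + 1) y =>
     cdiff K (degB (tag g) e) y *~ (-1) ^+ `|tag g|%N) inj co) => //.
- move=> n; elim/total_tensor_ind => [||p q h b x].
  + exact: spanned0.
  + exact: spannedD.
  have [s [_ [_ ->]]] := free_support b.
  rewrite tens_suml raddf_sum; apply: spanned_sum => a.
  have eq : q = n - p by rewrite -(eqP h) addrAC subrr add0r.
  subst q; rewrite tens_scale (bool_irrelevance h (degP n p)).
  exact: (@spanned_inj _ _ _ (fun g => inj g n) (fun g => co g n)
    (fun g => co_inj g n) (fun g g' => co_inj_out g g' n)
    (Tagged (fun i => G i) a) ((b a : R) *: x)).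
- move=> g i j k e e' y /(congr1 (fun z => z *~ (-1) ^+ `|tag g|%N)).
  rewrite -mulrzA sign_sq mulr1z mul0rz => /(Ka (degB (tag g) e))[x xE].
  exists (x *~ (-1) ^+ `|tag g|%N).
  by rewrite raddfMz -mulrzA sign_sq mulr1z.
- move=> [i a] n m e y.
  have h1 : i - 1 + (n - i) == m by rewrite addrC addrA subrK e addrK.
  rewrite [X in co _ _ X](@zdiff_tinj _ P K _ _ e _ _ _ _ (pred_succ i) (degB i e)
    _ h1 (degP m i)).
  rewrite raddfD raddfMz [X in X + _ = _]co_out; last first.
    by rewrite /= -subr_eq0 addrAC subrr add0r.
  by rewrite add0r co_in coord_basis eqxx; congr (_ *~ _); exact: scale1r.
move=> [i a] [i' a'] n m e y aa hh.
have h1 : i' - 1 + (n - i') == m by rewrite addrC addrA subrK e addrK.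
rewrite [X in co _ _ X](@zdiff_tinj _ P K _ _ e _ _ _ _ (pred_succ i') (degB i' e)
    _ h1 (degP m i')).
rewrite raddfD raddfMz.
rewrite [X in _ + X *~ _ = _](co_inj_out _ (Tagged (fun i => G i) a')) // mul0rz addr0.
have [ii|ii] := eqVneq (i' - 1) i; last by rewrite co_out.
subst i; rewrite co_in0 //; exact: d_ht.
Qed.

End SemiFreeLeft.

(** * Total tensor products of short exact sequences *)

Section DirSumMap.
Variables (I : choiceType) (V W : I -> zmodType).
Variable f : forall i, {additive V i -> W i}.

Fact dirsum_map_supp (t : dirsum V) : ((fun i => f i (t i)) : dprod W) \in @finsupp _ W.
Proof.
have [tS _] := dirsum_supp t; apply/asboolP; apply: sub_finite_set tS => i /=.
by apply: contraNN => /eqP ->; rewrite raddf0.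
Qed.
Definition dirsum_map (t : dirsum V) : dirsum W := DirSum (dirsum_map_supp t).
Fact dirsum_map_is_zmod_morphism : zmod_morphism dirsum_map.
Proof. by move=> t u; apply: dirsumP => i; exact: raddfB. Qed.
HB.instance Definition _ := GRing.isZmodMorphism.Build (dirsum V) (dirsum W)
  dirsum_map dirsum_map_is_zmod_morphism.
End DirSumMap.

Lemma dirsum_map_inj (I : choiceType) (V W : I -> zmodType)
    (f : forall i, {additive V i -> W i}) i (x : V i) :
  dirsum_map f (dirsum_inj x) = dirsum_inj (f i x).
Proof.
apply: dirsumP => j; rewrite -[LHS]/(f j (dirsum_at j (dirsum_inj x))).
rewrite -[RHS]/(dirsum_at j _); have [ij|ij] := eqVneq i j.
  by subst j; rewrite /dirsum_at !dirsum_injE.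
by rewrite /dirsum_at !dirsum_inj_out // raddf0.
Qed.

Lemma dirsum_map_short_exact (I : choiceType) (V W U : I -> zmodType)
    (f : forall i, {additive V i -> W i}) (g : forall i, {additive W i -> U i}) :
  (forall i, short_exact (f i) (g i)) ->
  short_exact (dirsum_map f) (dirsum_map g).
Proof.
move=> fg; split.
- apply: additive_inj => t t0; apply: dirsumP => i; have [fI _ _] := fg i.
  by apply: fI; rewrite raddf0; exact: (congr1 (dirsum_at i) t0).
- move=> t; split=> [t0|[u <-]]; last first.
    apply: dirsumP => i; have [_ fgE _] := fg i.
    by apply/fgE; exists (u i).
  have H i : exists x, f i x = t i.
    by have [_ fgE _] := fg i; apply/fgE; exact: (congr1 (dirsum_at i) t0).
  pose u i := if t i == 0 then 0 else sval (cid (H i)).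
  have uE i : f i (u i) = t i.
    by rewrite /u; case: eqP => [->|_]; [rewrite raddf0 | case: cid].
  have uS : (u : dprod V) \in @finsupp _ V.
    have [tS _] := dirsum_supp t; apply/asboolP; apply: sub_finite_set tS => i /=.
    by apply: contraNN => ti; rewrite /u ti.
  by exists (DirSum uS); apply: dirsumP => i; exact: uE.
- move=> t.
  have H i : exists x, g i x = t i by have [_ _ gS] := fg i; apply: gS.
  pose u i := if t i == 0 then 0 else sval (cid (H i)).
  have uE i : g i (u i) = t i.
    by rewrite /u; case: eqP => [->|_]; [rewrite raddf0 | case: cid].
  have uS : (u : dprod W) \in @finsupp _ W.
    have [tS _] := dirsum_supp t; apply/asboolP; apply: sub_finite_set tS => i /=.
    by apply: contraNN => ti; rewrite /u ti.
  by exists (DirSum uS); apply: dirsumP => i; exact: uE.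
Qed.

Section TotalMap.
Variables (R : pzRingType) (X X' : complex R^c) (F F' : complex R).
Variables (f : chain_map X X') (g : chain_map F F').

Definition total_map n : total_tensor X F n -> total_tensor X' F' n :=
  dirsum_map (fun pq : tdeg n => tensor_map (f (val pq).1) (g (val pq).2)
    : {additive total_tensor_summand X F pq -> total_tensor_summand X' F' pq}).
HB.instance Definition _ n := GRing.isZmodMorphism.Build
  (total_tensor X F n) (total_tensor X' F' n) (@total_map n)
  (@dirsum_map_is_zmod_morphism _ _ _ _).

Lemma total_map_tinj n p q (h : p + q == n) t :
  total_map (tinj h t) = tinj h (tensor_map (f p) (g q) t).
Proof. exact: dirsum_map_inj. Qed.

Lemma total_map_diff n m (e : n = m + 1) t :
  total_map (zdiff (total_tensor X F) e t) = zdiff (total_tensor X' F') e (total_map t).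
Proof.
move: t; apply: (@total_tensor_ext _ _ _ _ _ (@total_map m \o zdiff (total_tensor X F) e)
  (zdiff (total_tensor X' F') e \o @total_map n)) => p q h x y.
have h1 : p - 1 + q == m by rewrite addrAC (eqP h) e addrK.
have h2 : p + (q - 1) == m by rewrite addrA (eqP h) e addrK.
rewrite -[LHS]/(total_map (zdiff (total_tensor X F) e (tinj h (tens x y)))).
rewrite -[RHS]/(zdiff (total_tensor X' F') e (total_map (tinj h (tens x y)))).
rewrite total_map_tinj tensor_mapE.
rewrite !(zdiff_tinj e (pred_succ p) (pred_succ q) _ h1 h2).
rewrite raddfD raddfMz /= !total_map_tinj !tensor_mapE.
by rewrite !chain_mapP.
Qed.

End TotalMap.

Definition id_chain_map (R : pzRingType) (X : complex R) : chain_map X X :=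
  @mk_chain_map R X X (fun i => idfun) (fun _ _ _ _ => erefl).

Section TotalShortExact.
Variable R : pzRingType.

(** Exact in each degree because F_n is projective, so that the sequence splits. *)
Lemma total_ses_right (X : complex R^c) (K P F : complex R) (i : chain_map K P)
    (p : chain_map P F) :
  (forall n, short_exact (i n) (p n)) -> (forall n, projective (F n)) ->
  acyclic (total_tensor X P) -> acyclic (total_tensor X F) ->
  acyclic (total_tensor X K).
Proof.
move=> ip Fp.
apply: (@ses_acyclicl (total_tensor X K) (total_tensor X P) (total_tensor X F)
  (fun n => @total_map _ _ _ _ _ (id_chain_map X) i n)
  (fun n => @total_map _ _ _ _ _ (id_chain_map X) p n)).
- by move=> n m e t; exact: total_map_diff.
- by move=> n m e t; exact: total_map_diff.
move=> n; apply: dirsum_map_short_exact => -[[a b] h] /=.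
have [iI ipE pS] := ip b; have [r rK] := split_retraction (ip b) (@Fp b).
split.
- apply: additive_inj => t t0.
  rewrite -[t](tensor_map_id (f := idfun) (g := idfun)) //.
  rewrite -(@tensor_map_comp _ _ _ _ _ _ _ idfun idfun (i b) r) //.
  by rewrite [X in tensor_map _ _ X]t0 raddf0.
- exact: tensor_right_exactr.
- by apply: tensor_map_surj => // x; exists x.
Qed.

(** Exact in each degree because K_n is flat. *)
Lemma total_ses_left (K : complex R) (X P W : complex R^c) (i : chain_map X P)
    (p : chain_map P W) :
  (forall n, short_exact (i n) (p n)) -> (forall n, flat (K n)) ->
  acyclic (total_tensor X K) -> acyclic (total_tensor P K) ->
  acyclic (total_tensor W K).
Proof.
move=> ip Kf.
apply: (@ses_acyclicr (total_tensor X K) (total_tensor P K) (total_tensor W K)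
  (fun n => @total_map _ _ _ _ _ i (id_chain_map K) n)
  (fun n => @total_map _ _ _ _ _ p (id_chain_map K) n)).
- by move=> n m e t; exact: total_map_diff.
- by move=> n m e t; exact: total_map_diff.
move=> n; apply: dirsum_map_short_exact => -[[a b] h] /=.
have [iI ipE pS] := ip a; split.
- apply: additive_inj => t; apply: flat_inj; first exact: Kf.
  by move=> x ix; apply: iI; rewrite ix raddf0.
- exact: tensor_right_exactl.
- by apply: tensor_map_surj => // x; exists x.
Qed.

End TotalShortExact.

(** * Complexes concentrated in degree 0 *)

Section Concentrated.
Variables (R : pzRingType) (F : lmodType R).

Fact conc_closed (i : int) : submod_closed [pred x : F | (i == 0) || (x == 0)].
Proof.
split; first by rewrite inE eqxx orbT.
move=> a x y; rewrite !inE; case: (i == 0) => //= /eqP -> /eqP ->.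
by rewrite scaler0 addr0.
Qed.
(** The zero submodule in degree i <> 0. In this encoding every degree is a
    retract of F and no transport between degrees is needed. *)
Definition conc_sub (i : int) : submodule F := Submodule (conc_closed i).
Definition conc_diff (i j : int) (e : i = j + 1) :
  {linear submod (conc_sub i) -> submod (conc_sub j)} := \0.
Fact conc_diffK (i j k : int) (e : i = j + 1) (e' : j = k + 1) x :
  conc_diff e' (conc_diff e x) = 0.
Proof. by []. Qed.
Definition conc : complex R := Complex conc_diffK.

Definition conc_out (i : int) : {linear conc i -> F} := @submod_incl _ _ (conc_sub i).

Fact conc_in_subproof i (x : F) : (if i == 0 then x else 0) \in conc_sub i.
Proof. by rewrite inE; case: ifP => //= _; rewrite eqxx. Qed.
Definition conc_in_fun i (x : F) : conc i := Submod (conc_in_subproof i x).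
Fact conc_in_is_linear i : linear (conc_in_fun i).
Proof.
move=> a x y; apply: val_inj; rewrite /=; case: ifP => // _.
by rewrite scaler0 addr0.
Qed.
HB.instance Definition _ i := GRing.isLinear.Build R F (conc i) *:%R
  (conc_in_fun i) (conc_in_is_linear i).
Definition conc_in i : {linear F -> conc i} := conc_in_fun i.

Lemma conc_outK i : cancel (conc_out i) (conc_in i).
Proof.
move=> [x xS]; apply: val_inj; rewrite /= /submod_incl /=.
by have := xS; rewrite inE; case: ifP => //= _ /eqP.
Qed.

Lemma conc_inK : cancel (conc_in 0) (conc_out 0).
Proof. by []. Qed.

Lemma conc_eq0 i (x : conc i) : i != 0 -> x = 0.
Proof.
by move=> i0; rewrite -[x]conc_outK; apply: val_inj; rewrite /= (negbTE i0).
Qed.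

Lemma conc_flat : flat F -> forall i, flat (conc i).
Proof. by move=> Ff i; exact: flat_retract (conc_outK (i := i)) Ff. Qed.

End Concentrated.

Section ConcentratedTensor.
Variable R : pzRingType.

(** The tensor product of X with the concentrated complex is X (x) F degreewise:
    [io] and [pr] are inverse isomorphisms, and [io] commutes with differentials. *)
Lemma conc_semi_flat (F : lmodType R) : flat F -> semi_flat (conc F).
Proof.
move=> Ff; split; first exact: conc_flat.
move=> X Xa i j k e e' t; split=> [dt|[u <-]]; last exact: zdiffK.
pose T := total_tensor X (conc F).
have h (n : int) : n + 0 == n by rewrite addr0.
pose io n u : T n := tinj (h n) (tensor_map (idfun : {linear X n -> X n}) (conc_in F 0) u).
pose pr n t := tensor_map (idfun : {linear X n -> X n}) (conc_out F 0) (tproj (h n) (t : T n)).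
have ioK n (s : T n) : io n (pr n s) = s.
  move: s; apply: (@total_tensor_ext _ _ _ _ _
    (@tinj _ X (conc F) _ _ _ (h n) \o (tensor_map idfun (conc_in F 0) \o
      (tensor_map idfun (conc_out F 0) \o tproj (h n)))) idfun).
  move=> p q hpq x y /=; have [q0|q0] := eqVneq q 0; last first.
    by rewrite (conc_eq0 y q0) tens0r !raddf0.
  subst q; have pn : p = n by rewrite -(eqP hpq) addr0.
  subst p; rewrite tinjK !tensor_mapE conc_outK.
  by rewrite (bool_irrelevance hpq (h n)).
have prK n u : pr n (io n u) = u.
  rewrite /pr /io tinjK (@tensor_map_comp _ _ _ _ _ _ _ _ _ _ _ idfun idfun) //.
  exact: tensor_map_id.
have dio n m (ee : n = m + 1) u :
    zdiff T ee (io n u) = io m (tensor_map (cdiff X ee) idfun u).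
  move: u; apply: (@tensor_ext _ _ _ _
    (zdiff T ee \o (@tinj _ X (conc F) _ _ _ (h n) \o tensor_map idfun (conc_in F 0)))
    (@tinj _ X (conc F) _ _ _ (h m) \o (tensor_map idfun (conc_in F 0) \o
      tensor_map (cdiff X ee) idfun))) => x y.
  have h2 : n + (0 - 1) == m by rewrite add0r ee addrK.
  rewrite -[LHS]/(zdiff T ee (tinj (h n) (tensor_map idfun (conc_in F 0) (tens x y)))).
  rewrite tensor_mapE (zdiff_tinj ee ee (pred_succ 0) (h n) (h m) h2).
  rewrite -[cdiff (conc F) _ _]/0 tens0r raddf0 mul0rz addr0.
  by rewrite /= !tensor_mapE.
have [|u uE] := (Ff _ _ _ _ _ (Xa i j k e e') (pr j t)).1.
  by rewrite -[LHS]prK -dio ioK dt /pr !raddf0.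
by exists (io i u); rewrite dio uE ioK.
Qed.

Lemma conc_tensor_exact (W : lmodType R^c) (K : complex R) :
  acyclic (total_tensor (conc W) K) ->
  forall i j k (e : i = j + 1) (e' : j = k + 1),
    exact_at (tensor_map (idfun : {linear W -> W}) (cdiff K e))
             (tensor_map (idfun : {linear W -> W}) (cdiff K e')).
Proof.
move=> Ta i j k e e' t; split=> [dt|[u <-]]; last first.
  rewrite (@tensor_map_comp _ _ _ _ _ _ _ _ _ _ _ idfun (cdiff K e' \o cdiff K e)) //.
  by apply: tensor_map0r => x /=; exact: cdiffK.
pose T := total_tensor (conc W) K.
have h (n : int) : 0 + n == n by rewrite add0r.
pose io n u : T n := tinj (h n) (tensor_map (conc_in W 0) (idfun : {linear K n -> K n}) u).
pose pr n t := tensor_map (conc_out W 0) (idfun : {linear K n -> K n}) (tproj (h n) (t : T n)).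
have ioK n (s : T n) : io n (pr n s) = s.
  move: s; apply: (@total_tensor_ext _ _ _ _ _
    (@tinj _ (conc W) K _ _ _ (h n) \o (tensor_map (conc_in W 0) idfun \o
      (tensor_map (conc_out W 0) idfun \o tproj (h n)))) idfun).
  move=> p q hpq x y /=; have [p0|p0] := eqVneq p 0; last first.
    by rewrite (conc_eq0 x p0) tens0l !raddf0.
  subst p; have qn : q = n by rewrite -(eqP hpq) add0r.
  subst q; rewrite tinjK !tensor_mapE conc_outK.
  by rewrite (bool_irrelevance hpq (h n)).
have prK n u : pr n (io n u) = u.
  rewrite /pr /io tinjK (@tensor_map_comp _ _ _ _ _ _ _ _ _ _ _ idfun idfun) //.
  exact: tensor_map_id.
have dio n m (ee : n = m + 1) u :
    zdiff T ee (io n u) = io m (tensor_map idfun (cdiff K ee) u).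
  move: u; apply: (@tensor_ext _ _ _ _
    (zdiff T ee \o (@tinj _ (conc W) K _ _ _ (h n) \o tensor_map (conc_in W 0) idfun))
    (@tinj _ (conc W) K _ _ _ (h m) \o (tensor_map (conc_in W 0) idfun \o
      tensor_map idfun (cdiff K ee)))) => x y.
  have h1 : 0 - 1 + n == m by rewrite sub0r addrC ee addrK.
  rewrite -[LHS]/(zdiff T ee (tinj (h n) (tensor_map (conc_in W 0) idfun (tens x y)))).
  rewrite tensor_mapE (zdiff_tinj ee (pred_succ 0) ee (h n) h1 (h m)).
  rewrite -[cdiff (conc W) _ _]/0 tens0l raddf0 add0r expr0 mulr1z.
  by rewrite /= !tensor_mapE.
have [|s sE] := (Ta i j k e e' (io j t)).1; first by rewrite dio dt /io !raddf0.
exists (pr i s); rewrite -[LHS]prK -dio ioK [X in pr _ X]sE; exact: prK.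
Qed.

End ConcentratedTensor.

(** * The semi-free resolution of a complex *)

Section Tree.
Variables (R : pzRingType) (M : complex R).

(** A generator of degree i is the formal datum of a chain (a finite linear
    combination of generators of degree i - 1) and an element of M_i. All cells
    of the resolution are produced at once, with no colimit of stages. *)
Inductive gen (i : int) : Type :=
  Gen (n : nat) (c : 'I_n -> R) (gs : 'I_n -> gen (i - 1)) (m : M i).

HB.instance Definition _ i := gen_eqMixin (gen i).
HB.instance Definition _ i := gen_choiceMixin (gen i).

Definition gen_val i (g : gen i) : M i := let: Gen _ _ _ m := g in m.

Definition gen_bnd i (g : gen i) : free R (gen (i - 1)) :=
  let: Gen n c gs _ := g in \sum_k c k *: basis R (gs k).

(** The generator is valid if its chain z is a cycle with f(z) = dm, for the
    differential and the map f to M that send an invalid generator to 0 and a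
    valid one to z and to m. An invalid generator is thus a cycle over 0, and
    the resolution contains generators that bound it. *)
Fixpoint gen_valid i (g : gen i) : bool :=
  let: Gen n c gs m := g in
  `[< \sum_k c k *: (if gen_valid (gs k) then gen_bnd (gs k) else 0) = 0 /\
      \sum_k c k *: (if gen_valid (gs k) then gen_val (gs k) else 0) =
        cdiff M (pred_succ i) m >].

Fixpoint gen_height i (g : gen i) : nat :=
  let: Gen n c gs m := g in (\max_k gen_height (gs k)).+1.

Definition tree_pred i : {linear free R (gen i) -> free R (gen (i - 1))} :=
  free_lift (fun g : gen i => if gen_valid g then gen_bnd g else 0).

Definition tree_val i : {linear free R (gen i) -> M i} :=
  free_lift (fun g : gen i => if gen_valid g then gen_val g else 0).

Lemma tree_pred_basis i (g : gen i) :
  tree_pred i (basis R g) = if gen_valid g then gen_bnd g else 0.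
Proof. exact: free_lift_basis. Qed.

Lemma tree_val_basis i (g : gen i) :
  tree_val i (basis R g) = if gen_valid g then gen_val g else 0.
Proof. exact: free_lift_basis. Qed.

Lemma gen_validP i (g : gen i) : reflect (tree_pred (i - 1) (gen_bnd g) = 0 /\
  tree_val (i - 1) (gen_bnd g) = cdiff M (pred_succ i) (gen_val g)) (gen_valid g).
Proof.
case: g => n c gs m; apply: (equivP (asboolP _)).
rewrite !linear_sum /=.
rewrite [in X in _ <-> (X = 0 /\ _)](eq_bigr (fun k => c k *:
  (if gen_valid (gs k) then gen_bnd (gs k) else 0))); last first.
  by move=> k _; rewrite linearZ /= free_lift_basis.
rewrite [in X in _ <-> (_ /\ X = _)](eq_bigr (fun k => c k *:
  (if gen_valid (gs k) then gen_val (gs k) else 0))) //.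
by move=> k _; rewrite linearZ /= free_lift_basis.
Qed.

Lemma tree_predK i x : tree_pred (i - 1) (tree_pred i x) = 0.
Proof.
move: x; apply: (@free_ext _ _ _ (tree_pred (i - 1) \o tree_pred i) \0) => g.
rewrite /= free_lift_basis; case: gen_validP => [[]//|_]; exact: linear0.
Qed.

Lemma tree_val_pred i x :
  tree_val (i - 1) (tree_pred i x) = cdiff M (pred_succ i) (tree_val i x).
Proof.
move: x; apply: (@free_ext _ _ _ (tree_val (i - 1) \o tree_pred i)
  (cdiff M (pred_succ i) \o tree_val i)) => g.
rewrite /= !free_lift_basis; case: gen_validP => [[]//|_].
by rewrite !linear0.
Qed.

Fact deg_pred (i j : int) : i = j + 1 -> i - 1 = j.
Proof. by move=> ->; rewrite addrK. Qed.

Definition tree_diff i j (e : i = j + 1) : {linear free R (gen i) -> free R (gen j)} :=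
  ecast k {linear free R (gen i) -> free R (gen k)} (deg_pred e) (tree_pred i).

Lemma tree_diff_pred i : tree_diff (pred_succ i) = tree_pred i.
Proof. by rewrite /tree_diff (eq_irrelevance (deg_pred (pred_succ i)) erefl). Qed.

Fact tree_diffK i j k (e : i = j + 1) (e' : j = k + 1) x :
  tree_diff e' (tree_diff e x) = 0.
Proof.
move: k e'; apply: deg_ind; move: j e; apply: deg_ind.
by rewrite !tree_diff_pred tree_predK.
Qed.

Definition tree : complex R := free_complex tree_diffK.

Fact tree_map_subproof i j (e : i = j + 1) x :
  tree_val j (cdiff tree e x) = cdiff M e (tree_val i x).
Proof.
move: j e; apply: deg_ind.
by rewrite -[cdiff tree _]/(tree_diff _) tree_diff_pred tree_val_pred.
Qed.
Definition tree_map : chain_map tree M :=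
  mk_chain_map (L := tree) (f := tree_val) tree_map_subproof.

Lemma tree_height : height_lowering tree_diff gen_height.
Proof.
move=> i j e a; move: j e; apply: deg_ind => b ab; rewrite tree_diff_pred tree_pred_basis.
case: ifP => // _; case: a ab => n c gs m /= ab.
rewrite -[LHS]/(coord b _) raddf_sum /= big1 // => k _.
rewrite coordZ coord_basis; case: eqP => [kb|_]; last exact: mulr0.
by move: ab; rewrite -kb ltnNge (leq_bigmax k).
Qed.

(** The hypotheses say that the generator with datum (z, m) is valid. *)
Lemma tree_fill i (z : tree (i - 1)) (m : M i) : tree_pred (i - 1) z = 0 ->
  tree_val (i - 1) z = cdiff M (pred_succ i) m ->
  exists x : tree i, tree_pred i x = z /\ tree_val i x = m.
Proof.
move=> dz fz; have [s [_ [_ zE]]] := free_support z.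
pose g := Gen (fun k : 'I_(size s) => z (tnth (in_tuple s) k))
  (tnth (in_tuple s)) m.
have gE : gen_bnd g = z by rewrite /= [RHS]zE [RHS]big_tnth.
have gv : gen_valid g by apply/gen_validP; rewrite gE.
by exists (basis R g); rewrite tree_pred_basis tree_val_basis gv gE.
Qed.

(** A generator with datum (0, dm) is a cycle over dm, which a second generator
    with value m bounds. *)
Lemma tree_map_surj i : surjective (tree_map i).
Proof.
move=> m.
have [|| z [dz fz]] := @tree_fill (i - 1) 0 (cdiff M (pred_succ i) m).
- exact: linear0.
- by rewrite linear0 cdiffK.
by have [x [_ fx]] := tree_fill dz fz; exists x.
Qed.

(** A cycle m of M is hit by the generator with datum (0, m), and a cycle z over
    a boundary dm is bounded by the generator with datum (z, m). *)
Lemma tree_quasi_iso : quasi_iso tree_map.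
Proof.
apply/quasi_isoP; split.
  move=> i j k e e' m; move: k e'; apply: deg_ind => dm.
  have [|| z [dz fz]] := @tree_fill j 0 m; rewrite ?linear0 ?dm //.
  exists z, 0; rewrite linear0 addr0; split=> //.
  by rewrite -[cdiff tree _]/(tree_diff _) tree_diff_pred.
move=> i j k e e' y x; move: k e'; apply: deg_ind.
rewrite -[cdiff tree _]/(tree_diff _) tree_diff_pred.
move: j e y; apply: deg_ind => y dy fy.
have [w [dw _]] := tree_fill dy fy; exists w.
by rewrite -[cdiff tree _]/(tree_diff _) tree_diff_pred.
Qed.

Section TreeHom.
Variables (N : complex R) (Na : acyclic N) (n m : int) (e : n = m + 1).
Variable f : total_hom_obj tree N m.
Hypothesis df0 : forall k (e' : m = k + 1), total_hom_diff tree N e' f = 0.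

Fact hdegS (p q : int) : q - p == n -> (p, q - 1).2 - (p, q - 1).1 == m.
Proof. by move=> /eqP pq /=; rewrite addrAC pq e addrK. Qed.
Fact hdegB (p q : int) : q - p == n -> (q - 1) - (p - 1) == n.
Proof. by rewrite opprB addrA subrK. Qed.

(** A chain g with dg = f, chosen on generators by recursion: its value y on a
    generator a has to satisfy dy = f(a) + (-1)^n g(da), and da involves only
    subtrees of a. *)
Fixpoint tree_lift p (g : gen p) : forall q, q - p == n -> N q :=
  let: Gen k c gs x := g in fun q h =>
  xget 0 [set y | cdiff N (pred_succ q) y =
    f (exist _ (p, q - 1) (hdegS h)) (basis R (Gen c gs x)) +
    (if gen_valid (Gen c gs x)
     then \sum_l c l *: tree_lift (gs l) (hdegB h) else 0) *~ (-1) ^+ `|n|%N].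

Definition tree_hom p q (h : q - p == n) : {linear tree p -> N q} :=
  free_lift (fun g : gen p => tree_lift g h).

Lemma tree_hom_pred p q (h : q - p == n) (g : gen p) :
  tree_hom (hdegB h) (tree_pred p (basis R g)) =
  if gen_valid g then let: Gen k c gs x := g in
    \sum_l c l *: tree_lift (gs l) (hdegB h) else 0.
Proof.
rewrite tree_pred_basis; case: ifP => _; last exact: linear0.
case: g => k c gs x; rewrite linear_sum; apply: eq_bigr => l _.
by rewrite linearZ /= free_lift_basis.
Qed.

(** The required value exists as N is acyclic: the right-hand side is a cycle by
    the equation on subtrees, together with d (d a) = 0 and df = 0. *)
Lemma tree_liftE p (g : gen p) q (h : q - p == n) :
  cdiff N (pred_succ q) (tree_lift g h) =
    f (exist _ (p, q - 1) (hdegS h)) (basis R g) +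
    tree_hom (hdegB h) (tree_pred p (basis R g)) *~ (-1) ^+ `|n|%N.
Proof.
elim: g q h => {}p k c gs IH x q h; set g := Gen c gs x.
set rhs := (X in _ = X).
have -> : tree_lift g h = xget 0 [set y | cdiff N (pred_succ q) y = rhs].
  by rewrite /rhs tree_hom_pred.
apply: (@xgetPex _ 0 [set y | cdiff N (pred_succ q) y = rhs]).
apply: (Na (pred_succ q) (pred_succ (q - 1)) _).1; rewrite /rhs.
set z := tree_pred p (basis R g).
pose v : lhom (tree (p - 1)) (N (q - 1 - 1)) :=
  f (exist _ (p - 1, q - 1 - 1) (hdegS (hdegB h))) +
  (tree_hom (hdegB (hdegB h)) \o tree_pred (p - 1) : lhom _ _) *~ (-1) ^+ `|n|%N.
have vE y : v y = f (exist _ (p - 1, q - 1 - 1) (hdegS (hdegB h))) y +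
    tree_hom (hdegB (hdegB h)) (tree_pred (p - 1) y) *~ (-1) ^+ `|n|%N.
  by rewrite -[LHS]/(_ + _) lhom_mulz.
have vg l : cdiff N (pred_succ (q - 1)) (tree_hom (hdegB h) (basis R (gs l))) =
    v (basis R (gs l)).
  by rewrite vE -IH; congr (cdiff _ _ _); exact: free_lift_basis.
have uv : cdiff N (pred_succ (q - 1)) (tree_hom (hdegB h) z) = v z.
  rewrite /z tree_pred_basis; case: ifP => _; last by rewrite !linear0.
  rewrite [tree_hom _ _]linear_sum linear_sum [RHS]linear_sum.
  apply: eq_bigr => l _.
  by rewrite [tree_hom _ _]linearZ linearZ [RHS]linearZ vg.
rewrite -[LHS]/(cdiff N (pred_succ (q - 1)) _) linearD raddfMz /= uv vE.
rewrite tree_predK linear0 mul0rz addr0.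
rewrite (@total_hom_cycleE _ _ _ _ _ (pred_succ m) f _ _ _ _ (pred_succ p)
  (pred_succ (q - 1)) (hdegS h) (hdegS (hdegB h))) //.
rewrite -[cdiff tree _]/(tree_diff _) tree_diff_pred -/z.
by rewrite (sign_succ e) mulrNz subrr.
Qed.

Lemma tree_hom_bounds : exists g, total_hom_diff tree N e g = f.
Proof.
exists (hom_family tree_hom); apply: total_hom_eqP => p q h.
have h1 : (q + 1) - p == n by rewrite addrAC (eqP h) e.
have h2 : q - (p - 1) == n by rewrite opprB addrCA addrC (eqP h) e.
have E (a : gen p) : cdiff N (erefl (q + 1)) (tree_hom h1 (basis R a)) =
    f (exist _ (p, q) h) (basis R a) +
    tree_hom h2 (tree_pred p (basis R a)) *~ (-1) ^+ `|n|%N.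
  have : forall q' (e' : q' = q + 1) (h' : q' - p == n),
      cdiff N e' (tree_hom h' (basis R a)) = f (exist _ (p, q) h) (basis R a) +
        tree_hom h2 (tree_pred p (basis R a)) *~ (-1) ^+ `|n|%N.
    move=> q' e' h'; move: q e' h h2 {h1}; apply: deg_ind => h h2.
    rewrite [tree_hom h' _]free_lift_basis tree_liftE.
    by rewrite (bool_irrelevance (hdegB h') h2) (bool_irrelevance (hdegS h') h).
  by apply.
pose u : lhom (tree p) (N q) := (cdiff N (erefl (q + 1)) \o tree_hom h1 : lhom _ _)
  - (tree_hom h2 \o tree_pred p : lhom _ _) *~ (-1) ^+ `|n|%N.
have uE y : u y = cdiff N (erefl (q + 1)) (tree_hom h1 y) -
    tree_hom h2 (tree_pred p y) *~ (-1) ^+ `|n|%N.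
  by rewrite -[LHS]/(_ - _) lhom_mulz.
move=> x; rewrite (@total_hom_diffE _ _ _ n m e _ p q _ _ (pred_succ p) erefl h h1 h2).
rewrite -[LHS]/(cdiff N erefl (tree_hom h1 x) -
  tree_hom h2 (tree_diff (pred_succ p) x) *~ (-1) ^+ `|n|%N) tree_diff_pred.
rewrite -uE; move: x; apply: free_ext => a.
by rewrite uE E addrK.
Qed.

End TreeHom.

Lemma tree_hom_acyclic (N : complex R) : acyclic N -> acyclic (total_hom tree N).
Proof.
move=> Na; apply: total_hom_acyclic_of => n m e f df0.
exact: tree_hom_bounds.
Qed.

Lemma tree_semi_projective : semi_projective tree.
Proof.
by split=> [i|N Na]; [exact: free_projective | exact: tree_hom_acyclic].
Qed.

End Tree.

(** * Kernels of resolutions *)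

Section KernelComplex.
Variables (R : pzRingType) (P F : complex R) (p : chain_map P F).

Fact ker_sub_diff i j (e : i = j + 1) x :
  x \in kermod (p i) -> cdiff P e x \in kermod (p j).
Proof. by rewrite !inE chain_mapP => /eqP ->; rewrite linear0. Qed.
Definition ker_sub : subcomplex P := Subcomplex ker_sub_diff.

Lemma sub_short_exact (L : subcomplex P) (N : complex R) (q : chain_map P N) :
  (forall i, surjective (q i)) -> (forall i x, q i x = 0 <-> x \in L i) ->
  forall i, short_exact (sub_incl L i) (q i).
Proof.
move=> qS qL i; split=> [x y|x|]; [exact: val_inj | | exact: qS].
split=> [/qL xL|[y <-]]; last by apply/qL; exact: valP.
by exists (Submod xL).
Qed.

Lemma ker_short_exact : (forall i, surjective (p i)) ->
  forall i, short_exact (sub_incl ker_sub i) (p i).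
Proof.
by move=> pS; apply: sub_short_exact => // i x; split=> [px|/eqP]; [exact/eqP|].
Qed.

Lemma quot_short_exact (L : subcomplex P) :
  forall i, short_exact (sub_incl L i) (quot_proj L i).
Proof.
by apply: sub_short_exact => i x; [exact: quotmod_piP | exact: quotmod_pi_eq0].
Qed.

Lemma ker_acyclic : (forall i, surjective (p i)) -> quasi_iso p ->
  acyclic (complex_of_sub ker_sub).
Proof.
move=> pS /quasi_isoP[fo fi] i j k e e' z; split=> [dz|[x <-]]; last first.
  exact: (@cdiffK _ (complex_of_sub ker_sub)).
have dz' : cdiff P e' (val z) = 0 := congr1 val dz.
have pz : p j (val z) = cdiff F e 0.
  by rewrite linear0; have /eqP := valP z.
have [w wE] := fi i j k e e' _ _ dz' pz.
have [|y [x [dy py]]] := fo (i + 1) i j erefl e (p i w).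
  by rewrite -chain_mapP -wE pz linear0.
have [x' xE] := pS _ x.
have kI : w - y + cdiff P erefl x' \in kermod (p i).
  by rewrite inE linearD linearB chain_mapP xE py opprD addrA subrr sub0r addNr.
exists (Submod kI); apply: val_inj.
by rewrite /= linearD linearB dy subr0 cdiffK addr0 -wE.
Qed.

End KernelComplex.

Section FlatCycles.
Variables (R : pzRingType) (K : complex R).

Lemma cycles_short_exact : acyclic K -> forall i j (e : i = j + 1),
  short_exact (cycles_incl K i) (to_cycles K e).
Proof.
move=> Ka i j e; split=> [x y|x|[z zZ]]; first exact: val_inj.
- split=> [/(congr1 val) /= dx|[[y yZ] <-]].
    have xZ : x \in kermod (cdiff K (pred_succ i)).
      apply/eqP; move: j e dx; apply: deg_ind; exact.
    by exists (Submod xZ).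
  apply: val_inj => /=; have /eqP := yZ; move: j e; apply: deg_ind; exact.
have /eqP dz := zZ; have [x xE] := (Ka _ _ _ e (pred_succ j) z).1 dz.
by exists x; apply: val_inj.
Qed.

(** Z_j is pure in K_j: an element of X (x) Z_j lifts to X (x) K_(j+1), and
    if it dies in X (x) K_j then its lift is a boundary. *)
Lemma flat_cycles : acyclic K -> (forall i, flat (K i)) ->
  (forall (W : lmodType R^c) i j k (e : i = j + 1) (e' : j = k + 1),
    exact_at (tensor_map (idfun : {linear W -> W}) (cdiff K e))
             (tensor_map (idfun : {linear W -> W}) (cdiff K e'))) ->
  forall j, flat (cycles K j).
Proof.
move=> Ka Kf WK j.
have [_ ex sur] := cycles_short_exact Ka (pred_succ j).
apply: (proj1 (pure_flat (i := cycles_incl K j) (p := to_cycles K (pred_succ j)) _ ex sur (Kf j))).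
move=> X t it.
have [_ _ sur'] := cycles_short_exact Ka (erefl (j + 1)).
have [t' tE] := tensor_map_surj (f := idfun : {linear X -> X})
  (fun x => ex_intro _ x erefl) sur' t.
have [|u uE] := (WK X _ _ _ (erefl (j + 1 + 1)) (erefl (j + 1)) t').1.
  rewrite -it -tE (@tensor_map_comp _ _ _ _ _ _ _ _ _ _ _ idfun (cdiff K erefl)) //.
rewrite -tE -uE (@tensor_map_comp _ _ _ _ _ _ _ _ _ _ _ idfun
  (to_cycles K erefl \o cdiff K erefl)) //.
by apply: tensor_map0r => x; apply: val_inj; rewrite /= cdiffK.
Qed.

End FlatCycles.

(** * Semi-flat complexes over a perfect ring *)

Lemma tree_tensor_acyclic_right (R : pzRingType) (X : complex R^c) (M : complex R) :
  acyclic X -> acyclic (total_tensor X (tree M)).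
Proof. exact/semifree_right_acyclic/(@tree_height R M). Qed.

Lemma tree_tensor_acyclic_left (R : pzRingType) (M : complex R^c) (K : complex R) :
  acyclic K -> acyclic (total_tensor (tree M) K).
Proof. exact/semifree_left_acyclic/(@tree_height R^c M). Qed.

(** W (x) K is acyclic for each right module W: for a semi-free resolution P of W
    with kernel X, the complex P (x) K is acyclic because K is, and X (x) K because
    X is, K being semi-flat. *)
Lemma semi_flat_acyclic_cycles (R : pzRingType) (K : complex R) :
  acyclic K -> semi_flat K -> forall j, flat (cycles K j).
Proof.
move=> Ka [Kf Kt]; apply: flat_cycles => // W; apply: conc_tensor_exact.
have pS := @tree_map_surj _ (conc W).
apply: (total_ses_left (ker_short_exact pS)) => //.
  by apply: Kt; apply: ker_acyclic => //; exact: tree_quasi_iso.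
exact: tree_tensor_acyclic_left.
Qed.

Lemma perfect_contraction (R : pzRingType) (K : complex R) : left_perfect R ->
  acyclic K -> (forall j, flat (cycles K j)) -> exists h, contraction (K := K) h.
Proof.
by move=> Rp Ka Zf; apply: acyclic_projective_contraction => // i; exact: Rp.
Qed.

(** Let K be the kernel of a semi-free resolution P of F. It is acyclic, and
    semi-flat since P and F are; so its cycles are flat, hence projective, and K
    is contractible. Thus Hom(F, N) is acyclic whenever Hom(P, N) is. *)
Lemma perfect_semi_flat_semi_projective (R : pzRingType) (F : complex R) :
  left_perfect R -> semi_flat F -> semi_projective F.
Proof.
move=> Rp [Ff Ft].
have Fp i : projective (F i) by exact: Rp.
split=> // N Na; pose P := tree F.
have pS := @tree_map_surj _ F.
have ses := ker_short_exact pS.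
set K := complex_of_sub (ker_sub (tree_map F)) in ses.
have Kp i : projective (K i).
  have [r rK] := split_retraction (ses i) (@Fp i).
  exact: projective_retract rK (@free_projective _ _).
have Ka : acyclic K by apply: ker_acyclic => //; exact: tree_quasi_iso.
have Kf : semi_flat K.
  split=> [i|X Xa]; first exact: projective_flat.
  apply: (total_ses_right ses Fp); last exact: Ft.
  exact: tree_tensor_acyclic_right.
have [h hK] := perfect_contraction Rp Ka (semi_flat_acyclic_cycles Ka Kf).
apply: (hom_ses_acyclic ses Fp); first exact: tree_hom_acyclic.
exact: contraction_hom_acyclic hK.
Qed.

(** * Pure subcomplexes through cycles *)

Section PureCycles.
Variables (R : pzRingType) (M : complex R).
Implicit Type L : subcomplex M.

Fact cyc_sub_closed L j :
  submod_closed [pred x : M j | (x \in L j) && (cdiff M (pred_succ j) x == 0)].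
Proof.
split; first by rewrite inE rpred0 linear0 eqxx.
move=> a x y; rewrite !inE => /andP[xL /eqP dx] /andP[yL /eqP dy].
by rewrite rpredD ?rpredZ //= linearP dx dy scaler0 addr0.
Qed.
Definition cyc_sub L j : submodule (M j) := Submodule (cyc_sub_closed L j).

Lemma cyc_subP L j x :
  reflect (x \in L j /\ forall k (e : j = k + 1), cdiff M e x = 0) (x \in cyc_sub L j).
Proof.
rewrite inE; apply: (iffP andP) => -[xL dx]; split=> //; last by rewrite dx.
by apply: deg_ind; exact/eqP.
Qed.

Lemma sub_acyclicP L : acyclic (complex_of_sub L) <->
  forall i j (e : i = j + 1) x, x \in cyc_sub L j ->
    exists2 y, y \in L i & cdiff M e y = x.
Proof.
split=> [La i j e x /cyc_subP[xL dx]|H i j k e e' x]; last first.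
  split=> [|[y <-]]; last exact: (@cdiffK _ (complex_of_sub L)).
  move=> /(congr1 val) /= dx.
  have [|y yL yE] := H i j e (val x); last by exists (Submod yL); exact: val_inj.
  apply/cyc_subP; split; first exact: valP.
  move=> k' e''; have kk : k' = k by apply: (addIr 1); rewrite -e' -e''.
  by subst k'; rewrite (eq_irrelevance e'' e').
have [|y yE] := (La i j _ e (pred_succ j) (Submod xL)).1.
  by apply: val_inj; exact: dx.
by exists (val y); [exact: valP | have := congr1 val yE].
Qed.

(** Equivalent to L being a pure subcomplex that is pure-acyclic, in a form that
    is stable under unions of chains and under extensions. *)
Definition pure_cycles L :=
  acyclic (complex_of_sub L) /\ forall j, eqpure (cyc_sub L j).

(** Given a x in L, replace dx by cycles z of L with a z = a dx and lift z to some
    y in L. Then a (x - y) consists of cycles of L, and a solution w of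
    a w = a (x - y) in cycles of L makes y + w the required solution. *)
Lemma pure_cycles_eqpure L : pure_cycles L -> forall j, eqpure (L j).
Proof.
move=> [/sub_acyclicP La Lp] j m n a x axL.
pose d := cdiff M (pred_succ j).
have dax k : d (mxact a x k) = mxact a (d \o x) k by exact: mxact_linear.
have [|z zZ zE] := Lp (j - 1) _ _ a (d \o x).
  move=> k; rewrite -dax; apply/cyc_subP; split; first exact: subcomplex_diff.
  by move=> k' e; exact: cdiffK.
have H l : exists2 y, y \in L j & d y = z l by exact: La.
pose y l := s2val (cid2 (H l)).
have yL l : y l \in L j by rewrite /y; case: cid2.
have yE l : d (y l) = z l by rewrite /y; case: cid2.
have [|w wZ wE] := Lp j _ _ a (fun l => x l - y l).
  move=> k; rewrite mxactB; apply/cyc_subP; split.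
    by rewrite rpredB //; exact: mxact_sub.
  apply: deg_ind; rewrite linearB -/d dax (mxact_linear d a y).
  by rewrite (eq_mxact _ _ yE) zE subrr.
exists (fun l => y l + w l) => [l|k].
  by rewrite rpredD //; have /cyc_subP[] := wZ l.
by rewrite mxactD wE mxactB addrC subrK.
Qed.

Lemma eqpure_restrict (N : lmodType R) (S : submodule N) (T : submodule (submod S))
    (T' : submodule N) :
  (forall x : submod S, x \in T <-> val x \in T') ->
  (forall x, x \in T' -> x \in S) -> eqpure T' -> eqpure T.
Proof.
move=> TT TS Tp m n a x axT.
have E (z : 'I_n -> submod S) k : val (mxact a z k) = mxact a (val \o z) k.
  by rewrite -[LHS]/(submod_incl _) mxact_linear; apply: eq_mxact => l.
have [|y yT yE] := Tp _ _ a (val \o x); first by move=> k; rewrite -E; apply/TT; exact: axT.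
exists (fun l => Submod (TS _ (yT l))) => [l|k]; first by apply/TT; exact: yT.
by apply: val_inj; rewrite !E -yE.
Qed.

End PureCycles.

Section Disk.
Variables (R : pzRingType) (A : lmodType R) (j : int).


Fact disk_closed (k : int) :
  submod_closed [pred x : A | [|| k == j, j == k + 1 | x == 0]].
Proof.
split; first by rewrite inE eqxx !orbT.
move=> a x y; rewrite !inE; case: (k == j) => //=; case: (j == k + 1) => //=.
by move=> /eqP -> /eqP ->; rewrite scaler0 addr0.
Qed.
(** The complex with A in degrees j and j - 1 and the identity as differential,
    encoded by submodules of A as for complexes concentrated in one degree. *)
Definition disk_sub k : submodule A := Submodule (disk_closed k).

Fact disk_diff_subproof k k' (e : k = k' + 1) (x : submod (disk_sub k)) :
  (if k == j then val x else 0) \in disk_sub k'.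
Proof.
rewrite inE; case: ifP => [/eqP <-|_]; last by rewrite eqxx !orbT.
by rewrite -e eqxx orbT.
Qed.
Definition disk_diff_fun k k' (e : k = k' + 1) x : submod (disk_sub k') :=
  Submod (disk_diff_subproof e x).
Fact disk_diff_is_linear k k' (e : k = k' + 1) : linear (disk_diff_fun e).
Proof.
move=> a x y; apply: val_inj; rewrite /=; case: ifP => _ //.
by rewrite scaler0 addr0.
Qed.
HB.instance Definition _ k k' (e : k = k' + 1) := GRing.isLinear.Build R
  (submod (disk_sub k)) (submod (disk_sub k')) *:%R
  (disk_diff_fun e) (disk_diff_is_linear e).
Definition disk_diff k k' (e : k = k' + 1) :
  {linear submod (disk_sub k) -> submod (disk_sub k')} := disk_diff_fun e.

Fact succ_neq (i k : int) : i = k + 1 -> i <> k.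
Proof. by lia. Qed.

Fact disk_diffK k k' k'' (e : k = k' + 1) (e' : k' = k'' + 1) x :
  disk_diff e' (disk_diff e x) = 0.
Proof.
apply: val_inj => /=; case: eqP => // kj'; case: eqP => // kj.
by case: (succ_neq e); rewrite kj kj'.
Qed.
Definition disk : complex R := Complex disk_diffK.

Lemma disk_bounded : bounded disk.
Proof.
exists (j - 1), j => k kj [x xS]; apply: val_inj => /=.
have := xS; rewrite inE => /or3P[/eqP kj'|/eqP jk|/eqP //].
  by case: kj; lia.
by case: kj; lia.
Qed.

Lemma finitely_presented_iso (B : lmodType R) (f : {linear A -> B}) (g : {linear B -> A}) :
  cancel f g -> cancel g f -> finitely_presented A -> finitely_presented B.
Proof.
move=> fK gK [m [n [u [v [uv vS]]]]]; exists m, n, u, (f \o v); split.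
  move=> y; rewrite -uv; split=> [/(congr1 g)|/= ->]; last exact: linear0.
  by rewrite /= fK linear0.
by move=> y; have [x xE] := vS (g y); exists x; rewrite /= xE gK.
Qed.

Lemma disk_finitely_presented : finitely_presented A ->
  forall k, finitely_presented (disk k).
Proof.
move=> Afp k; have [kj|kj] := boolP ((k == j) || (j == k + 1)).
  have inS (x : A) : x \in disk_sub k by rewrite inE orbA kj.
  have inL : linear (fun x => Submod (inS x) : disk k).
    by move=> a x y; apply: val_inj.
  apply: (@finitely_presented_iso _ (mklin inL) (@submod_incl _ _ (disk_sub k))) => //.
  by move=> x; apply: val_inj.
exists 0, 0, \0, \0; split=> [y|y].
  by split=> // _; exists 0; apply/rowP => -[].
exists 0; case: y => y yS; apply: val_inj => /=; have := yS.
by rewrite inE orbA (negbTE kj) => /eqP.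
Qed.

Section DiskMap.
Variables (M : complex R) (phi : {linear A -> M j}).

Definition disk_map_at k : {linear disk k -> M k} :=
  match j =P k with
  | ReflectT e => ecast l {linear A -> M l} e phi \o @submod_incl _ _ (disk_sub k)
  | _ => match j =P k + 1 with
         | ReflectT e => cdiff M e \o (phi \o @submod_incl _ _ (disk_sub k))
         | _ => \0
         end
  end.

Lemma disk_map_top (x : disk j) : disk_map_at j x = phi (val x).
Proof.
by rewrite /disk_map_at; case: eqP => // e; rewrite (eq_irrelevance e erefl).
Qed.

Lemma disk_map_bot k (e : j = k + 1) (x : disk k) :
  disk_map_at k x = cdiff M e (phi (val x)).
Proof.
rewrite /disk_map_at; case: eqP => [jk|_]; first by case: (succ_neq e jk).
by case: eqP => // e'; rewrite (eq_irrelevance e' e).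
Qed.

Lemma disk_map_out k (x : disk k) : j <> k -> j <> k + 1 -> disk_map_at k x = 0.
Proof. by rewrite /disk_map_at; case: eqP => // _; case: eqP. Qed.

Fact disk_map_subproof i k (e : i = k + 1) x :
  disk_map_at k (cdiff disk e x) = cdiff M e (disk_map_at i x).
Proof.
have [ij|ij] := eqVneq j i.
  case: i / ij in e x *; rewrite disk_map_top (disk_map_bot e) /=.
  by rewrite eqxx.
have -> : cdiff disk e x = 0.
  by apply: val_inj; rewrite /= eq_sym (negbTE ij).
rewrite linear0; have [ij'|/eqP ij'] := eqVneq j (i + 1).
  by rewrite (disk_map_bot ij') cdiffK.
by rewrite disk_map_out ?linear0 //; exact/eqP.
Qed.
Definition disk_map : chain_map disk M := mk_chain_map disk_map_subproof.

End DiskMap.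
End Disk.

Section PureSubcomplex.
Variables (R : pzRingType) (M : complex R).
Implicit Type L : subcomplex M.

(** Chain maps out of a disk are linear maps out of its top degree, so lifting
    them along M -> M / L is lifting linear maps along M_j -> M_j / L_j. *)
Lemma pure_subcomplex_eqpure L : pure_subcomplex L -> forall j, eqpure (L j).
Proof.
move=> Lp j; apply: (eqpure_of_lift (p := quotmod_pi (L j))).
  exact: quotmod_pi_eq0.
move=> A Afp phi; have [_ _ lift] := Lp _ (disk_bounded A j) (disk_finitely_presented j Afp).
have [h hE] := lift (disk_map (M := quotient_complex L) phi).
have inS (x : A) : x \in disk_sub A j j by rewrite inE eqxx.
have inL : linear (fun x => Submod (inS x) : disk A j j).
  by move=> a x y; apply: val_inj.
exists (h j \o mklin inL) => x.
have := congr1 (fun f : chain_map _ _ => f j (mklin inL x)) hE.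
by rewrite /= disk_map_top.
Qed.

Lemma pure_acyclic_pure_cycles L : pure_subcomplex L ->
  pure_acyclic (complex_of_sub L) -> pure_cycles L.
Proof.
move=> Lp [La Lz]; split=> // j.
pose T := kermod (cdiff (complex_of_sub L) (pred_succ j)).
apply: (@eqpure_trans _ _ (L j) T); last exact: pure_subcomplex_eqpure.
- move=> x; split=> [/eqP dx|/cyc_subP[_ dx]].
    apply/cyc_subP; split; first exact: valP.
    by apply: deg_ind; exact: (congr1 val dx).
  by apply/eqP; apply: val_inj; exact: dx.
- by move=> x /cyc_subP[].
apply: pure_exact_eqpure (Lz j (j - 1) (pred_succ j)) => x.
split=> [/(congr1 val) /= dx|/eqP dx]; first by rewrite inE dx.
by apply: val_inj.
Qed.

Lemma pure_cycles_eqpure_ker L : pure_cycles L ->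
  forall j, eqpure (kermod (cdiff (complex_of_sub L) (pred_succ j))).
Proof.
move=> [_ Lp] j; apply: (eqpure_restrict (T' := cyc_sub L j)); last exact: Lp.
  move=> x; split=> [/eqP dx|/cyc_subP[_ dx]].
    apply/cyc_subP; split; first exact: valP.
    by apply: deg_ind; exact: (congr1 val dx).
  by apply/eqP; apply: val_inj; exact: dx.
by move=> x /cyc_subP[].
Qed.

End PureSubcomplex.

(** * A maximal pure-acyclic pure subcomplex *)

Section Maximal.
Variables (R : pzRingType) (M : complex R).

Definition sub_le (L L' : subcomplex M) := forall i x, x \in L i -> x \in L' i.

Lemma zero_pure_cycles : exists L : subcomplex M, pure_cycles L.
Proof.
have cl i : submod_closed [pred x : M i | x == 0].
  split; first by rewrite inE eqxx.
  by move=> a x y; rewrite !inE => /eqP -> /eqP ->; rewrite scaler0 addr0.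
have dcl i j (e : i = j + 1) x : x \in Submodule (cl i) -> cdiff M e x \in Submodule (cl j).
  by rewrite !inE => /eqP ->; rewrite linear0.
exists (Subcomplex dcl); split.
  apply/sub_acyclicP => i j e x /cyc_subP[/eqP -> _]; exists 0; last exact: linear0.
  by rewrite inE.
move=> j m n a x ax; exists (fun=> 0) => [l|k]; first exact: rpred0.
have /cyc_subP[/eqP -> _] := ax k.
by rewrite /mxact big1 // => l _; rewrite scaler0.
Qed.

Section Union.
Variable A : set (subcomplex M).
Hypotheses (A0 : exists L, A L)
  (Atot : forall L L', A L -> A L' -> sub_le L L' \/ sub_le L' L).

Definition union_mem i : {pred M i} := fun x => `[< exists2 L, A L & x \in L i >].
Arguments union_mem : clear implicits.

Lemma union_common i n (x : 'I_n -> M i) : (forall k, x k \in union_mem i) ->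
  exists2 L, A L & forall k, x k \in L i.
Proof.
elim: n x => [|n IH] x xU; first by have [L AL] := A0; exists L => // -[].
have [L AL xL] := IH (fun k => x (fintype.lift ord0 k)) (fun k => xU _).
have /asboolP[L' AL' xL'] := xU ord0.
have [LL|LL] := Atot AL AL'.
  exists L' => // k; have [j ->|->//] := unliftP ord0 k.
  exact/LL/xL.
exists L => // k; have [j ->|->] := unliftP ord0 k; first exact: xL.
exact/LL/xL'.
Qed.

Fact union_closed i : submod_closed (union_mem i).
Proof.
split; first by have [L AL] := A0; apply/asboolP; exists L => //; exact: rpred0.
move=> a x y xU yU.
have [|L AL xL] := @union_common i 2 (fun k => if k == ord0 then x else y).
  by move=> k; case: ifP.
apply/asboolP; exists L => //.
by rewrite rpredD ?rpredZ //; [exact: (xL ord0) | exact: (xL ord_max)].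
Qed.

Fact union_diff i j (e : i = j + 1) x :
  x \in Submodule (union_closed i) -> cdiff M e x \in Submodule (union_closed j).
Proof.
move=> /asboolP[L AL xL]; apply/asboolP; exists L => //; exact: subcomplex_diff.
Qed.
Definition union_sub : subcomplex M := Subcomplex union_diff.

Lemma union_le L : A L -> sub_le L union_sub.
Proof. by move=> AL i x xL; apply/asboolP; exists L. Qed.

Lemma union_pure_cycles : (forall L, A L -> pure_cycles L) -> pure_cycles union_sub.
Proof.
move=> Ap; split.
  apply/sub_acyclicP => i j e x /cyc_subP[/asboolP[L AL xL] dx].
  have [/sub_acyclicP La _] := Ap L AL.
  have [|y yL <-] := La i j e x; first exact/cyc_subP.
  by exists y => //; exact: union_le yL.
move=> j m n a x ax.
have [|L AL axL] := @union_common j m (mxact a x).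
  by move=> k; have /cyc_subP[] := ax k.
have [_ /(_ j _ _ a x)[|y yZ yE]] := Ap L AL.
  by move=> k; apply/cyc_subP; split=> //; have /cyc_subP[] := ax k.
exists y => // l; have /cyc_subP[yL dy] := yZ l.
by apply/cyc_subP; split=> //; exact: union_le yL.
Qed.

End Union.

(** Zorn's lemma for the inclusion order, with unions as upper bounds. *)
Lemma maximal_pure_cycles : exists2 L : subcomplex M, pure_cycles L &
  forall L', pure_cycles L' -> sub_le L L' -> sub_le L' L.
Proof.
have [L0 L0p] := zero_pure_cycles.
pose T := {L : subcomplex M | pure_cycles L}.
pose r (s t : T) : bool := `[< sub_le (sval s) (sval t) >].
have [||A Atot|[L Lp] Lmax] := @ZL_preorder T (exist _ L0 L0p) r.
- by move=> t; apply/asboolP.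
- move=> s t u /asboolP st /asboolP tu; apply/asboolP => i x xs; exact/tu/st.
- have [[t At]|A0] := pselect (exists t, A t); last first.
    by exists (exist _ L0 L0p) => s As; case: A0; exists s.
  pose B : set (subcomplex M) := [set L | exists2 s, A s & sval s = L].
  have B0 : exists L, B L by exists (sval t), t.
  have Btot L L' : B L -> B L' -> sub_le L L' \/ sub_le L' L.
    move=> [s As <-] [s' As' <-].
    by have [/asboolP|/asboolP] := Atot s s' As As'; [left|right].
  have Bp L : B L -> pure_cycles L by move=> [s _ <-]; exact: (svalP s).
  exists (exist _ (union_sub B0 Btot) (union_pure_cycles B0 Btot Bp)) => s As.
  by apply/asboolP; apply: union_le; exists s.
exists L => // L' L'p LL'.
by have /asboolP := Lmax (exist _ L' L'p) (asboolT LL').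
Qed.

Section Preimage.
Variables (L : subcomplex M) (N : subcomplex (quotient_complex L)).

Fact preim_closed i : submod_closed [pred x | quotmod_pi (L i) x \in N i].
Proof.
split; first by rewrite inE linear0 rpred0.
by move=> a x y; rewrite !inE linearP => xN yN; rewrite rpredD ?rpredZ.
Qed.
Fact preim_diff i j (e : i = j + 1) x :
  x \in Submodule (preim_closed i) -> cdiff M e x \in Submodule (preim_closed j).
Proof.
by rewrite !inE -(quot_diffE L e) => xN; exact: (subcomplex_diff (s := N) e xN).
Qed.
Definition preim_sub : subcomplex M := Subcomplex preim_diff.

Lemma preim_le : sub_le L preim_sub.
Proof. by move=> i x xL; rewrite inE (quotmod_pi_eq0 _ _).2 // rpred0. Qed.

(** Acyclicity passes to extensions. For purity, solve the system in the cycles of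
    N, lift the solution to cycles y over N, and then solve a z = a (x - y) in the
    cycles of L. *)
Lemma preim_pure_cycles : pure_cycles L -> pure_cycles N -> pure_cycles preim_sub.
Proof.
move=> [/sub_acyclicP La Lp] [/sub_acyclicP Na Np].
have qd i j (e : i = j + 1) x : cdiff (quotient_complex L) e (quotmod_pi (L i) x) =
    quotmod_pi (L j) (cdiff M e x) := quot_diffE L e x.
(* correct any lift of q by an element of L with the same differential *)
have lift j q : q \in cyc_sub N j ->
    exists2 y, y \in cyc_sub preim_sub j & quotmod_pi (L j) y = q.
  have [y <-] := quotmod_piP q => /cyc_subP[yN dy].
  have [|l lL lE] := La j (j - 1) (pred_succ j) (cdiff M (pred_succ j) y).
    apply/cyc_subP; split=> [|k e]; last exact: cdiffK.
    by apply/quotmod_pi_eq0; rewrite -qd dy.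
  have /quotmod_pi_eq0 l0 := lL.
  exists (y - l); last by rewrite quotmod_piB l0 subr0.
  apply/cyc_subP; split; first by rewrite inE quotmod_piB l0 subr0.
  by apply: deg_ind; rewrite linearB lE subrr.
have piZ j x : x \in cyc_sub preim_sub j -> quotmod_pi (L j) x \in cyc_sub N j.
  move=> /cyc_subP[xN dx]; apply/cyc_subP; split=> // k e.
  by rewrite qd dx linear0.
split.
  apply/sub_acyclicP => i j e x xZ; have [q qN qE] := Na i j e _ (piZ j x xZ).
  have [y yE] := quotmod_piP q; subst q.
  have [|l lL lE] := La i j e (x - cdiff M e y).
    have /cyc_subP[_ dx] := xZ; apply/cyc_subP; split=> [|k e'].
      by apply/quotmod_pi_eq0; rewrite quotmod_piB -qd qE subrr.
    by rewrite linearB dx cdiffK subrr.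
  exists (y + l); last by rewrite linearD lE addrC subrK.
  by rewrite inE quotmod_piD (quotmod_pi_eq0 _ l).2 // addr0.
move=> j m n a x ax.
have [|q qZ qE] := Np j _ _ a (quotmod_pi (L j) \o x).
  by move=> k; rewrite -mxact_linear; exact: piZ.
have H l := lift j (q l) (qZ l).
pose y l := s2val (cid2 (H l)).
have yZ l : y l \in cyc_sub preim_sub j by rewrite /y; case: cid2.
have yE l : quotmod_pi (L j) (y l) = q l by rewrite /y; case: cid2.
have [|z zZ zE] := Lp j _ _ a (fun l => x l - y l).
  move=> k; rewrite mxactB; apply/cyc_subP; split.
    apply/quotmod_pi_eq0; rewrite quotmod_piB !(mxact_linear (quotmod_pi (L j))) -qE.
    by apply/eqP; rewrite subr_eq0; apply/eqP/eq_mxact => l; exact/esym/yE.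
  move=> k' e; rewrite linearB; have /cyc_subP[_ ->] := ax k.
  rewrite mxact_linear /mxact big1 ?subrr // => l _ /=.
  by have /cyc_subP[_ ->] := yZ l; rewrite scaler0.
exists (fun l => y l + z l) => [l|k].
  rewrite rpredD //; have /cyc_subP[zL dz] := zZ l.
  by apply/cyc_subP; split=> //; exact: preim_le.
by rewrite mxactD zE mxactB addrC subrK.
Qed.

End Preimage.

(** The preimage of a pure-acyclic pure subcomplex of M / L again has pure cycles,
    so by maximality it is L. *)
Lemma maximal_quotient_pure_minimal (L : subcomplex M) : pure_cycles L ->
  (forall L', pure_cycles L' -> sub_le L L' -> sub_le L' L) ->
  pure_minimal (quotient_complex L).
Proof.
move=> Lp Lmax N Np Na i q qN.
have NL := Lmax _ (preim_pure_cycles Lp (pure_acyclic_pure_cycles Np Na)) (@preim_le L N).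
have [x xE] := quotmod_piP q; rewrite -xE; apply/quotmod_pi_eq0/NL.
by rewrite inE xE.
Qed.

End Maximal.

(** * Pure-minimal resolutions over a perfect ring *)

Section QuotientResolution.
Variables (R : pzRingType) (P : complex R) (L : subcomplex P).
Hypotheses (Pp : semi_projective P) (Rp : left_perfect R) (Lp : pure_cycles L).

Let K := complex_of_sub L.

Lemma pure_quotient_projective i : projective (quotient_complex L i).
Proof.
have Pf : flat (P i) by apply: projective_flat; exact: (proj1 Pp).
by apply: Rp; have [] := eqpure_flat Pf (@pure_cycles_eqpure _ _ _ Lp i).
Qed.

Lemma pure_sub_contraction : exists h, contraction (K := K) h.
Proof.
apply: perfect_contraction => //; first exact: (proj1 Lp).
have Lf j : flat (submod (L j)).
  have Pf : flat (P j) by apply: projective_flat; exact: (proj1 Pp).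
  by have [] := eqpure_flat Pf (@pure_cycles_eqpure _ _ _ Lp j).
by move=> j; have [] := eqpure_flat (Lf j) (@pure_cycles_eqpure_ker _ _ _ Lp j).
Qed.

Lemma pure_quotient_semi_projective : semi_projective (quotient_complex L).
Proof.
split=> [i|N Na]; first exact: pure_quotient_projective.
have [h hK] := pure_sub_contraction.
apply: (hom_ses_acyclic (quot_short_exact L) pure_quotient_projective).
  exact: (proj2 Pp).
exact: contraction_hom_acyclic hK.
Qed.

(** Let h contract L and let r retract P_i onto L_i. Then H = h r is a homotopy
    on P with dH + Hd = 1 on L, so f - f (dH + Hd) is homotopic to f and descends
    to P / L. *)
Lemma quotient_resolution (M : complex R) (f : chain_map P M) : quasi_iso f ->
  exists g : chain_map (quotient_complex L) M, quasi_iso g.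
Proof.
move=> /quasi_isoP[fo fi]; have [h hK] := pure_sub_contraction.
have rE i := split_retraction (quot_short_exact L i) (@pure_quotient_projective i).
pose r i := sval (cid (rE i)).
have rK i (x : K i) : r i (val x) = x by rewrite /r; case: cid => /= s sK; exact: sK.
pose H i j (e : j = i + 1) : {linear P i -> P j} :=
  @submod_incl _ _ (L j) \o (h i j e \o r i).
pose u i : lhom (P i) (M i) := (f i : lhom _ _) -
  (f i \o (cdiff P erefl \o H i (i + 1) erefl) : lhom _ _) -
  (f i \o (H (i - 1) i (pred_succ i) \o cdiff P (pred_succ i)) : lhom _ _).
have uE i j k (e : j = i + 1) (e' : i = k + 1) x : u i x =
    f i x - f i (cdiff P e (H i j e x)) - f i (H k i e' (cdiff P e' x)).
  by subst j; move: k e'; apply: deg_ind.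
have uD i j (e : i = j + 1) x : u j (cdiff P e x) = cdiff M e (u i x).
  rewrite (uE j i (j - 1) e (pred_succ j)) (uE i (i + 1) j erefl e).
  by rewrite cdiffK !linear0 addr0 !linearB -!chain_mapP cdiffK !linear0 addr0.
have uL i x : x \in L i -> u i x = 0.
  move=> xL; rewrite (uE i _ _ erefl (pred_succ i)) -linearB -linearB.
  rewrite -(linear0 (f i)); congr (f i _).
  have rx : r i x = Submod xL := rK i (Submod xL).
  have e1 : H i (i + 1) erefl x = val (h i (i + 1) erefl (Submod xL)).
    by rewrite /H /= rx.
  have rdx : r (i - 1) (cdiff P (pred_succ i) x) =
      cdiff K (pred_succ i) (Submod xL) := rK _ (cdiff K (pred_succ i) (Submod xL)).
  have e2 : H (i - 1) i (pred_succ i) (cdiff P (pred_succ i) x) =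
      val (h (i - 1) i (pred_succ i) (cdiff K (pred_succ i) (Submod xL))).
    by rewrite /H /= rdx.
  have E := congr1 val (hK i (i + 1) (i - 1) erefl (pred_succ i) (Submod xL)).
  by rewrite e1 e2 -addrA -opprD; apply/eqP; rewrite subr_eq0; apply/eqP/esym.
have gE i := linear_factor (g := quotmod_pi (L i)) (u := u i) (@quotmod_piP _ _ (L i))
  (fun x x0 => uL i x ((quotmod_pi_eq0 _ _).1 x0)).
pose g i := sval (cid (gE i)).
have gpi i x : g i (quotmod_pi (L i) x) = u i x by rewrite /g; case: cid => s sE; exact: sE.
have qd i j (e : i = j + 1) x : cdiff (quotient_complex L) e (quotmod_pi (L i) x) =
    quotmod_pi (L j) (cdiff P e x) := quot_diffE L e x.
have gD i j (e : i = j + 1) x : g j (cdiff (quotient_complex L) e x) = cdiff M e (g i x).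
  by have [y <-] := quotmod_piP x; rewrite qd !gpi uD.
exists (mk_chain_map (L := quotient_complex L) gD); apply/quasi_isoP; split.
  move=> i j k e e' m dm; have [y [x [dy fy]]] := fo i j k e e' m dm.
  exists (quotmod_pi (L j) y), (x - f i (H j i e y)).
  rewrite qd dy linear0; split=> //.
  rewrite -[LHS]/(g j _) gpi (uE j i k e e') dy !linear0 addr0 fy.
  by rewrite linearB -chain_mapP addrA.
move=> i j k e e' q x; have [y <-] := quotmod_piP q.
rewrite qd => /quotmod_pi_eq0 dyL; rewrite -[LHS]/(g j _).
have /sub_acyclicP La := proj1 Lp.
have [|l lL lE] := La j k e' (cdiff P e' y).
  by apply/cyc_subP; split=> // k' e''; exact: cdiffK.
have -> : quotmod_pi (L j) y = quotmod_pi (L j) (y - l).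
  by rewrite quotmod_piB (quotmod_pi_eq0 _ l).2 // subr0.
have dy : cdiff P e' (y - l) = 0 by rewrite linearB lE subrr.
rewrite gpi (uE j i k e e') dy !linear0 addr0 => /eqP.
rewrite subr_eq chain_mapP -linearD => /eqP fy.
have [w wE] := fi i j k e e' _ _ dy fy.
by exists (quotmod_pi (L i) w); rewrite qd -wE.
Qed.

End QuotientResolution.

Lemma perfect_pure_minimal_resolution (R : pzRingType) (M : complex R) :
  left_perfect R -> has_pure_minimal_semi_projective_resolution M.
Proof.
move=> Rp; have Pp := tree_semi_projective M.
have [L Lp Lmax] := maximal_pure_cycles (tree M).
have [g gq] := quotient_resolution Pp Rp Lp (tree_quasi_iso M).
exists (quotient_complex L), g; split=> //.
  exact: pure_quotient_semi_projective.
exact: maximal_quotient_pure_minimal.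
Qed.

(** * Lifting chain maps through a pure-acyclic subcomplex *)

Section PureLifting.
Variables (R : pzRingType) (M : complex R) (L : subcomplex M).
Hypothesis Lp : pure_cycles L.

Let K := complex_of_sub L.

Lemma pure_cycles_pure_acyclic : pure_acyclic K.
Proof.
split=> [|i j e]; first exact: (proj1 Lp).
apply: (eqpure_pure_exact (S := kermod (cdiff K (pred_succ i)))).
- move=> x; move: j e; apply: deg_ind.
  by split=> [/(congr1 val) dx|/eqP dx]; [apply/eqP | apply: val_inj].
- exact: (cycles_short_exact (proj1 Lp)).
exact: pure_cycles_eqpure_ker.
Qed.

Lemma chain_map_eq (A B : complex R) (f g : chain_map A B) :
  (forall i x, f i x = g i x) -> f = g.
Proof. by move=> fg; apply/val_inj/dprodP => i; apply: lhomP => x; exact: fg. Qed.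

Section Update.
Variables (A B : complex R) (i : int) (b : forall k, {linear A k -> B k})
  (b' : {linear A i -> B i}).
Definition update k : {linear A k -> B k} :=
  if i =P k is ReflectT e then ecast k {linear A k -> B k} e b' else b k.
Lemma update_in x : update i x = b' x.
Proof. by rewrite /update; case: eqP => // e; rewrite (eq_irrelevance e erefl). Qed.
Lemma update_out k x : i <> k -> update k x = b k x.
Proof. by rewrite /update; case: eqP. Qed.
End Update.

(** Lift degree by degree from the bottom: a lift of the next component commutes
    with the differential up to a map into the cycles of L, which lifts to L. *)
Lemma pure_cycles_lift (A : complex R) : bounded A ->
  (forall i, finitely_presented (A i)) ->
  forall al : chain_map A (quotient_complex L),
  exists be : chain_map A M, chain_map_post (quot_proj L) be = al.
Proof.
move=> [a0 [b0 A0]] Afp al.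
have qd i j (e : i = j + 1) x : cdiff (quotient_complex L) e (quotmod_pi (L i) x) =
    quotmod_pi (L j) (cdiff M e x) := quot_diffE L e x.
pose good (be : forall i, {linear A i -> M i}) i :=
  (forall x, quotmod_pi (L i) (be i x) = al i x) /\
  (forall j (e : i = j + 1) x, be j (cdiff A e x) = cdiff M e (be i x)).
have zero_good be i : i < a0 \/ b0 < i -> good be i.
  move=> iA; have A0i := A0 i iA; split=> [x|j e x].
    rewrite (A0i x) (linear0 (al i)) linear0.
    exact: (linear0 (quotmod_pi (L i))).
  by rewrite (A0i x) !linear0.
have step n : exists be, forall i, i < a0 + n%:Z -> good be i.
  elim: n => [|n [be beP]].
    by exists (fun i => \0) => i; rewrite addr0 => ia; apply: zero_good; left.
  pose i0 := a0 + n%:Z; pose j0 := i0 - 1; pose e0 := pred_succ i0.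
  have j0i : j0 < a0 + n%:Z by rewrite /j0 /i0; lia.
  have [b' b'E] := eqpure_lift (@quotmod_piP _ _ (L i0)) (@quotmod_pi_eq0 _ _ (L i0))
    (@pure_cycles_eqpure _ _ _ Lp i0) (Afp i0) (al i0).
  have [beq bed] := beP j0 j0i.
  pose th : lhom (A i0) (M j0) := (cdiff M e0 \o b' : lhom _ _) - (be j0 \o cdiff A e0 : lhom _ _).
  have thE x : th x = cdiff M e0 (b' x) - be j0 (cdiff A e0 x) by [].
  have thL x : th x \in L j0.
    apply/quotmod_pi_eq0; rewrite thE quotmod_piB beq -qd b'E chain_mapP.
    exact: subrr.
  have thZ x : Submod (thL x) \in kermod (cdiff K (pred_succ j0)).
    apply/eqP; apply: val_inj; rewrite /= linearB cdiffK -bed cdiffK linear0.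
    exact: subrr.
  have thlin : linear (fun x => Submod (thZ x) : cycles K j0).
    move=> c x y; apply: val_inj; apply: val_inj.
    exact: (linearP th).
  have [_ _ tS] := cycles_short_exact (proj1 Lp) e0.
  have tk (x : K i0) : to_cycles K e0 x = 0 <-> x \in kermod (cdiff K (pred_succ i0)).
    by split=> [/(congr1 val) dx|/eqP dx]; [apply/eqP | apply: val_inj].
  have [ga gaE] := eqpure_lift tS tk (@pure_cycles_eqpure_ker _ _ _ Lp i0) (Afp i0) (mklin thlin).
  pose b'' : lhom (A i0) (M i0) := (b' : lhom _ _) - (@submod_incl _ _ (L i0) \o ga : lhom _ _).
  have b''E x : b'' x = b' x - val (ga x) by [].
  have b''q x : quotmod_pi (L i0) (b'' x) = al i0 x.
    apply: etrans (congr1 (quotmod_pi (L i0)) (b''E x)) _.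
    by rewrite quotmod_piB b'E (quotmod_pi_eq0 _ _).2 ?subr0 //; exact: valP.
  have b''d x : cdiff M e0 (b'' x) = be j0 (cdiff A e0 x).
    have gd : cdiff M e0 (val (ga x)) = th x := congr1 (fun z => val (val z)) (gaE x).
    apply: etrans (congr1 (cdiff M e0) (b''E x)) _.
    by rewrite linearB gd (thE x) opprB [LHS]addrC subrK.
  exists (update be b'') => i ia; have [ii|ii] := eqVneq i0 i.
    case: i / ii in ia *; split=> [x|]; first by rewrite update_in.
    apply: deg_ind => x; rewrite update_in update_out; last by rewrite /i0; lia.
    exact: esym (b''d x).
  have ia' : i < a0 + n%:Z by move/eqP: ii; move: ia; rewrite /i0; lia.
  have [bq bd] := beP i ia'; split=> [x|j e x].
    by rewrite update_out //; exact/eqP.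
  rewrite !update_out //; first exact/eqP.
  by move: ia'; rewrite /i0; lia.
have [be beP] := step (`|b0 - a0|%N.+1).
have bg i : good be i.
  have [ia|ia] := boolP (i < a0 + (`|b0 - a0|%N.+1)%:Z); first exact: beP.
  by apply: zero_good; right; lia.
have bd i j (e : i = j + 1) x : be j (cdiff A e x) = cdiff M e (be i x).
  by have [_ ->] := bg i.
exists (mk_chain_map bd); apply: chain_map_eq => i x.
by have [bq _] := bg i; exact: bq.
Qed.

Lemma pure_cycles_pure_subcomplex : pure_subcomplex L.
Proof.
move=> A Ab Afp; split; last exact: pure_cycles_lift.
- move=> f g fg; apply: chain_map_eq => i x; apply: val_inj.
  exact: (congr1 (fun f : chain_map _ _ => f i x) fg).
- move=> h; split=> [h0|[k <-]]; last first.
    apply: chain_map_eq => i x; apply/quotmod_pi_eq0; exact: valP.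
  have hL i x : h i x \in L i.
    by apply/quotmod_pi_eq0; exact: (congr1 (fun f : chain_map _ _ => f i x) h0).
  have klin i : linear (fun x => Submod (hL i x) : K i).
    by move=> c x y; apply: val_inj; exact: (linearP (h i)).
  have kd i j (e : i = j + 1) x :
      mklin (klin j) (cdiff A e x) = cdiff K e (mklin (klin i) x).
    by apply: val_inj; exact: (chain_mapP h).
  by exists (mk_chain_map (L := A) (M := K) kd); apply: chain_map_eq.
Qed.

End PureLifting.

(** * Soft truncations *)

Section Truncation.
Variables (R : pzRingType) (P : complex R) (Z : forall i, submodule (P i)).
Hypotheses (bZ : forall i j (e : i = j + 1) x, cdiff P e x \in Z j)
  (Zd : forall i j (e : i = j + 1) x, x \in Z i -> cdiff P e x = 0).

(** Used with Z the cycles, to split Z_0 off P_0, and with Z the boundaries, as a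
    pure-acyclic subcomplex. *)
Definition trunc_mem i : {pred P i} :=
  [pred x | [|| 0 < i, (i == 0) && (x \in Z i) | x == 0]].

Fact trunc_closed i : submod_closed (@trunc_mem i).
Proof.
rewrite /trunc_mem; split; first by rewrite !inE eqxx !orbT.
move=> a x y; rewrite !inE; case: (0 < i) => //=; case: (i == 0) => /=.
  move=> /orP xZ /orP yZ; apply/orP; left.
  have xZ' : x \in Z i by case: xZ => // /eqP ->; rewrite rpred0.
  have yZ' : y \in Z i by case: yZ => // /eqP ->; rewrite rpred0.
  by rewrite rpredD ?rpredZ.
by move=> /eqP -> /eqP ->; rewrite scaler0 addr0.
Qed.

Lemma trunc_pos i x : 0 < i -> x \in Submodule (@trunc_closed i).
Proof. by move=> i0; rewrite inE /= /trunc_mem /= i0. Qed.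

Lemma trunc_zero i x : i = 0 -> x \in Submodule (@trunc_closed i) <-> x \in Z i.
Proof.
move=> i0; rewrite inE /=; have -> : (0 < i) = false by rewrite i0.
have -> : (i == 0) = true by rewrite i0.
rewrite /=.
by split=> [/orP[//|/eqP ->]|->]; first exact: rpred0.
Qed.

Lemma trunc_neg i x : i < 0 -> x \in Submodule (@trunc_closed i) <-> x = 0.
Proof.
move=> i0; rewrite inE /= /trunc_mem /= ltNge (ltW i0) (lt_eqF i0) /=.
by split=> [/eqP|->].
Qed.

Fact trunc_diff i j (e : i = j + 1) x :
  x \in Submodule (@trunc_closed i) -> cdiff P e x \in Submodule (@trunc_closed j).
Proof.
move=> xT; have [j0|j0|j0] := ltgtP 0 j; first exact: trunc_pos.
- apply/(trunc_neg _ j0); have [i0|i0] := eqVneq i 0; last first.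
    have im : i < 0 by move/eqP: i0; lia.
    by have -> : x = 0 by [apply/(trunc_neg _ im)]; exact: linear0.
  by apply: Zd; apply/(trunc_zero _ i0).
- by apply/(trunc_zero _ (esym j0)); exact: bZ.
Qed.

Definition trunc : subcomplex P := Subcomplex trunc_diff.

End Truncation.

(** * Flat modules as homology of pure-minimal complexes *)

Section FlatFromResolution.
Variables (R : pzRingType) (F : lmodType R) (P : complex R)
  (f : chain_map P (conc F)).
Hypotheses (Ff : flat F) (fq : quasi_iso f) (Pp : semi_projective P)
  (Pm : pure_minimal P).

Lemma exact_off_zero i j k (e : i = j + 1) (e' : j = k + 1) y :
  j != 0 -> cdiff P e' y = 0 -> exists w, cdiff P e w = y.
Proof.
move=> j0 dy; have /quasi_isoP[_ fi] := fq.
have [|w wE] := fi i j k e e' y 0 dy; last by exists w.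
by rewrite linear0; exact: conc_eq0.
Qed.

(** The truncation P -> P / (... -> P_1 -> Z_0 -> 0) has an acyclic target, so it
    is null-homotopic; in degree 0 the homotopy exhibits Z_0 as a summand of P_0. *)
Lemma cycles0_summand : exists u : {linear P (0 - 1) -> P 0},
  forall x, cdiff P (pred_succ 0) (x - u (cdiff P (pred_succ 0) x)) = 0.
Proof.
pose Z i := kermod (cdiff P (pred_succ i)).
have bZ i j (e : i = j + 1) x : cdiff P e x \in Z j by apply/eqP; exact: cdiffK.
have Zd i j (e : i = j + 1) x : x \in Z i -> cdiff P e x = 0.
  by move=> /eqP dx; move: j e; apply: deg_ind.
pose T := trunc bZ Zd; pose Q := quotient_complex T.
have qd i j (e : i = j + 1) x : cdiff Q e (quotmod_pi (T i) x) =
    quotmod_pi (T j) (cdiff P e x) := quot_diffE T e x.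
have Qpos i (q : Q i) : 0 < i -> q = 0.
  move=> i0; have [x <-] := quotmod_piP q.
  by apply/quotmod_pi_eq0; exact: (trunc_pos Z x i0).
have Qa : acyclic Q.
  move=> i j k e e' q; split=> [|[x <-]]; last exact: (@cdiffK _ Q).
  have [j0 _|j0|j0] := ltgtP 0 j; first by exists 0; rewrite (Qpos j q j0) raddf0.
    have [x <-] := quotmod_piP q.
    rewrite -[zdiff _ _ _]/(cdiff Q e' _) qd => /quotmod_pi_eq0 dxT.
    have k0 : k < 0 by lia.
    have dx := (trunc_neg Z _ k0).1 dxT.
    have [|w wE] := @exact_off_zero i j k e e' x _ dx; first by rewrite lt_eqF.
    by exists (quotmod_pi (T i) w); rewrite -wE -qd.
  have [x <-] := quotmod_piP q.
  rewrite -[zdiff _ _ _]/(cdiff Q e' _) qd => /quotmod_pi_eq0 dxT.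
  have k0 : k < 0 by lia.
  have dx := (trunc_neg Z _ k0).1 dxT.
  exists 0; rewrite raddf0; apply/esym/quotmod_pi_eq0.
  apply/(trunc_zero Z _ (esym j0)); apply/eqP.
  by move: k e' dx {dxT k0}; apply: deg_ind.
have [s sE] := null_homotopy (quot_proj T) ((proj2 Pp) Q Qa).
have [u uE] := (proj1 Pp (0 - 1)) _ _ (quotmod_pi (T 0)) (s (0 - 1) 0 (pred_succ 0))
  (@quotmod_piP _ _ (T 0)).
exists u => x; apply/eqP; apply: (trunc_zero Z _ erefl).1.
apply/quotmod_pi_eq0; rewrite quotmod_piB uE.
have s0 : s 0 (0 + 1) erefl x = 0 by exact: Qpos.
have := sE 0 (0 + 1) (0 - 1) erefl (pred_succ 0) x.
by rewrite s0 linear0 add0r => <-; exact: subrr.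
Qed.

Let B i := immod (cdiff P (erefl (i + 1))).

Fact im_trunc i j (e : i = j + 1) x : cdiff P e x \in B j.
Proof. by subst i; apply/asboolP; exists x. Qed.
Fact trunc_im i j (e : i = j + 1) x : x \in B i -> cdiff P e x = 0.
Proof. by move=> /asboolP[y <-]; exact: cdiffK. Qed.

(** The complex ... -> P_2 -> P_1 -> B_0 -> 0. *)
Let L := trunc im_trunc trunc_im.

Let augment : {linear P 0 -> F} := conc_out F 0 \o f 0.

Lemma augment_boundary i (e : i = 0 + 1) x : augment (cdiff P e x) = 0.
Proof. by rewrite /augment /= chain_mapP. Qed.

Lemma augment_surj (a : F) : exists2 y : P 0,
  augment y = a & cdiff P (pred_succ 0) y = 0.
Proof.
have /quasi_isoP[fo _] := fq.
have [|y [x [dy fy]]] := fo _ _ _ (erefl (0 + 1)) (pred_succ 0) (conc_in F 0 a) => //.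
exists y => //; rewrite -[LHS]/(conc_out F 0 (f 0 y)) fy.
by rewrite -[cdiff (conc F) _ _]/0 addr0 conc_inK.
Qed.

Lemma augment_inj (y : P 0) : cdiff P (pred_succ 0) y = 0 -> augment y = 0 -> y \in B 0.
Proof.
move=> dy ay; have /quasi_isoP[_ fi] := fq.
have [|w ->] := fi _ _ _ (erefl (0 + 1)) (pred_succ 0) y 0 dy; last exact: im_trunc.
by rewrite linear0; apply: val_inj; exact: ay.
Qed.

Lemma trunc_cycles0 x : x \in cyc_sub L 0 <-> x \in B 0.
Proof.
split=> [/cyc_subP[xL _]|xB]; first exact/(trunc_zero B x erefl).
by apply/cyc_subP; split=> [|k e]; [apply/(trunc_zero B x erefl) | exact: trunc_im xB].
Qed.

(** As Z_0 is a summand of P_0, move x into Z_0. In Z_0 / B_0 = F the relation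
    a x = 0 gives x = b w with a b = 0 by flatness; subtracting b v, for cycles v
    over w, moves x into B_0. *)
Lemma trunc_eqpure0 : eqpure (cyc_sub L 0).
Proof.
move=> m n a x ax; have [u uE] := cycles0_summand.
pose d := cdiff P (pred_succ 0).
pose r : lhom (P 0) (P 0) := (idfun : lhom _ _) - (u \o d : lhom _ _).
have rE y : r y = y - u (d y) by [].
have dr y : d (r y) = 0 by rewrite rE; exact: uE.
have rax k : mxact a (r \o x) k = mxact a x k.
  rewrite -(mxact_linear r) rE; have /cyc_subP[_ ->] := ax k.
  by rewrite linear0 subr0.
have arx k : mxact a (augment \o (r \o x)) k = 0.
  rewrite -mxact_linear rax; have /trunc_cycles0/asboolP[y <-] := ax k.
  exact: augment_boundary.
have [p [b [w [qE ab]]]] := flat_equation Ff arx.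
pose v j := s2val (cid2 (augment_surj (w j))).
have vE j : augment (v j) = w j by rewrite /v; case: cid2.
have dv j : d (v j) = 0 by rewrite /v; case: cid2.
exists (fun l => r (x l) - mxact b v l) => [l|k]; last first.
  by rewrite mxactB mxact_mul // subr0 rax.
apply/trunc_cycles0/augment_inj.
  rewrite -/d linearB dr (mxact_linear d) /mxact big1 ?subrr // => j _.
  by rewrite /= dv scaler0.
rewrite linearB (mxact_linear augment) -[augment (r (x l))]/((augment \o (r \o x)) l).
by rewrite qE; apply/eqP; rewrite subr_eq0; apply/eqP/eq_mxact => j; exact/esym/vE.
Qed.

Lemma trunc_acyclic : acyclic (complex_of_sub L).
Proof.
apply/sub_acyclicP => i j e x xZ; have /cyc_subP[xL dx] := xZ.
have [j0|j0|j0] := ltgtP 0 j.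
- have [|w wE] := @exact_off_zero i j (j - 1) e (pred_succ j) x _ (dx _ _).
    by rewrite gt_eqF.
  by exists w => //; apply: trunc_pos; lia.
- exists 0; first exact: rpred0.
  by rewrite linear0; apply/esym/(trunc_neg B x j0).
have xB : x \in B j by apply/(trunc_zero B x (esym j0)).
have [w wE] : exists w, cdiff P e w = x.
  by move: xB; subst i; move=> /asboolP.
by exists w => //; apply: trunc_pos; lia.
Qed.

(** dx is a relation over the flat module P_j, hence is generated by cycles of L,
    which lift along d; the difference solves the system in the cycles. *)
Lemma trunc_eqpureS i j (e : i = j + 1) : 0 < i ->
  eqpure (cyc_sub L j) -> eqpure (cyc_sub L i).
Proof.
move=> i0 jp m n a x ax; pose d := cdiff P e.
have xL l : x l \in L i by exact: trunc_pos.
have dxZ l : d (x l) \in cyc_sub L j.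
  apply/cyc_subP; split; first exact: subcomplex_diff.
  by move=> k e'; exact: cdiffK.
have adx k : mxact a (d \o x) k = 0.
  by rewrite -mxact_linear; have /cyc_subP[_ ->] := ax k.
have [p [b [w [dxE ab]]]] := flat_equation (projective_flat (proj1 Pp j)) adx.
have [|w' w'Z w'E] := jp _ _ b w; first by move=> l; rewrite -dxE; exact: dxZ.
have /sub_acyclicP La := trunc_acyclic.
have H k := La i j e (w' k) (w'Z k).
pose v k := s2val (cid2 (H k)).
have vE k : d (v k) = w' k by rewrite /v; case: cid2.
exists (fun l => x l - mxact b v l) => [l|k]; last first.
  by rewrite mxactB mxact_mul // subr0.
apply/cyc_subP; split; first exact: trunc_pos.
move=> k e'; have kj : k = j by apply: (addIr 1); rewrite -e -e'.
subst k; rewrite (eq_irrelevance e' e) -/d linearB (mxact_linear d).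
apply/eqP; rewrite subr_eq0; apply/eqP; rewrite -[LHS]/((d \o x) l) dxE -w'E.
by apply: eq_mxact => k; exact/esym/vE.
Qed.

Lemma trunc_pure_cycles : pure_cycles L.
Proof.
split; first exact: trunc_acyclic.
have pos (n : nat) : eqpure (cyc_sub L n).
  elim: n => [|n IH]; first exact: trunc_eqpure0.
  by apply: (@trunc_eqpureS n.+1 n) => //; lia.
case=> [n|n] //; move=> m k a x ax; exists (fun=> 0) => [l|h]; first exact: rpred0.
have n0 : Negz n < 0 by lia.
have /cyc_subP[/(trunc_neg B _ n0) -> _] := ax h.
by rewrite /mxact big1 // => l _; rewrite scaler0.
Qed.

(** By minimality the truncation vanishes, so B_0 = 0 and F = Z_0, which is a
    summand of P_0. *)
Lemma flat_projective_of_resolution : projective F.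
Proof.
have Lp := trunc_pure_cycles.
have L0 := Pm (pure_cycles_pure_subcomplex Lp) (pure_cycles_pure_acyclic Lp).
have [u uE] := cycles0_summand; pose d := cdiff P (pred_succ 0).
pose r : {linear P 0 -> P 0} := ((idfun : lhom _ _) - (u \o d : lhom _ _) : lhom _ _).
have rE y : r y = y - u (d y) by [].
have aS : surjective (augment \o r).
  move=> y; have [z az dz] := augment_surj y.
  by exists z; rewrite -[LHS]/(augment (r z)) rE /d dz linear0 subr0.
have [|io ioE] := linear_factor (u := r) aS.
  move=> x arx; apply: (L0 0); apply/(trunc_zero B _ erefl)/augment_inj => //.
  by rewrite rE; exact: uE.
apply: (projective_retract (i := io) (r := augment)); last exact: (proj1 Pp).
by move=> y; have [x <-] := aS y; rewrite ioE.
Qed.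

End FlatFromResolution.

(** * The characterization of left perfect rings *)

Lemma flat_projective_of_semi_flat (R : pzRingType) :
  (forall F : complex R, semi_flat F -> semi_projective F) -> left_perfect R.
Proof.
move=> sp F /conc_semi_flat/sp[/(_ 0) Fp _].
exact: projective_retract (conc_inK (F := F)) Fp.
Qed.

Theorem mainTheorem8 (R : pzRingType) :
  (left_perfect R <->
     (forall F : complex R, semi_flat F -> semi_projective F)) /\
  (left_perfect R <->
     (forall M : complex R, has_pure_minimal_semi_projective_resolution M)).
Proof.
split; split.
- by move=> Rp F; exact: perfect_semi_flat_semi_projective.
- exact: flat_projective_of_semi_flat.
- by move=> Rp M; exact: perfect_pure_minimal_resolution.
move=> res F Ff; have [P [f [fq Pp Pm]]] := res (conc F).
exact: flat_projective_of_resolution Ff fq Pp Pm.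
Qed.
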